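(* Fix $\rho<1/2$. There is a constant $d_0=d_0(\rho)>0$ for which the following holds. For all even integers $L\ge4$ and all integers $d\ge d_0$, if $\mathcal{M}$ is an ergodic $\rho$-local Markov chain on state space $\mathcal{I}(T_{L,d})$ with uniform stationary distribution, then $$\tau_{\mathcal{M}(T_{L,d})}\ \ge\ \exp\left\{\frac{L^{d-1}}{d^4\log^2L}\right\}.$$
   Context: For $L$ even, $T_{L,d}$ (the even discrete torus) is the graph on vertex set $V=\{0,\dots,L-1\}^d$ in which two vertices are adjacent if they differ on exactly one coordinate and differ by $1\pmod L$ on that coordinate. $\mathcal{I}(T_{L,d})$ is the set of independent sets of $T_{L,d}$ (sets of vertices spanning no edges). $\log$ is the natural logarithm. A Markov chain $\mathcal{M}$ on state space $\mathcal{I}(T_{L,d})$ with transition probabilities $P_{\mathcal{M}}$ is $\rho$-local if in each step the states of at most $\rho|V|$ vertices are changed: $P_{\mathcal{M}}(I_1,I_2)\neq0\Rightarrow|I_1\triangle I_2|\le\rho|V|$. The mixing time of an ergodic chain $\mathcal{M}$ with stationary distribution $\pi$ on $\mathcal{I}(T_{L,d})$ is $$\tau_{\mathcal{M}(T_{L,d})}=\max_{I}\min\left\{t_0:\ \tfrac12\sum_{J}|P^t(I,J)-\pi(J)|\le\tfrac1e\ \ \forall t>t_0\right\},$$ where $I,J$ range over $\mathcal{I}(T_{L,d})$ and $P^t(I,\cdot)$ is the distribution of the chain at time $t$ when started at $I$. *)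

(* Defs.v *)
From HB Require Import structures.
From mathcomp Require Import all_boot all_order all_algebra.
From mathcomp Require Import all_classical all_reals all_analysis.

Set Implicit Arguments.
Unset Strict Implicit.
Unset Printing Implicit Defensive.

Import Order.TTheory GRing.Theory Num.Theory.

Local Open Scope ring_scope.

Notation torus L d := {ffun 'I_d -> 'I_L}.

Definition differ_by_1_mod (L a b : nat) : bool :=
  (a + 1 == b %[mod L])%N || (b + 1 == a %[mod L])%N.

Definition torus_adj (L d : nat) : rel (torus L d) := fun x y =>
  (#|[set i | x i != y i]| == 1%N) &&
  [forall i, (x i != y i) ==> differ_by_1_mod L (x i) (y i)].

Definition independent (L d : nat) (I : {set torus L d}) : bool :=
  [forall x in I, forall y in I, ~~ torus_adj x y].

Notation indset L d := {I : {set torus L d} | independent I}.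

Definition symdiff (T : finType) (A B : {set T}) : {set T} :=
  (A :\: B) :|: (B :\: A).

Section MarkovChains.
Variables (R : realType) (S : finType).

Definition distribution_on (p : S -> R) : Prop :=
  (forall x, 0 <= p x) /\ \sum_x p x = 1.

Record markov_chain := MarkovChain {
  trans :> S -> S -> R;
  transP : forall x, distribution_on (trans x)
}.

Fixpoint trans_iter (M : markov_chain) (t : nat) (x y : S) : R :=
  if t is t'.+1 then \sum_z trans_iter M t' x z * M z y else (x == y)%:R.

Definition irreducible_chain (M : markov_chain) : Prop :=
  forall x y, exists t, 0 < trans_iter M t x y.

(* The gcd of the return times of every state is 1. *)
Definition aperiodic_chain (M : markov_chain) : Prop :=
  forall x (k : nat),
    (forall t, (0 < t)%N -> 0 < trans_iter M t x x -> (k %| t)%N) -> k = 1%N.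

Definition ergodic (M : markov_chain) : Prop :=
  irreducible_chain M /\ aperiodic_chain M.

Definition stationary (M : markov_chain) (p : S -> R) : Prop :=
  distribution_on p /\ forall y, \sum_x p x * M x y = p y.

Definition uniform_distr : S -> R := fun=> (#|S|%:R)^-1.

Definition tv_dist (p q : S -> R) : R := 2^-1 * \sum_x `|p x - q x|.

Definition mixed_after (M : markov_chain) (p : S -> R) (x : S) : set nat :=
  [set t0 | forall t, (t0 < t)%N ->
     tv_dist (trans_iter M t x) p <= (expR 1)^-1]%classic.

(* For an ergodic chain with stationary distribution p every set mixed_after
   M p x is nonempty, so that each infimum below is a minimum and the mixing
   time is a natural number; the infimum of an empty set would be +oo. *)
Definition mixing_time (M : markov_chain) (p : S -> R) : \bar R :=
  \big[maxe/0%E]_x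
    ereal_inf [set (t0%:R : R)%:E | t0 in mixed_after M p x]%classic.

End MarkovChains.

Arguments uniform_distr R S : clear implicits.

Definition local_chain (R : realType) (L d : nat) (rho : R)
    (M : markov_chain R (indset L d)) : Prop :=
  forall I J : indset L d, M I J != 0 ->
    #|symdiff (val I) (val J)|%:R <= rho * #|{: torus L d}|%:R.

(* Main.v *)
(* A rho-local chain cannot jump over the bottleneck of the nearly balanced
   independent sets, those whose imbalance between the two sublattices is at
   most rho |V| / 2 in absolute value.  For the stationary chain the probabilities
   of leaving the set A of even-dominated states within t steps add up to at most
   t times the size of the bottleneck, and A carries almost half of the mass by
   translation symmetry.  So it is enough that the bottleneck is an
   exp(- L^(d-1) / d^4) fraction of all independent sets.

   Call a unit cube bad if both of its parity classes are substantially occupied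
   or if one of its facets is nearly empty.  A bad cube makes almost all its
   neighbours relaxed (bad in a weaker sense).  Relaxed independent sets of the
   d-cube are rare, by Sapozhenko's containers together with an isoperimetric
   inequality, and reflection positivity (a chessboard estimate) carries this over
   to the torus: k well separated cubes are simultaneously bad with probability at
   most q^k, where q is superpolynomially small in d.

   Cubes that are not bad carry a sign, constant along adjacent ones.  In the box
   [0, L)^d, without wrapping around, the boundary of the set of plus cubes splits
   into closed pieces, one for each cluster of bad cubes; a cluster of m cubes has
   a piece of size O(d^3 m), and isoperimetry fills it with O(d^3 L m) cubes.
   Exponential moments of the total filled volume, by a cluster expansion tilted at
   rate 1 / (d^3 L), show that one sign dominates outside an exp(- c L^(d-1) / d^3)
   fraction of the independent sets.  Then one sublattice is nearly empty, so
   balance leaves the other less than half full by a constant factor, and such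
   sets are exponentially rare in |V|. *)
Require Import Defs.
From HB Require Import structures.
From mathcomp Require Import all_boot all_order all_algebra.
From mathcomp Require Import all_classical all_reals all_analysis.
(* Once more, so that the finite sets shadow the homonyms of the classical ones. *)
From mathcomp Require Import fintype finset fingraph.
From mathcomp Require Import ring lra zify.

Set Implicit Arguments.
Unset Strict Implicit.
Unset Printing Implicit Defensive.

Import Order.TTheory GRing.Theory Num.Theory.

Local Open Scope ring_scope.

(** * Counting subsets of bounded size *)

(** In the chessboard estimate one relaxed cube costs only a factor exp(-g) with g of order 1/(sqrt
    d ln d), which beats no power of d. Hence the two notions: a bad cube forces almost 2d relaxed
    neighbours, and their joint cost, with an exponent of order sqrt d / ln d, beats every power of
    d. As the neighbours of different bad cubes must not overlap, only a net of bad cubes at mutual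
    distance above 2 is charged.

    Wrap-around edges are left out because a closed contour on the torus need not be a boundary; in
    the box it is one, so each piece can be filled.

    The volume filled by a cluster of m cubes is bounded both by a multiple of L m and by a multiple
    of m^2. The first bound permits the tilt 1/(d^3 L); the second gives a small cluster a tilted
    weight of order 1/L, so that the sum over all positions is of order |V|/L = L^(d-1), times a
    superpolynomially small factor. The linear bound alone would leave a term of order |V|. *)

Section SubsetCounting.
Variable R : realType.

Lemma sum_subset_prod (T : finType) (Y : {set T}) (F : T -> R) :
  \sum_(X : {set T} | X \subset Y) \prod_(i in X) F i =
  \prod_(i in Y) (1 + F i).
Proof.
rewrite [RHS](eq_bigr (fun i => (F i + 1))); last by move=> i _; rewrite addrC.
rewrite [RHS]big_mkcond /=.
rewrite [RHS](eq_bigr (fun i => (if i \in Y then F i else 0) + 1)); last first.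
  by move=> i _; case: ifP => // _; rewrite add0r.
rewrite bigA_distr [LHS]big_mkcond /=; apply: eq_bigr => X _.
rewrite -big_mkcond /=; case: ifP => XY.
  by apply: eq_bigr => i iX; rewrite (subsetP XY).
have /subsetPn[x xX xY] := negbT XY.
by rewrite (bigD1 x) //= (negbTE xY) mul0r.
Qed.

(** Weigh X by x ^ #|X|: the weights of all subsets of Y add up to (1 + x) ^ #|Y|, and a counted set
    weighs at least x ^ a because x <= 1. *)
Lemma card_subset_le_markov (T : finType) (Y : {set T}) (a x : R) :
  0 < x -> x <= 1 ->
  #|[set X : {set T} | (X \subset Y) && (#|X|%:R <= a)]|%:R
    <= (1 + x) ^+ #|Y| * expR (- a * ln x).
Proof.
move=> x0 x1; have lnx : ln x <= 0 by exact: ln_le0.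
rewrite -prodr_const -(sum_subset_prod Y (fun=> x)) mulr_suml.
rewrite -sum1_card natr_sum big_mkcond [leRHS]big_mkcond /=.
apply: ler_sum => X _; rewrite inE; case: (X \subset Y) => //=.
case: ifP => [Xa|_]; last by rewrite mulr_ge0 ?expR_ge0 // prodr_ge0 // => *; apply: ltW.
rewrite prodr_const -{1}(lnK x0) -expRM_natl -expRD -[leLHS]expR0 ler_expR.
rewrite -mulrDl; apply: mulr_le0 => //; lra.
Qed.

Lemma card_small_subsets (T : finType) (Y : {set T}) (k : R) :
  0 < k -> k <= 1 ->
  #|[set X : {set T} | (X \subset Y) && (#|X|%:R <= k * #|Y|%:R)]|%:R
    <= expR (#|Y|%:R * (k * (1 - ln k))).
Proof.
move=> k0 k1; apply: (le_trans (card_subset_le_markov _ _ k0 k1)).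
have -> : #|Y|%:R * (k * (1 - ln k)) = #|Y|%:R * k + - (k * #|Y|%:R) * ln k.
  by ring.
rewrite expRD ler_wpM2r ?expR_ge0 // expRM_natl lerXn2r ?nnegrE ?expR_ge0 //.
  by lra.
exact: expR_ge1Dx.
Qed.

Lemma card_subsets_lt_half (k : R) : 0 < k -> k < 1 / 2 -> exists c : R, 0 < c /\
  forall (T : finType) (Y : {set T}),
  #|[set X : {set T} | (X \subset Y) && (#|X|%:R <= (1 / 2 - k) * #|Y|%:R)]|%:R
    <= 2 ^+ #|Y| * expR (- c * #|Y|%:R).
Proof.
move=> k0 k1.
(* The best tilt is close to 1 - 4 k. A square is taken because its exponent cancels the 1/2 in 1/2
   - k, so that the bound on ln (1 - k) leaves a rational inequality in k. *)
pose x := (1 - k) ^+ 2.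
have x0 : 0 < x by rewrite exprn_gt0 //; lra.
have x1 : x <= 1 by rewrite /x expr2; nra.
have lnk : - k / (1 - k) <= ln (1 - k).
  have h : 0 < 1 - k by lra.
  have h2 : 0 <= k / (1 - k) by rewrite divr_ge0 ?ltW.
  have := @le_ln1Dx R (k / (1 - k)) ltac:(lra).
  have -> : 1 + k / (1 - k) = (1 - k)^-1 by field; lra.
  by rewrite lnV ?posrE // mulNr; lra.
have lt : (1 + x) / 2 < expR ((1 / 2 - k) * ln x).
  rewrite /x lnXn; last by lra.
  apply: (@lt_le_trans _ _ (1 + (1 - 2 * k) * (- k / (1 - k)))).
    rewrite -subr_gt0.
    have -> : 1 + (1 - 2 * k) * (- k / (1 - k)) - (1 + (1 - k) ^+ 2) / 2 =
      k^+2 * ((1 + k) / (2 * (1 - k))) by field; lra.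
    by rewrite mulr_gt0 ?exprn_gt0 ?divr_gt0 //; lra.
  apply: le_trans (expR_ge1Dx _).
  have -> : (1 / 2 - k) * (ln (1 - k) *+ 2) = (1 - 2 * k) * ln (1 - k) by field.
  by rewrite lerD2l ler_wpM2l //; lra.
exists ((1 / 2 - k) * ln x - ln ((1 + x) / 2)); split.
  rewrite subr_gt0 -[ltRHS]expRK ltr_ln ?posrE ?expR_gt0 //; lra.
move=> T Y; apply: (le_trans (card_subset_le_markov _ _ x0 x1)).
have -> : (1 + x) ^+ #|Y| = 2 ^+ #|Y| * expR (#|Y|%:R * ln ((1 + x) / 2)).
  rewrite expRM_natl lnK ?posrE ?divr_gt0 //; last by lra.
  by rewrite -exprMn; congr (_ ^+ _); field.
rewrite -mulrA -expRD ler_wpM2l ?exprn_ge0 // ler_expR.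
by rewrite le_eqVlt; apply/orP; left; apply/eqP; ring.
Qed.

End SubsetCounting.

(** * Containers for closed neighbourhoods *)

Section LnTwo.
Variable R : realType.
Lemma ln2_le1 : ln 2 <= 1 :> R.
Proof. by have := @le_ln1Dx R 1 ltac:(lra); rewrite (_ : 1 + 1 = 2 :> R)//; lra. Qed.

Lemma expR_half_le2 : expR (1 / 2) <= 2 :> R.
Proof.
have h : 1 / 2 <= expR (- (1 / 2)) :> R by apply: le_trans (expR_ge1Dx _); lra.
have p := expR_gt0 (1 / 2 : R).
have e : expR (- (1 / 2)) * expR (1 / 2) = 1 :> R by rewrite -expRD addNr expR0.
nra.
Qed.

Lemma ln2_ge_half : 1 / 2 <= ln 2 :> R.
Proof. by rewrite -[leLHS]expRK ler_ln ?posrE ?expR_gt0 // expR_half_le2. Qed.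

End LnTwo.

(** * Numerical inequalities of the container bound: l = ln D, s = sqrt D, M = #|T| *)

Section ContainerNumerics.
Variables (R : realType) (c l s M t : R).
Hypotheses (c0 : 0 < c) (c1 : c <= 1) (l1 : 1 <= l) (s0 : 0 < s) (M0 : 0 < M).
Hypotheses (hD : 24 * 24 * l ^+ 3 <= c * s) (tM : t <= M) (hts : c * M <= t * s).
Let t0 : 0 < t.
Proof. by rewrite -(pmulr_lgt0 _ s0); apply: lt_le_trans hts; rewrite mulr_gt0. Qed.
Let cs0 : 0 < c * s. Proof. by rewrite mulr_gt0. Qed.
Let l0 : 0 < l. Proof. exact: lt_le_trans l1. Qed.

Lemma cs_ge : 24 * 24 * l <= c * s.
Proof.
have l2 : 1 <= l ^+ 2 by exact: exprn_ege1.
apply: le_trans hD; rewrite exprS.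
have := ler_peMr (ltW l0) l2; lra.
Qed.

Lemma s_ge : 24 <= s.
Proof.
have h1 : c * s <= s by rewrite ger_pMl.
have := cs_ge; have := l1; lra.
Qed.

Lemma cover_size (m k m1 m2 : R) : m <= k + m1 + m2 -> k <= 2 * M * l / (s * s) + 1 ->
  s * s <= M -> m1 <= M / (s * s) -> m2 <= 4 * t / s -> m <= 8 * t * l / (c * s).
Proof.
move=> hm hk sM h1 h2.
have -> : 8 * t * l / (c * s) = 4 * l * (t / (c * s)) + 4 * l * (t / (c * s)) by ring.
have tcs : 0 < t / (c * s) by rewrite divr_gt0.
have e1 : M / (s * s) <= t / (c * s).
  rewrite ler_pdivrMr ?mulr_gt0 // mulrAC ler_pdivlMr // mulrA (mulrC M) mulrA.
  by rewrite ler_pM2r.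
have e2 : 1 <= M / (s * s) by rewrite ler_pdivlMr ?mulr_gt0 // mul1r.
have e3 : 2 * M * l / (s * s) = 2 * l * (M / (s * s)) by ring.
have e4 : 4 * t / s = 4 * c * (t / (c * s)).
  by field; rewrite !gt_eqF.
have := ler_wpM2l (ltW l0) e1; have := ler_wpM2r (ltW tcs) c1; have := ler_wpM2r (ltW tcs) l1.
move: (t / (c * s)) (M / (s * s)) e1 e2 e3 e4 hk h1 h2 tcs => x y; lra.
Qed.

Lemma kappa_le : 8 * t * l / (c * s) <= M.
Proof.
rewrite ler_pdivrMr //; have := cs_ge => h.
have h1 := ler_wpM2l (ltW M0) h; have := ler_wpM2r (ltW l0) tM; have := mulr_gt0 M0 l0; lra.
Qed.

Lemma kappa_ge : M <= 8 * t * l / (c * s) * (s * s).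
Proof.
have -> : 8 * t * l / (c * s) * (s * s) = 8 * l * (t * s) / c by field; rewrite !gt_eqF.
rewrite ler_pdivlMr // (mulrC M); apply: (le_trans hts).
by rewrite ler_peMl ?mulr_ge0 ?ltW //; have := l1; lra.
Qed.

Lemma kappa_exp : 8 * t * l / (c * s) * (1 + l) <= 16 * t * l ^+ 2 / (c * s).
Proof.
have -> : 16 * t * l ^+ 2 / (c * s) = 8 * t * l / (c * s) * (2 * l) by ring.
by rewrite ler_pM2l ?divr_gt0 ?mulr_gt0 //; have := l1; lra.
Qed.

Lemma gap_gt0 : 0 < t / (4 * l).
Proof. by rewrite divr_gt0 ?mulr_gt0. Qed.

Lemma gap_le : t / (4 * l) <= M.
Proof.
rewrite ler_pdivrMr ?mulr_gt0 //; apply: (le_trans tM).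
by rewrite ler_peMr ?ltW //; have := l1; lra.
Qed.

Lemma gap_ge : M <= t / (4 * l) * (s * s / 4).
Proof.
have -> : t / (4 * l) * (s * s / 4) = t * s * s / (16 * l) by field; rewrite !gt_eqF.
rewrite ler_pdivlMr ?mulr_gt0 //.
have := ler_wpM2r (ltW s0) hts; have := ler_wpM2l (ltW M0) cs_ge.
have := mulr_gt0 M0 l0; lra.
Qed.

Lemma case_wide : ln 2 * (4 * t / s - t / (4 * l)) <= 4 * t / s - t / (8 * l).
Proof.
have e : t / (8 * l) = (t / (4 * l)) / 2 by field; rewrite gt_eqF.
rewrite e; have := gap_gt0; have := ln2_le1 R; have := ln2_ge_half R.
have : 0 < 4 * t / s by rewrite divr_gt0 ?mulr_gt0.
move: (4 * t / s) (t / (4 * l)) (ln 2) => x y z; nra.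
Qed.

Lemma case_narrow : t / 4 + ln 2 * (- t) <= 4 * t / s - t / (8 * l).
Proof.
have h : t / (8 * l) <= t / 8.
  by rewrite ler_pM2l // lef_pV2 ?posrE ?mulr_gt0 // ler_peMr.
have : 0 < 4 * t / s by rewrite divr_gt0 ?mulr_gt0.
have := ler_wpM2r (ltW t0) (ln2_ge_half R).
rewrite mulrN; move: (4 * t / s) (t / (8 * l)) (ln 2 * t) h => x y z; have := t0; lra.
Qed.

(** The first two terms pay for the two sets of a fingerprint, the bracket is the net gain once they
    are fixed. Payments of order t l^2 / (c s) stay below the gain t / (8 l) once c s dominates l^3,
    which is [hD]. *)
Lemma total_exp : 16 * t * l ^+ 2 / (c * s) + 16 * t * l ^+ 2 / (c * s) +
  (4 * t / s - t / (8 * l)) <= - (t / (16 * l)).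
Proof.
have -> : 4 * t / s = 4 * c * t / (c * s) by field; rewrite !gt_eqF.
have -> : t / (8 * l) = 2 * (t / (16 * l)) by field; rewrite gt_eqF.
have h : (32 * l ^+ 2 + 4 * c) * t / (c * s) <= t / (16 * l).
  rewrite ler_pdivrMr // mulrAC ler_pdivlMr ?mulr_gt0 //.
  have h : (32 * l ^+ 2 + 4 * c) * (16 * l) <= c * s.
    apply: le_trans hD.
    have h1 : c <= l ^+ 2 by apply: (le_trans c1); exact: exprn_ege1.
    have := ler_wpM2r (ltW l0) h1.
    have -> : l ^+ 3 = l ^+ 2 * l by ring.
    have : 0 <= l ^+ 2 * l by rewrite mulr_ge0 ?exprn_ge0 ?ltW.
    lra.
  have := ler_wpM2l (ltW t0) h; lra.
move: h; rewrite mulrDl mulrDl; lra.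
Qed.
End ContainerNumerics.

(** * Fingerprints and containers in a regular graph *)

Section Container.
Variables (T : finType) (r : rel T) (D : nat).
Hypothesis r_sym : symmetric r.
Definition nbrs x : {set T} := [set y | r x y].
Hypothesis r_reg : forall x, #|nbrs x| = D.
Definition nbhd (A : {set T}) : {set T} := [set y | [exists x in A, r x y]].
(** [inner (nbhd A)] is the closure of A, the largest set with the same neighbourhood as A. *)
Definition inner (G : {set T}) : {set T} := [set x | nbrs x \subset G].

Lemma nbhdP (A : {set T}) y : reflect (exists2 x, x \in A & r x y) (y \in nbhd A).
Proof. by rewrite inE; apply: (iffP exists_inP). Qed.

Lemma nbhdS (A B : {set T}) : A \subset B -> nbhd A \subset nbhd B.
Proof.
by move=> /subsetP AB; apply/subsetP => y /nbhdP[x xA rxy]; apply/nbhdP; exists x => //; apply: AB.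
Qed.

Lemma nbhdU (A B : {set T}) : nbhd (A :|: B) = nbhd A :|: nbhd B.
Proof.
apply/setP => y; rewrite in_setU; apply/nbhdP/orP.
  by case=> x /setUP[xA|xB] rxy; [left|right]; apply/nbhdP; exists x.
by case=> /nbhdP[x xA rxy]; exists x => //; rewrite in_setU xA ?orbT.
Qed.

Lemma sub_inner_nbhd (A : {set T}) : A \subset inner (nbhd A).
Proof.
apply/subsetP => x xA; rewrite inE; apply/subsetP => y; rewrite inE => rxy.
by apply/nbhdP; exists x.
Qed.

Lemma nbhd_inner (A : {set T}) : nbhd (inner (nbhd A)) = nbhd A.
Proof.
apply/eqP; rewrite eqEsubset (nbhdS (sub_inner_nbhd A)) andbT.
apply/subsetP => y /nbhdP[x]; rewrite inE => /subsetP h rxy.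
by apply: h; rewrite inE.
Qed.

Lemma edge_sym (A B : {set T}) :
  (\sum_(x in A) #|nbrs x :&: B| = \sum_(y in B) #|nbrs y :&: A|)%N.
Proof.
have aux x (C : {set T}) : #|nbrs x :&: C| = (\sum_(y in C | r x y) 1)%N.
  by rewrite -sum1_card; apply: eq_bigl => y; rewrite !inE andbC.
under eq_bigr => x _ do rewrite aux.
under [RHS]eq_bigr => x _ do rewrite aux.
rewrite (exchange_big_dep (mem B)) //=; last by move=> x y _ /andP[].
by apply: eq_bigr => y yB; apply: eq_bigl => x; rewrite yB r_sym.
Qed.

Lemma sum_nbrs (A : {set T}) : (\sum_(x in A) #|nbrs x| = D * #|A|)%N.
Proof. by under eq_bigr => x _ do rewrite r_reg; rewrite sum_nat_const mulnC. Qed.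

(** Each chosen vertex covers at least psi points of U not covered before. *)
Lemma greedy_cover (W U : {set T}) (psi : nat) : (0 < psi)%N ->
  exists X : {set T}, [/\ X \subset W, (#|X| * psi <= #|U|)%N &
    forall v, v \in W -> (#|nbrs v :&: (U :\: nbhd X)| < psi)%N].
Proof.
move=> psi0; have [m] := ubnP #|U|; elim: m U => // m IH U Um.
have [/existsP[v /andP[vW hv]]|/existsPn none] := boolP [exists v, (v \in W) && (psi <= #|nbrs v :&: U|)%N]; last first.
  exists set0; split; rewrite ?sub0set ?cards0 // => v vW.
  have := none v; rewrite vW /= -ltnNge; apply: leq_ltn_trans.
  by apply: subset_leq_card; rewrite setIS // subsetDl.
have cU := cardsID (nbrs v) U; rewrite setIC in cU.
have [|X [XW Xc Xh]] := IH (U :\: nbrs v); first lia.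
exists (v |: X); split.
- by rewrite subUset sub1set vW.
- by have := cardsU1 v X; case: (v \in X) => /=; nia.
- move=> w wW; apply: leq_ltn_trans (Xh w wW); apply: subset_leq_card.
  apply/subsetP => y; rewrite !inE => /andP[-> /andP[h ->]].
  rewrite andbT /= andbC; apply/andP; split.
    by apply: contra h => rvy; apply/exists_inP; exists v => //; rewrite setU11.
  apply: contra h => /exists_inP[x xX rxy]; apply/exists_inP; exists x => //.
  by rewrite in_setU1 xX orbT.
Qed.

(* Double counting: as long as some of U is uncovered, one vertex of W covers a
   proportion D / (2 |T|) of what is left. *)
Lemma fractional_cover (W U : {set T}) (k : nat) :
  (forall y, y \in U -> D <= 2 * #|nbrs y :&: W|)%N ->
  exists X : {set T}, [/\ X \subset W, (#|X| <= k)%N &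
   (#|U :\: nbhd X| * (2 * #|T|) ^ k <= #|T| * (2 * #|T| - D) ^ k)%N].
Proof.
move=> hU; elim: k => [|k [X [XW Xk HX]]].
  exists set0; split; rewrite ?sub0set ?cards0 // !muln1.
  by apply: leq_trans (max_card _); rewrite -/(#|T|); apply: subset_leq_card; apply: subset_predT.
set U' := U :\: nbhd X in HX *.
have [/existsP[v /andP[vW hv]]|/existsPn none] := boolP [exists v, (v \in W) && (#|U'| * D <= 2 * #|T| * #|nbrs v :&: U'|)%N].
  exists (v |: X); split.
  - by rewrite subUset sub1set vW.
  - by have := cardsU1 v X; case: (v \in X) => /=; lia.
  - have -> : U :\: nbhd (v |: X) = U' :\: nbrs v.
      rewrite nbhdU [nbhd [set v] :|: _]setUC /U' setDDl; congr (_ :\: (_ :|: _)).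
      apply/setP => y; rewrite [RHS]inE; apply/nbhdP/idP => [[x /set1P -> //]|h].
      by exists v; rewrite ?set11.
    have cU := cardsID (nbrs v) U'; rewrite setIC in cU.
    rewrite !expnS.
    have h1 : (#|U' :\: nbrs v| * (2 * #|T|) <= #|U'| * (2 * #|T| - D))%N by nia.
    nia.
have [U0|[y yU]] := set_0Vmem U'.
  by exists X; split; rewrite ?(leqW Xk) // -/U' U0 cards0.
have T0 : (0 < #|T|)%N by apply/card_gt0P; exists y.
have le : (\sum_(v in W) (2 * #|T| * #|nbrs v :&: U'| + 1) <= \sum_(v in W) #|U'| * D)%N.
  apply: leq_sum => v vW; have := none v; rewrite vW /= -ltnNge addn1; exact.
have ge : (\sum_(y in U') D <= \sum_(y in U') 2 * #|nbrs y :&: W|)%N.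
  by apply: leq_sum => z zU; apply: hU; move: zU; rewrite in_setD => /andP[].
rewrite big_split /= -!big_distrr /= !sum_nat_const edge_sym in le ge.
rewrite muln1 in le.
have WT : (#|W| <= #|T|)%N by exact: max_card.
have W0 : #|W| = 0%N.
  have h : (#|W| * (#|U'| * D) <= #|T| * (#|U'| * D))%N by rewrite leq_mul2r WT orbT.
  have h' := leq_mul (leqnn #|T|) ge.
  clear -le h h'; move: (\sum_(_ in _) _)%N #|W| #|T| #|U'| le h h' => a b c e; nia.
have D0 : D = 0%N.
  have /hU : y \in U by move: yU; rewrite in_setD => /andP[].
  by rewrite (cards0_eq W0) setI0 cards0 muln0 leqn0 => /eqP.
exists X; split; rewrite ?(leqW Xk) //.
rewrite -/U'; move: HX; rewrite D0 subn0 !expnS => HX.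
by rewrite mulnCA [leqRHS]mulnCA leq_mul2l HX orbT.
Qed.

(** Both approximations are functions of the fingerprint (X1, X3) alone, so counting fingerprints
    counts containers. *)
Definition approx_inner (psi : nat) (X1 X3 : {set T}) : {set T} :=
  [set v | #|nbrs v :\: nbhd X1| < psi]%N :\: nbhd X3.
Definition approx_nbhd (psi : nat) (X1 X3 : {set T}) : {set T} :=
  nbhd X1 :|: [set w | psi <= #|nbrs w :&: approx_inner psi X1 X3|]%N.

(** Double counting of the edges between the closure and [nbhd A]. If [nbhd A] has t points more
    than the closure, exactly D t edges lead from it out of the closure. *)
Lemma inner_edges (A : {set T}) :
  (\sum_(y in nbhd A) #|nbrs y :\: inner (nbhd A)| + D * #|inner (nbhd A)| = D * #|nbhd A|)%N.
Proof.
set G := nbhd A; set W := inner G.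
have -> : (D * #|W| = \sum_(y in G) #|nbrs y :&: W|)%N.
  rewrite edge_sym -sum_nbrs; apply: eq_bigr => x; rewrite inE => xW.
  by rewrite (setIidPl xW).
by rewrite -big_split /= -sum_nbrs; apply: eq_bigr => y _; rewrite addnC cardsID.
Qed.

(* Sapozhenko's approximation.  X1 covers the vertices of [nbhd A] with at least half
   of their neighbours in the closure of A, fractionally (k steps, m1 leftovers) and
   then greedily (m2); X3, outside [nbhd A], expels all but few of the points that
   look as if they belonged to the closure.  psi is going to be about sqrt D. *)
Lemma container (A : {set T}) (t psi k : nat) :
  #|nbhd A| = (#|inner (nbhd A)| + t)%N -> (0 < psi)%N -> (2 * psi <= D)%N ->
  exists (X1 X3 : {set T}) m1 m2,
   [/\ (#|X1| <= k + m1 + m2)%N /\ (m1 * (2 * #|T|) ^ k <= #|T| * (2 * #|T| - D) ^ k)%N,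
       (m2 * psi <= 2 * t)%N /\ (#|X3| * psi <= 2 * t)%N,
       inner (nbhd A) \subset approx_inner psi X1 X3,
       approx_nbhd psi X1 X3 \subset nbhd A &
       (D * #|approx_inner psi X1 X3| <= D * #|approx_nbhd psi X1 X3| + 4 * t * psi)%N].
Proof.
set G := nbhd A; set W := inner G => Gt psi0 psiD.
have D0 : (0 < D)%N by lia.
have out : (\sum_(y in G) #|nbrs y :\: W| = D * t)%N.
  by have := inner_edges A; rewrite -/G -/W Gt; lia.
have nbW x : x \in W -> nbrs x \subset G by rewrite inE.
pose Gh := [set y in G | D <= 2 * #|nbrs y :&: W|]%N.
(* A point of G outside Gh sends more than D / 2 of its edges out of the closure, and there are only
   D t such edges. *)
have cGh : (#|G :\: Gh| <= 2 * t)%N.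
  rewrite -(leq_pmul2l D0) -(sum_nbrs (G :\: Gh)).
  apply: (@leq_trans (\sum_(y in G) 2 * #|nbrs y :\: W|)%N); last first.
    by rewrite -big_distrr /= out; lia.
  rewrite [leqRHS](big_setID Gh) /= (setIidPr _); last by apply/subsetP => y; rewrite inE => /andP[].
  apply: leq_trans (leq_addl _ _); apply: leq_sum => y; rewrite !inE => /andP[h yG].
  move: h; rewrite yG /= -ltnNge => h.
  by have := cardsID W (nbrs y); rewrite r_reg; lia.
have [|X0 [X0W X0k HX0]] := @fractional_cover W Gh k.
  by move=> y; rewrite inE => /andP[].
pose f y := odflt y [pick x in nbrs y :&: W].
have fP y : y \in Gh -> f y \in W /\ r (f y) y.
  rewrite inE => /andP[_ h]; rewrite /f; case: pickP => [x /setIP[]|h0].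
    by rewrite inE r_sym.
  by move: h; rewrite (eq_card0 h0) muln0 leqNgt D0.
pose Xr := f @: (Gh :\: nbhd X0).
have XrW : Xr \subset W.
  by apply/subsetP => _ /imsetP[y /setDP[yG _] ->]; have [] := fP y yG.
have [X2 [X2W X2c X2h]] := greedy_cover W (G :\: nbhd (X0 :|: Xr)) psi0.
pose X1 := X0 :|: Xr :|: X2.
have GhX1 : Gh \subset nbhd (X0 :|: Xr).
  apply/subsetP => y yG; rewrite nbhdU in_setU.
  have [//|yn] := boolP (y \in nbhd X0); apply/nbhdP; exists (f y).
    by apply: imset_f; rewrite in_setD yn.
  by have [] := fP y yG.
have X1W : X1 \subset W by rewrite !subUset X0W XrW.
have X1G : nbhd X1 \subset G by rewrite /G -(nbhd_inner A); apply: nbhdS.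
pose S2 := [set v | #|nbrs v :\: nbhd X1| < psi]%N.
have WS2 : W \subset S2.
  apply/subsetP => v vW; rewrite inE; apply: leq_ltn_trans (X2h v vW).
  apply: subset_leq_card; rewrite /X1 (nbhdU _ X2) setDDl setIDA.
  by rewrite (setIidPl (nbW v vW)).
(* A vertex of S2 has fewer than psi <= D / 2 neighbours outside [nbhd X1], hence at least D / 2
   inside G; those of S2 outside W share the same D t edges. *)
have cS2 : (#|S2 :\: W| <= 2 * t)%N.
  rewrite -(leq_pmul2l D0).
  have e1 : (\sum_(v in S2 :\: W) #|nbrs v :&: G| <= D * t)%N.
    rewrite edge_sym -out; apply: leq_sum => y _; apply: subset_leq_card.
    by rewrite setIDA setSD // subsetIl.
  have e2 : (\sum_(v in S2 :\: W) D <= \sum_(v in S2 :\: W) 2 * #|nbrs v :&: G|)%N.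
    apply: leq_sum => v /setDP[]; rewrite inE => h _.
    have := cardsID (nbhd X1) (nbrs v); rewrite r_reg.
    have := subset_leq_card (setIS (nbrs v) X1G); lia.
  move: e2; rewrite sum_nat_const -big_distrr /=; lia.
(* X3 lies outside G, so its neighbours lie outside the closure and deleting them loses nothing of
   W. Afterwards every point outside G has fewer than psi neighbours in S. *)
have [X3 [X3W X3c X3h]] := greedy_cover (~: G) (S2 :\: W) psi0.
have nbC w : w \notin G -> nbrs w :&: W = set0.
  move=> wG; apply/eqP; rewrite -subset0; apply/subsetP => x /setIP[]; rewrite !inE => rwx.
  by move=> /subsetP /(_ w); rewrite inE r_sym (negbTE wG) => /(_ rwx).
pose S := approx_inner psi X1 X3; pose F := approx_nbhd psi X1 X3.
have SE : S = S2 :\: nbhd X3 by [].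
have WS : W \subset S.
  rewrite SE subsetD WS2 /= disjoints_subset; apply/subsetP => w wW; rewrite in_setC.
  apply/nbhdP => -[x xX3 rxw]; have := subsetP X3W x xX3; rewrite in_setC => /negP; apply.
  by apply: (subsetP (nbW w wW)); rewrite inE r_sym.
have FG : F \subset G.
  rewrite subUset X1G; apply/subsetP => w; rewrite inE; apply: contraTT => wG.
  rewrite -ltnNge; apply: leq_ltn_trans (X3h w _); last by rewrite in_setC.
  apply: subset_leq_card; rewrite -/S SE; apply/subsetP => x /setIP[xw /setDP[x2 x3]].
  rewrite in_setI xw in_setD x3 in_setD x2 /= andbT.
  by apply/negP => xW; have := in_set0 x; rewrite -(nbC w wG) in_setI xw xW.
have GF : (#|G :\: F| <= 2 * t)%N.
  apply: leq_trans cGh; apply: subset_leq_card; apply: setDS.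
  apply: subset_trans GhX1 _; apply: subset_trans (subsetUl _ _).
  by apply: nbhdS; exact: subsetUl.
exists X1, X3, #|Gh :\: nbhd X0|, #|X2|; split => //.
- split => //; rewrite /X1.
  have [h1 _] := leq_card_setU (X0 :|: Xr) X2; have [h2 _] := leq_card_setU X0 Xr.
  have h3 : (#|Xr| <= #|Gh :\: nbhd X0|)%N := leq_imset_card f _.
  by apply: leq_trans h1 _; rewrite leq_add2r; apply: leq_trans h2 _; apply: leq_add.
- split; last by apply: leq_trans X3c _.
  apply: leq_trans X2c _; apply: leq_trans cGh; apply: subset_leq_card.
  exact: setDS.
(* Edges from S into F number at most D #|F|. The others start at one of the at most 2 t points of S
   outside W, each with fewer than psi neighbours outside F, or run from W to one of the at most 2 t
   points of G outside F, each with fewer than psi neighbours in S. *)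
rewrite -/S -/F -(sum_nbrs S).
have -> : (\sum_(x in S) #|nbrs x| = \sum_(x in S) #|nbrs x :&: F| + \sum_(x in S) #|nbrs x :\: F|)%N.
  by rewrite -big_split; apply: eq_bigr => x _; rewrite /= cardsID.
apply: leq_add.
  rewrite edge_sym -(sum_nbrs F); apply: leq_sum => y _; exact/subset_leq_card/subsetIl.
rewrite (big_setID W) /= (setIidPr WS).
have h1 : (\sum_(x in S :\: W) #|nbrs x :\: F| <= \sum_(x in S2 :\: W) psi)%N.
  rewrite [leqRHS](big_setID (S :\: W)) /=.
  have SW : S :\: W \subset S2 :\: W by rewrite setSD // SE subsetDl.
  rewrite (setIidPr SW); apply: leq_trans (leq_addr _ _); apply: leq_sum => x /(subsetP SW) /setDP[].
  rewrite inE => h _; apply: ltnW; apply: leq_ltn_trans h; apply: subset_leq_card.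
  by apply: setDS; exact: subsetUl.
have h2 : (\sum_(x in W) #|nbrs x :\: F| <= \sum_(y in G :\: F) psi)%N.
  have -> : (\sum_(x in W) #|nbrs x :\: F| = \sum_(x in W) #|nbrs x :&: (G :\: F)|)%N.
    by apply: eq_bigr => x xW; rewrite setIDA (setIidPl (nbW x xW)).
  rewrite edge_sym; apply: leq_sum => y /setDP[_]; rewrite in_setU negb_or inE => /andP[_].
  rewrite -ltnNge => h; apply: ltnW; apply: leq_ltn_trans h; apply: subset_leq_card.
  exact: setIS.
move: h1 h2; rewrite !sum_nat_const => h1 h2.
have k1 := leq_trans h1 (leq_mul cS2 (leqnn psi)).
have k2 := leq_trans h2 (leq_mul GF (leqnn psi)).
by apply: leq_trans (leq_add k2 k1) _; rewrite -mulnDl -mulnDl.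
Qed.

Variable R : realType.

Definition pow2 (x : R) : R := expR (ln 2 * x).

Lemma pow2D x y : pow2 (x + y) = pow2 x * pow2 y.
Proof. by rewrite /pow2 mulrDr expRD. Qed.

Lemma pow2_ge0 x : 0 <= pow2 x.
Proof. exact: expR_ge0. Qed.

Lemma ler_pow2 x y : (pow2 x <= pow2 y) = (x <= y).
Proof. by rewrite ler_expR ler_pM2l // ln_gt0 //; lra. Qed.

Lemma pow2_nat n : pow2 n%:R = 2 ^+ n.
Proof. by rewrite /pow2 mulrC expRM_natl lnK // posrE. Qed.

(** The number of sets that avoid [nbhd A]; in the cube, of the second slices compatible with a
    first slice A. *)
Definition weight (A : {set T}) : R := pow2 (#|T|%:R - #|nbhd A|%:R).
Definition few (a : R) : R := #|[set X : {set T} | #|X|%:R <= a]|%:R.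

Lemma sum_subsets (S : {set T}) (P : pred {set T}) (c : R) : 0 <= c ->
  \sum_(A : {set T} | P A && (A \subset S)) c <= pow2 #|S|%:R * c.
Proof.
move=> c0; rewrite pow2_nat -natrX -card_powerset -mulr_natl mulr1.
have -> : #|powerset S|%:R * c = \sum_(A : {set T} | A \subset S) c.
  by rewrite sumr_const mulr_natl; congr (_ *+ _); apply: eq_card => X; rewrite powersetE.
by rewrite big_mkcond [leRHS]big_mkcond ler_sum // => A _; case: (P A) => //=; case: ifP.
Qed.

(* If much of [nbhd A] is missing from F, the weight is small; otherwise the few
   possible differences determine the closure of A, which has t points less than
   [nbhd A]. *)
Lemma sum_weight_given (S F : {set T}) (t : nat) (a : R) : 0 <= a ->
  \sum_(A : {set T} | [&& F \subset nbhd A, #|nbhd A| == #|inner (nbhd A)| + t & A \subset S]%N)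
     weight A <=
  pow2 (#|S|%:R + #|T|%:R - #|F|%:R - a) + few a * pow2 (#|T|%:R - t%:R).
Proof.
move=> a0; rewrite (bigID (fun A => #|nbhd A :\: F|%:R <= a)) /= addrC; apply: lerD.
  apply: (@le_trans _ _ (\sum_(A : {set T} | true && (A \subset S)) pow2 (#|T|%:R - #|F|%:R - a))).
    rewrite big_mkcond [leRHS]big_mkcond ler_sum //= => A _.
    case: (A \subset S); rewrite ?andbF //= andbT.
    case: ifP => [/andP[/andP[FA _] h]|_]; last exact: pow2_ge0.
    rewrite /weight ler_pow2 -(cardsID F (nbhd A)) (setIidPr FA) natrD.
    by move: h; rewrite -ltNge; lra.
  apply: (le_trans (sum_subsets _ _ (pow2_ge0 _))).
  by rewrite -pow2D ler_pow2; lra.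
rewrite (partition_big (fun A => nbhd A :\: F) (fun Y : {set T} => #|Y|%:R <= a)) /=; last first.
  by move=> A /andP[].
rewrite /few -sum1_card natr_sum mulr_suml.
rewrite [leRHS](eq_bigl (fun Y : {set T} => #|Y|%:R <= a)); last by move=> Y; rewrite inE.
apply: ler_sum => Y Ya; rewrite mul1r.
pose G := F :|: Y.
have GA (A : {set T}) : F \subset nbhd A -> nbhd A :\: F = Y -> nbhd A = G.
  move=> FA YE; apply/setP => y; rewrite /G -YE in_setU in_setD.
  by case: (boolP (y \in F)) => // yF; rewrite (subsetP FA y yF).
have [tG|tG] := boolP (#|G| == #|inner G| + t)%N; last first.
  rewrite big_pred0 ?pow2_ge0 // => A; apply/negP => /andP[/andP[/and3P[FA tA _] _] /eqP YE].
  by move/negP: tG; apply; rewrite -(GA A).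
apply: (@le_trans _ _ (\sum_(A : {set T} | true && (A \subset inner G)) pow2 (#|T|%:R - #|G|%:R))).
  rewrite big_mkcond [leRHS]big_mkcond ler_sum //= => A _.
  case: ifP => [/andP[/andP[/and3P[FA _ _] _] /eqP YE]|_]; last by case: ifP => // _; exact: pow2_ge0.
  by rewrite -(GA A) // sub_inner_nbhd.
apply: (le_trans (sum_subsets _ _ (pow2_ge0 _))).
rewrite -pow2D ler_pow2 (eqP tG) natrD; lra.
Qed.

Lemma few_le (k y : R) : 0 < k -> k <= #|T|%:R -> #|T|%:R <= k * y ->
  few k <= expR (k * (1 + ln y)).
Proof.
move=> k0 kT Ty; have T0 : 0 < #|T|%:R :> R by apply: lt_le_trans kT.
have y0 : 0 < y by rewrite -(pmulr_rgt0 _ k0); apply: lt_le_trans Ty.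
have := @card_small_subsets R T setT (k / #|T|%:R).
rewrite divr_gt0 // ler_pdivrMr // mul1r kT => /(_ isT isT).
rewrite cardsT divfK ?gt_eqF // => h.
have -> : few k = #|[set X : {set T} | (X \subset setT) && (#|X|%:R <= k)]|%:R.
  by congr (_%:R); apply: eq_card => X; rewrite !inE subsetT.
apply: (le_trans h); rewrite ler_expR mulrA (mulrC #|T|%:R) divfK ?gt_eqF //.
rewrite ler_pM2l // lerD2l -lnV ?posrE ?divr_gt0 // ler_ln ?posrE ?invr_gt0 ?divr_gt0 //.
by rewrite invf_div ler_pdivrMr // mulrC.
Qed.

Lemma geometric_decay (m k N d : nat) : (d <= 2 * N)%N -> (0 < N)%N ->
  (m * (2 * N) ^ k <= N * (2 * N - d) ^ k)%N ->
  m%:R <= N%:R * expR (- (k%:R * (d%:R / (2 * N%:R)))) :> R.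
Proof.
move=> dN N0; rewrite -(@ler_nat R) natrM natrX natrM natrM natrX natrB // natrM => h.
have Nr : 0 < N%:R :> R by rewrite ltr0n.
have dr : d%:R <= 2 * N%:R :> R by rewrite -natrM ler_nat.
have h2 : ((2 * N%:R - d%:R) / (2 * N%:R)) ^+ k <= expR (- (k%:R * (d%:R / (2 * N%:R)))) :> R.
  have a0 : 0 <= (2 * N%:R - d%:R) / (2 * N%:R) :> R by apply: divr_ge0; lra.
  rewrite -mulrN expRM_natl lerXn2r ?nnegrE ?expR_ge0 //.
  by apply: le_trans (expR_ge1Dx _); rewrite le_eqVlt; apply/orP; left; apply/eqP; field; lra.
apply: le_trans (ler_wpM2l (ltW Nr) h2).
by rewrite expr_div_n mulrA ler_pdivlMr //; apply: exprn_gt0; lra.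
Qed.

Section Count.
Variables (c l s M : R) (t : nat).
Hypotheses (lE : l = ln D%:R) (sE : s = Num.sqrt D%:R) (ME : M = #|T|%:R).
Hypotheses (c0 : 0 < c) (c1 : c <= 1) (D0 : (0 < D)%N) (l1 : 1 <= l).
Hypotheses (hD : 24 * 24 * l ^+ 3 <= c * s) (DT : (D <= #|T|)%N).
Hypotheses (tT : (t <= #|T|)%N) (hts : c * M <= t%:R * s).
Let kappa : R := 8 * t%:R * l / (c * s).
Let ss : s * s = D%:R.
Proof. by rewrite sE -expr2 sqr_sqrtr // ler0n. Qed.
Let s0 : 0 < s. Proof. by rewrite sE sqrtr_gt0 ltr0n. Qed.
Let M0 : 0 < M. Proof. by rewrite ME ltr0n; apply: leq_trans DT. Qed.
Let tM : t%:R <= M. Proof. by rewrite ME ler_nat. Qed.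
Let t0 : 0 < t%:R :> R.
Proof. by rewrite -(pmulr_lgt0 _ s0); apply: lt_le_trans hts; rewrite mulr_gt0. Qed.
Let cs0 : 0 < c * s. Proof. by rewrite mulr_gt0. Qed.
Let l0 : 0 < l. Proof. exact: lt_le_trans l1. Qed.
Let kappa0 : 0 < kappa. Proof. by rewrite divr_gt0 ?mulr_gt0. Qed.

Let fit psi (X : {set T} * {set T}) : bool := [&& #|X.1|%:R <= kappa, #|X.2|%:R <= kappa &
   (D * #|approx_inner psi X.1 X.2| <= D * #|approx_nbhd psi X.1 X.2| + 4 * t * psi)%N].

Let cover psi (A : {set T}) : s / 2 <= psi%:R -> psi%:R <= s ->
  (#|nbhd A| == #|inner (nbhd A)| + t)%N ->
  exists X, fit psi X && [&& approx_nbhd psi X.1 X.2 \subset nbhd A,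
     #|nbhd A| == #|inner (nbhd A)| + t & A \subset approx_inner psi X.1 X.2]%N.
Proof.
move=> psi1 psi2 At; have s24 := s_ge c1 l1 s0 hD.
have psi0 : (0 < psi)%N.
  by rewrite -(@ltr_nat R); apply: lt_le_trans psi1; rewrite divr_gt0.
have psiD : (2 * psi <= D)%N.
  rewrite -(@ler_nat R) natrM -ss; apply: (@le_trans _ _ (s * psi%:R)).
    by rewrite ler_wpM2r //; lra.
  by rewrite ler_pM2l.
(* With k.+1 fractional steps the uncovered part shrinks by a factor exp(- l) = 1 / D, so that at
   most M / D points are left over. *)
have [k /andP[k1 k2]] : {n : nat | (n%:R <= 2 * M * l / (s * s)) && (2 * M * l / (s * s) < n.+1%:R)}.
  by exists (Num.truncn (2 * M * l / (s * s))); apply: truncn_itv; rewrite divr_ge0 ?mulr_ge0 ?ltW.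
have [X1 [X3 [m1 [m2 [[c1' m1h] [m2h m3h] sS sF sD]]]]] := container k.+1 (eqP At) psi0 psiD.
exists (X1, X3); rewrite /fit /= sD At sF (subset_trans (sub_inner_nbhd A) sS) !andbT.
have small (m : nat) : (m * psi <= 2 * t)%N -> m%:R <= 4 * t%:R / s.
  rewrite -(@ler_nat R) !natrM ler_pdivlMr // => h.
  have : m%:R * (s / 2) <= m%:R * psi%:R :> R by rewrite ler_wpM2l ?ler0n.
  move: h; lra.
have m1r : m1%:R <= M / (s * s).
  have DT2 : (D <= 2 * #|T|)%N by rewrite (leq_trans DT) // leq_pmull.
  apply: (le_trans (geometric_decay DT2 (leq_trans D0 DT) m1h)).
  rewrite -ME; have -> : M / (s * s) = M * expR (- l) by rewrite expRN lE lnK ?ss // posrE ltr0n.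
  rewrite ler_pM2l // ler_expR lerN2.
  move: k2; rewrite ltr_pdivrMr ?mulr_gt0 // mulrA ler_pdivlMr ?mulr_gt0 // -ss.
  by move/ltW; rewrite mulrC mulrA (mulrC l).
have sM : s * s <= M by rewrite ss ME ler_nat.
have k1' : (k.+1)%:R <= 2 * M * l / (s * s) + 1 by rewrite -natr1 lerD2r.
apply/andP; split.
  apply: (cover_size c0 c1 l1 s0 M0 hts _ k1' sM m1r (small _ m2h)).
  by rewrite -!natrD ler_nat.
apply: (cover_size c0 c1 l1 s0 M0 hts _ k1' sM m1r (small _ m3h)).
by rewrite ler_wpDl // addr_ge0 ?ler0n.
Qed.

Let few_kappa : few kappa <= expR (16 * t%:R * l ^+ 2 / (c * s)).
Proof.
have h1 := kappa_le c0 l1 s0 M0 hD tM; have h2 := kappa_ge c0 l1 s0 M0 hts.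
rewrite ME in h1; rewrite ss ME in h2.
apply: (le_trans (few_le kappa0 h1 h2)); rewrite ler_expR -lE.
exact: (kappa_exp c0 l1 s0 M0 hts).
Qed.

Let few_gap : few (t%:R / (4 * l)) <= expR (t%:R / 4).
Proof.
have h1 := gap_le l1 M0 tM; have h2 := gap_ge l1 s0 M0 hD hts.
rewrite ME in h1; rewrite ss ME in h2.
apply: (le_trans (few_le (gap_gt0 c0 l1 s0 M0 hts) h1 h2)); rewrite ler_expR.
have -> : t%:R / 4 = t%:R / (4 * l) * l by field; rewrite gt_eqF.
rewrite ler_pM2l ?divr_gt0 ?mulr_gt0 //.
have -> : D%:R / 4 = D%:R / 2 / 2 :> R by field.
rewrite ln_div ?posrE ?divr_gt0 ?ltr0n // ln_div ?posrE ?ltr0n // -lE.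
have := ln2_ge_half R; lra.
Qed.

Let given psi X : psi%:R <= s -> fit psi X ->
  \sum_(A : {set T} | [&& approx_nbhd psi X.1 X.2 \subset nbhd A,
     #|nbhd A| == #|inner (nbhd A)| + t & A \subset approx_inner psi X.1 X.2]%N) weight A
  <= 2 * pow2 M * expR (4 * t%:R / s - t%:R / (8 * l)).
Proof.
move=> psi2 /and3P[_ _].
move: (approx_inner _ _ _) (approx_nbhd _ _ _) => S F.
rewrite -(@ler_nat R) natrD !natrM => okX.
(* At the threshold t / (4 l) both cases win: a large missing part gains 2 ^ (- t / (4 l)) against a
   slack of 4 t / s, and a small one costs exp(t / 4) choices against a gain of 2 ^ (- t). *)
apply: (le_trans (sum_weight_given _ _ _ (ltW (gap_gt0 c0 l1 s0 M0 hts)))).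
have -> (x : R) : 2 * pow2 M * x = pow2 M * x + pow2 M * x by ring.
rewrite -ME; apply: lerD.
  apply: (@le_trans _ _ (pow2 (M + (4 * t%:R / s - t%:R / (4 * l))))).
    rewrite ler_pow2.
    have h : #|S|%:R - #|F|%:R <= 4 * t%:R / s :> R.
      rewrite ler_pdivlMr // -(ler_pM2l s0).
      have -> : s * ((#|S|%:R - #|F|%:R) * s) = D%:R * #|S|%:R - D%:R * #|F|%:R by rewrite -ss; ring.
      have -> : s * (4 * t%:R) = 4 * t%:R * s by ring.
      have := ler_wpM2l (_ : 0 <= 4 * t%:R) psi2 => /(_ ltac:(by rewrite mulr_ge0 ?ler0n)) h.
      move: okX h; lra.
    move: h; lra.
  by rewrite pow2D ler_wpM2l ?pow2_ge0 // ler_expR (case_wide c0 l1 s0 M0 hts).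
apply: le_trans (ler_wpM2r (pow2_ge0 _) few_gap) _.
rewrite pow2D mulrCA ler_wpM2l ?pow2_ge0 // -expRD ler_expR.
exact: (case_narrow c0 l1 s0 M0 hts).
Qed.

Lemma container_count_aux :
  \sum_(A : {set T} | (#|nbhd A| == #|inner (nbhd A)| + t)%N) weight A <=
  2 * pow2 M * expR (- (t%:R / (16 * l))).
Proof.
have [psi /andP[psi1 psi2]] : {n : nat | (n%:R <= s) && (s < n.+1%:R)}.
  by exists (Num.truncn s); apply: truncn_itv; exact: ltW.
have psi3 : s / 2 <= psi%:R.
  have := s_ge c1 l1 s0 hD; move: psi2; rewrite -natr1; lra.
apply: (@le_trans _ _ (\sum_(X | fit psi X) \sum_(A : {set T} | [&& approx_nbhd psi X.1 X.2 \subset nbhd A,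
     #|nbhd A| == #|inner (nbhd A)| + t & A \subset approx_inner psi X.1 X.2]%N) weight A)).
  rewrite (exchange_big_dep (fun A : {set T} => #|nbhd A| == #|inner (nbhd A)| + t)%N) /=; last first.
    by move=> X A _ /and3P[].
  apply: ler_sum => A At; have [X rX] := cover psi3 psi1 At.
  by rewrite (bigD1 X) //= lerDl sumr_ge0 // => *; exact: pow2_ge0.
apply: (le_trans (ler_sum _ (fun X => given psi1))).
rewrite sumr_const -[_ *+ _]mulr_natl.
have E0 : 0 <= 2 * pow2 M * expR (4 * t%:R / s - t%:R / (8 * l)).
  apply: mulr_ge0; last exact: expR_ge0.
  by apply: mulr_ge0; [exact: ler0n|exact: pow2_ge0].
apply: (@le_trans _ _ (few kappa * few kappa * (2 * pow2 M * expR (4 * t%:R / s - t%:R / (8 * l))))).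
  apply: (ler_wpM2r E0); rewrite /few -natrM -cardsX ler_nat.
  by apply: subset_leq_card; apply/subsetP => X /and3P[h1 h2 _]; rewrite !inE h1 h2.
apply: (@le_trans _ _ (expR (16 * t%:R * l ^+ 2 / (c * s)) * expR (16 * t%:R * l ^+ 2 / (c * s)) * (2 * pow2 M * expR (4 * t%:R / s - t%:R / (8 * l))))).
  by apply: (ler_wpM2r E0); apply: ler_pM; rewrite ?few_kappa //; exact: ler0n.
rewrite mulrCA ler_wpM2l ?mulr_ge0 ?pow2_ge0 ?ler0n // -!expRD ler_expR.
exact: (total_exp c0 c1 l1 s0 M0 hD hts).
Qed.
End Count.

Lemma container_count (c : R) (t : nat) : 0 < c -> c <= 1 -> (0 < D)%N ->
  1 <= ln D%:R :> R -> 24 * 24 * ln D%:R ^+ 3 <= c * Num.sqrt D%:R ->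
  (D <= #|T|)%N -> (t <= #|T|)%N -> c * #|T|%:R <= t%:R * Num.sqrt D%:R ->
  \sum_(A : {set T} | (#|nbhd A| == #|inner (nbhd A)| + t)%N) weight A <=
  2 * pow2 #|T|%:R * expR (- (t%:R / (16 * ln D%:R))).
Proof. by move=> *; apply: (@container_count_aux c _ (Num.sqrt D%:R)). Qed.

End Container.

(** * Isoperimetry in the discrete cube *)

Notation cube n := {ffun 'I_n -> bool}.

Section Flip.
Variable n : nat.
Implicit Types (x y : cube n) (i j : 'I_n).

Definition flip i x : cube n := [ffun k => if k == i then ~~ x k else x k].

Lemma flipK i : involutive (flip i).
Proof. by move=> x; apply/ffunP => k; rewrite !ffunE; case: (k == i); rewrite ?negbK. Qed.

Lemma flipC i j x : flip i (flip j x) = flip j (flip i x).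
Proof. by apply/ffunP => k; rewrite !ffunE; case: (k == i); case: (k == j). Qed.

Lemma flip_inj i : injective (flip i).
Proof. exact: can_inj (flipK i). Qed.

Lemma flip_neq i x : flip i x != x.
Proof. by apply/eqP => /ffunP/(_ i); rewrite ffunE eqxx; case: (x i). Qed.

Lemma flip_injl x : injective (flip^~ x).
Proof.
move=> i j /ffunP/(_ i); rewrite !ffunE eqxx; case: eqP => // _; by case: (x i).
Qed.

Lemma flip_const (A : Type) (G : cube n -> A) :
  (forall i x, G (flip i x) = G x) -> forall x y, G x = G y.
Proof.
move=> Gf x y.
suff H (s : seq 'I_n) : G [ffun k => if k \in s then y k else x k] = G x.
  by rewrite -(H (enum 'I_n)); congr G; apply/ffunP => k; rewrite ffunE mem_enum.
elim: s => [|i s <-]; first by congr G; apply/ffunP => k; rewrite ffunE.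
case: (boolP ([ffun k => if k \in i :: s then y k else x k] == [ffun k => if k \in s then y k else x k])).
  by move/eqP->.
move=> ne; rewrite -[RHS](Gf i); congr G; apply/ffunP => k; rewrite !ffunE in_cons.
case: eqP => [->|//] /=.
move: ne; apply: contraNeq => h; apply/eqP/ffunP => k'; rewrite !ffunE in_cons.
case: eqP => [->|//] /=; move: h; case: (i \in s) => //=; by case: (x i); case: (y i).
Qed.

End Flip.

Section CubeIsoperimetry.
Variables (R : realType) (n : nat).
Implicit Types (F G : cube n -> R) (x y : cube n) (i j : 'I_n) (s : seq 'I_n).

Definition avg i F x : R := (F x + F (flip i x)) / 2.
(* Averaging over the coordinates in s only, which opens isoperimetry to induction
   on the coordinates. *)
Definition avgs s F : cube n -> R := foldr avg F s.

Lemma le_avgs s F G : (forall x, F x <= G x) -> forall x, avgs s F x <= avgs s G x.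
Proof.
move=> FG; elim: s => //= i s IH x; rewrite /avg ler_pM2r ?invr_gt0 // lerD //; exact: IH.
Qed.

Lemma avgs_lin s (a b : R) F G x :
  avgs s (fun y => a * F y + b * G y) x = a * avgs s F x + b * avgs s G x.
Proof. by elim: s x => //= i s IH x; rewrite /avg !IH; field. Qed.

Lemma avgs_flip s j F x : avgs s (fun y => F (flip j y)) x = avgs s F (flip j x).
Proof. by elim: s x => //= i s IH x; rewrite /avg !IH flipC. Qed.

Lemma avgs_inv s j F x : j \in s -> avgs s F (flip j x) = avgs s F x.
Proof.
elim: s x => //= i s IH x; rewrite in_cons /avg; case: eqP => [->|_] /=.
  by rewrite flipK addrC.
by move=> js; rewrite flipC !IH.
Qed.

Lemma avgs_const s (a : R) x : avgs s (fun=> a) x = a.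
Proof. by elim: s x => //= i s IH x; rewrite /avg !IH; field. Qed.

Lemma sum_avgs s F : \sum_x avgs s F x = \sum_x F x.
Proof.
elim: s => //= i s IH; rewrite -mulr_suml big_split /= IH.
have -> : \sum_x avgs s F (flip i x) = \sum_x avgs s F x.
  by rewrite [RHS](reindex_inj (@flip_inj _ i)).
by rewrite IH; field.
Qed.

Lemma avgs_mean F x : #|{: cube n}|%:R * avgs (enum 'I_n) F x = \sum_y F y.
Proof.
rewrite -(sum_avgs (enum 'I_n)) (eq_bigr (fun=> avgs (enum 'I_n) F x)) ?sumr_const ?mulr_natl //.
move=> y _; apply: (flip_const (G := avgs (enum 'I_n) F)) => i z.
by rewrite avgs_inv // mem_enum.
Qed.

Definition bdry (C : {set cube n}) i y : R := ((y \in C) && (flip i y \notin C))%:R.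
Definition bdeg C s y : R := \sum_(i <- s) bdry C i y.

Lemma le_sqrt_sqr (a b : R) : 0 <= a -> a ^+ 2 <= b -> a <= Num.sqrt b.
Proof.
move=> a0 ab; have {1}<- : Num.sqrt (a ^+ 2) = a by rewrite sqrtr_sqr ger0_norm.
by rewrite ler_sqrt // (le_trans (sqr_ge0 _) ab).
Qed.

(** With u = a (1 - a) <= 1/4 and v = (a - b)^2 <= 1, the root is at least u + v / 2; putting this
    value in place of the root gives an equality. *)
Lemma two_point (a b : R) : 0 <= b -> b <= a -> a <= 1 ->
  (a + b) / 2 * (1 - (a + b) / 2) <=
  (Num.sqrt ((a * (1 - a)) ^+ 2 + (a - b) ^+ 2) + b * (1 - b)) / 2.
Proof.
move=> b0 ba a1.
have h : a * (1 - a) + (a - b) ^+ 2 / 2 <= Num.sqrt ((a * (1 - a)) ^+ 2 + (a - b) ^+ 2).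
  have u0 : 0 <= a * (1 - a) by nra.
  have v0 : 0 <= (a - b) ^+ 2 by exact: sqr_ge0.
  apply: le_sqrt_sqr; first lra.
  have u1 : a * (1 - a) <= 1 / 4 by have := sqr_ge0 (a - 1 / 2); nra.
  have v1 : (a - b) ^+ 2 <= 1 by rewrite expr2; nra.
  move: (a * (1 - a)) ((a - b) ^+ 2) u0 v0 u1 v1 => u v u0 v0 u1 v1.
  have : 0 <= v * (1 - u - v / 4) by apply: mulr_ge0 => //; lra.
  rewrite !expr2; lra.
apply: le_trans (ler_wpM2r _ (lerD h (lexx _))); last by rewrite invr_ge0.
by rewrite le_eqVlt; apply/orP; left; apply/eqP; field.
Qed.

(** Minkowski's inequality: the norm of the averaged vector is at most the averaged norm, by pairing
    pointwise with the unit vector (P, Q) / r. *)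
Lemma avgs_sqrt s F G x (Q : R) : (forall y, 0 <= F y) -> (forall y, 0 <= G y) ->
  0 <= Q -> Q <= avgs s G x ->
  Num.sqrt (avgs s F x ^+ 2 + Q ^+ 2) <= avgs s (fun y => Num.sqrt (F y ^+ 2 + G y ^+ 2)) x.
Proof.
move=> F0 G0 Q0 QG; set P := avgs s F x; set r := Num.sqrt _.
have r0 : 0 <= r by exact: sqrtr_ge0.
have rr : r * r = P ^+ 2 + Q ^+ 2 by rewrite -expr2 sqr_sqrtr // addr_ge0 ?sqr_ge0.
have P0 : 0 <= P by rewrite -(avgs_const s 0 x); apply: le_avgs.
have [re|rn] := eqVneq r 0.
  by rewrite re -(avgs_const s 0 x); apply: le_avgs => y; exact: sqrtr_ge0.
have rp : 0 < r by rewrite lt_def rn.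
have pt y : P / r * F y + Q / r * G y <= Num.sqrt (F y ^+ 2 + G y ^+ 2).
  apply: le_sqrt_sqr; first by apply: addr_ge0; apply: mulr_ge0 => //; apply: divr_ge0.
  have -> : (P / r * F y + Q / r * G y) ^+ 2 = (P * F y + Q * G y) ^+ 2 / (r * r) by field.
  rewrite ler_pdivrMr ?mulr_gt0 // rr -subr_ge0.
  have -> : (F y ^+ 2 + G y ^+ 2) * (P ^+ 2 + Q ^+ 2) - (P * F y + Q * G y) ^+ 2 = (P * G y - Q * F y) ^+ 2 by ring.
  exact: sqr_ge0.
apply: le_trans (le_avgs s pt x); rewrite avgs_lin -/P.
have re : P / r * P + Q / r * Q = r.
  have -> : P / r * P + Q / r * Q = (P ^+ 2 + Q ^+ 2) / r by ring.
  by rewrite -rr mulfK.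
rewrite -[leLHS]re.
by rewrite lerD2l ler_wpM2l ?divr_ge0.
Qed.

(** Only points inside C are charged, through the root of their boundary degree. For a new
    coordinate i the two halves have densities a and b; on the denser side the average of [bdry C i]
    is at least |a - b|, which enters under the root, and [two_point] closes the induction. *)
Lemma avgs_isoperimetry (C : {set cube n}) s x : uniq s ->
  let m := avgs s (fun y => (y \in C)%:R) x in
  m * (1 - m) <= avgs s (fun y => Num.sqrt (bdeg C s y)) x.
Proof.
elim: s x => [x _|i s IH x /= /andP[iNs us]].
  rewrite /= /bdeg big_nil sqrtr0; case: (x \in C); rewrite ?mul0r ?subrr ?mulr0 //.
set ind : cube n -> R := fun y => (y \in C)%:R.
pose H y := Num.sqrt (bdeg C s y).
have split y : Num.sqrt (bdeg C (i :: s) y) = Num.sqrt (H y ^+ 2 + bdry C i y ^+ 2).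
  rewrite /H sqr_sqrtr; last by apply: sumr_ge0 => j _; exact: ler0n.
  by rewrite /bdeg big_cons addrC /bdry; case: (_ && _); rewrite ?expr1n ?expr0n.
have b0 y : 0 <= bdry C i y by exact: ler0n.
have H0 y : 0 <= H y by exact: sqrtr_ge0.
have dif z : avgs s ind z - avgs s ind (flip i z) <= avgs s (bdry C i) z.
  rewrite -[avgs s ind (flip i z)]avgs_flip -[avgs s ind z]mul1r -[- _]mulN1r -avgs_lin.
  apply: le_avgs => y; rewrite mul1r mulN1r /bdry /ind; case: (y \in C); case: (flip i y \in C) => //=; lra.
have m01 z : 0 <= avgs s ind z <= 1.
  rewrite -[X in X <= _ <= _](avgs_const s 0 z) -[X in _ <= _ <= X](avgs_const s 1 z).
  by rewrite !le_avgs // => y; rewrite /ind; case: (y \in C) => //=; rewrite lexx.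
have lower z : avgs s ind (flip i z) <= avgs s ind z ->
  Num.sqrt ((avgs s ind z * (1 - avgs s ind z)) ^+ 2 + (avgs s ind z - avgs s ind (flip i z)) ^+ 2)
  <= avgs s (fun y => Num.sqrt (bdeg C (i :: s) y)) z.
  move=> h; have := @avgs_sqrt s H (bdry C i) z _ H0 b0 _ (dif z).
  rewrite subr_ge0 => /(_ h) k.
  have -> : avgs s (fun y => Num.sqrt (bdeg C (i :: s) y)) z =
            avgs s (fun y => Num.sqrt (H y ^+ 2 + bdry C i y ^+ 2)) z.
    by congr (avgs s _ z); apply/funext => y; exact: split.
  apply: le_trans k; rewrite ler_sqrt; last by rewrite addr_ge0 ?sqr_ge0.
  rewrite lerD2r lerXn2r ?nnegrE //; last exact: IH.
    by have /andP[? ?] := m01 z; rewrite mulr_ge0 // subr_ge0.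
  by rewrite -(avgs_const s 0 z); apply: le_avgs.
have weak z : avgs s ind z * (1 - avgs s ind z) <= avgs s (fun y => Num.sqrt (bdeg C (i :: s) y)) z.
  apply: le_trans (IH z us) _; apply: le_avgs => y; rewrite split.
  by apply: le_sqrt_sqr; rewrite ?H0 // lerDl sqr_ge0.
rewrite {1 2 3}/avg -/(avgs s ind).
have /andP[a0 a1] := m01 x; have /andP[c0 c1] := m01 (flip i x).
have := lower x; have := lower (flip i x); have := weak x; have := weak (flip i x).
rewrite flipK /avg.
move: (avgs s ind x) (avgs s ind (flip i x)) a0 a1 c0 c1 => a b a0 a1 c0 c1 w1 w2 l1 l2.
have [ba|ab] := leP b a.
  apply: le_trans (two_point c0 ba a1) _; rewrite ler_pM2r ?invr_gt0 //.
  by rewrite lerD // l2.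
rewrite addrC; apply: le_trans (two_point a0 (ltW ab) c1) _; rewrite ler_pM2r ?invr_gt0 // addrC.
by rewrite lerD // l1 // ltW.
Qed.

Lemma cube_isoperimetry (C : {set cube n}) :
  #|C|%:R * (1 - #|C|%:R / #|{: cube n}|%:R) <=
  \sum_(x in C) Num.sqrt (#|[set i | flip i x \notin C]|%:R : R).
Proof.
have x0 : cube n := [ffun=> false].
have N0 : 0 < #|{: cube n}|%:R :> R by rewrite ltr0n; apply/card_gt0P; exists x0.
have := @avgs_isoperimetry C (enum 'I_n) x0 (enum_uniq _) => /=.
rewrite -(ler_pM2l N0) avgs_mean => h.
have e : avgs (enum 'I_n) (fun y => (y \in C)%:R) x0 = #|C|%:R / #|{: cube n}|%:R.
  apply: (mulfI (lt0r_neq0 N0)); rewrite avgs_mean mulrCA mulfV ?lt0r_neq0 // mulr1.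
  by rewrite -sum1_card natr_sum [RHS]big_mkcond; apply: eq_bigr => y _; case: (y \in C).
move: h; rewrite e mulrA mulrCA mulfV ?lt0r_neq0 // mulr1 => h; apply: (le_trans h).
rewrite [leRHS]big_mkcond; apply: ler_sum => y _; case: ifP => yC.
  rewrite ler_sqrt ?ler0n // /bdeg big_enum /= -sum1_card natr_sum [leRHS]big_mkcond ler_sum // => i _.
  by rewrite /bdry inE yC /=; case: (flip i y \in C).
rewrite -[leRHS](sqrtr0 R) ler_sqrt // /bdeg big1 // => i _; by rewrite /bdry yC.
Qed.

(** Reflexive, so that [nbhd] is the closed neighbourhood: forgetting one coordinate turns adjacency
    between the two parity classes of the (n+1)-cube into this relation. *)
Definition cube_rel : rel (cube n) := fun x y => (x == y) || [exists i, y == flip i x].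

Lemma cube_rel_sym : symmetric cube_rel.
Proof.
move=> x y; rewrite /cube_rel eq_sym; congr orb; apply/existsP/existsP => -[i /eqP->]; exists i; by rewrite flipK.
Qed.

Lemma cube_rel_reg x : #|nbrs cube_rel x| = n.+1.
Proof.
have -> : nbrs cube_rel x = x |: [set flip i x | i in 'I_n].
  apply/setP => y; rewrite !inE /cube_rel eq_sym; congr orb; apply/existsP/imsetP.
    by case=> i /eqP->; exists i.
  by case=> i _ ->; exists i.
rewrite cardsU1 card_imset; last exact: flip_injl.
rewrite card_ord; case: imsetP => // -[i _ e]; have := flip_neq i x; by rewrite -e eqxx.
Qed.

(** Apply the edge version to the complement of W: its points with a neighbour in W are those of
    [nbhd] outside W, and each has boundary degree at most n. *)
Lemma cube_vertex_isoperimetry (W : {set cube n}) :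
  #|W|%:R * (#|{: cube n}|%:R - #|W|%:R) <=
  Num.sqrt n%:R * (#|nbhd cube_rel W|%:R - #|W|%:R) * #|{: cube n}|%:R :> R.
Proof.
have x0 : cube n := [ffun=> false].
have N0 : 0 < #|{: cube n}|%:R :> R by rewrite ltr0n; apply/card_gt0P; exists x0.
have cC : #|~: W|%:R = #|{: cube n}|%:R - #|W|%:R :> R by rewrite -(cardsC W) natrD addrAC subrr add0r.
have := cube_isoperimetry (~: W); rewrite cC => h.
have -> : #|W|%:R * (#|{: cube n}|%:R - #|W|%:R) =
  (#|{: cube n}|%:R - #|W|%:R) * (1 - (#|{: cube n}|%:R - #|W|%:R) / #|{: cube n}|%:R) * #|{: cube n}|%:R :> R.
  by field; rewrite gt_eqF.
rewrite ler_wpM2r ?ler0n //; apply: (le_trans h).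
have WN : W \subset nbhd cube_rel W.
  by apply/subsetP => x xW; apply/nbhdP; exists x; rewrite // /cube_rel eqxx.
have -> : #|nbhd cube_rel W|%:R - #|W|%:R = #|nbhd cube_rel W :\: W|%:R :> R.
  by rewrite -(cardsID W (nbhd _ _)) (setIidPr WN) natrD addrAC subrr add0r.
rewrite mulrC -sum1_card natr_sum mulr_suml big_mkcond [leRHS]big_mkcond ler_sum // => x _.
rewrite in_setC in_setD; case: (boolP (x \in W)) => //= xW.
case: ifP => [_|/negP xN].
  rewrite mul1r ler_sqrt ?ler0n // ler_nat -[leqRHS]card_ord; exact: max_card.
rewrite [X in Num.sqrt X](_ : _ = 0) ?sqrtr0 //; apply/eqP; rewrite pnatr_eq0 cards_eq0.
apply/eqP/setP => i; rewrite !inE negbK; apply/negP => fW; apply: xN; apply/nbhdP.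
exists (flip i x) => //; rewrite /cube_rel; apply/orP; right; apply/existsP; exists i; by rewrite flipK.
Qed.

End CubeIsoperimetry.

(** * Growth comparisons *)

Definition evt (P : nat -> Prop) := exists N, forall d, (N <= d)%N -> P d.

Lemma evt_and P Q : evt P -> evt Q -> evt (fun d => P d /\ Q d).
Proof.
move=> [N hN] [M hM]; exists (maxn N M) => d; rewrite geq_max => /andP[? ?].
by split; [exact: hN|exact: hM].
Qed.

Lemma evt_impl (P Q : nat -> Prop) : (forall d, P d -> Q d) -> evt P -> evt Q.
Proof. by move=> PQ [N hN]; exists N => d /hN /PQ. Qed.

Lemma evt_ge N : evt (fun d => (N <= d)%N).
Proof. by exists N. Qed.

Section Growth.
Variable R : realType.

Lemma evt_ge_real (x : R) : evt (fun d => x <= d%:R).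
Proof.
exists (Num.truncn `|x|).+1 => d; rewrite -(@ler_nat R) => h.
apply: le_trans (ler_norm x) (le_trans _ h); apply: ltW; exact: truncnS_gt.
Qed.

Lemma expR_dominates (C : R) k : exists2 x0, 1 <= x0 & forall x, x0 <= x -> C * x ^+ k <= expR x.
Proof.
exists (Num.max 1 (C * (k.+1)`!%:R)); first by rewrite le_max lexx.
move=> x; rewrite ge_max => /andP[x1 xC].
have x0 : 0 <= x by lra.
apply: le_trans (expR_ge1Dxn k x0).
have h : C * x ^+ k <= x ^+ k.+1 / (k.+1)`!%:R.
  by rewrite ler_pdivlMr ?ltr0n ?fact_gt0 // exprS mulrAC ler_wpM2r ?exprn_ge0.
lra.
Qed.

Lemma evt_pow2 (C : R) k : evt (fun d => C * d%:R ^+ k <= 2 ^+ d).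
Proof.
have [x0 x01 h] := expR_dominates (C * 2 ^+ k) k.
apply: evt_impl (evt_ge_real (2 * x0)) => d hd.
have h2 : x0 <= d%:R / 2 by lra.
have -> : C * d%:R ^+ k = C * 2 ^+ k * (d%:R / 2) ^+ k.
  by rewrite -mulrA -exprMn; congr (_ * _ ^+ _); field.
apply: le_trans (h _ h2) _.
have -> : 2 ^+ d = expR (d%:R * ln 2) :> R by rewrite expRM_natl lnK // posrE.
by rewrite ler_expR ler_wpM2l // -div1r ln2_ge_half.
Qed.

Lemma evt_ln_sqrt (C : R) k : evt (fun d => C * ln d%:R ^+ k <= Num.sqrt d%:R).
Proof.
have [x0 x01 h] := expR_dominates (C * 2 ^+ k) k.
apply: evt_impl (evt_ge_real (expR (2 * x0))) => d hd.
have d0 : 0 < d%:R :> R by apply: lt_le_trans hd; exact: expR_gt0.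
have h1 : 2 * x0 <= ln d%:R by rewrite -[leLHS]expRK ler_ln ?posrE ?expR_gt0.
have h2 : x0 <= ln d%:R / 2 by lra.
have -> : C * ln d%:R ^+ k = C * 2 ^+ k * (ln d%:R / 2) ^+ k.
  by rewrite -mulrA -exprMn; congr (_ * _ ^+ _); field.
apply: le_trans (h _ h2) _.
have {2}-> : d%:R = expR (ln d%:R / 2) ^+ 2 :> R.
  by rewrite -expRM_natl mulrCA mulfV ?mulr1 ?lnK // posrE.
by rewrite sqrtr_sqr ler_norm.
Qed.

Lemma evt_ln_ge (x : R) : evt (fun d => x <= ln d%:R).
Proof.
apply: evt_impl (evt_ge_real (expR x)) => d hd.
by rewrite -[leLHS]expRK ler_ln ?posrE ?expR_gt0 // (lt_le_trans _ hd) ?expR_gt0.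
Qed.

Lemma ln_le_nat d : ln d%:R <= d%:R :> R.
Proof.
case: d => [|d]; first by rewrite ln0.
have := @le_ln1Dx R d%:R ltac:(have := ler0n R d; lra); rewrite -natr1 addrC => h; lra.
Qed.

Lemma sqrt_le_nat d : Num.sqrt d%:R <= d%:R :> R.
Proof.
case: d => [|d]; first by rewrite sqrtr0.
rewrite -[leRHS]ger0_norm // -sqrtr_sqr ler_sqrt ?sqr_ge0 // -natrX ler_nat.
nia.
Qed.

End Growth.

(** * Relaxed independent sets of the cube *)

Section CubeEvents.
Variable n : nat.
Implicit Types (K : {set cube n}) (x : cube n) (i j : 'I_n).

Definition par x : bool := odd (\sum_k x k).
Definition parset (b : bool) : {set cube n} := [set x | par x == b].
Definition facet i (s : bool) : {set cube n} := [set x : cube n | x i == s].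
Definition cube_indep K : bool := [forall x in K, forall i, flip i x \notin K].
Definition mixed e K : bool := [forall b, 2 ^ n <= e * #|K :&: parset b|]%N.
(* 2 * 2 ^ n: in a cube which is not bad, every facet contains at least twice as many
   points as the sparse parity class may have in the whole cube, so both sides of the
   facet see the same dominant class. *)
Definition bad e K : bool :=
  mixed e K || [exists i, exists s, e * #|K :&: facet i s| < 2 * 2 ^ n]%N.
(** What a neighbour of a bad cube inherits through the common facet: at least a quarter of each
    class of a mixed cube, whence 4 * e, or a nearly empty face of codimension two from a nearly
    empty facet. *)
Definition relaxed e K : bool :=
  mixed (4 * e) K || [exists i, exists s, exists j, exists u,
     (i != j) && (e * #|K :&: facet i s :&: facet j u| < 2 * 2 ^ n)%N].

Lemma par_flip i x : par (flip i x) = ~~ par x.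
Proof.
rewrite /par (bigD1 i) // [in RHS](bigD1 i) //= !oddD ffunE eqxx.
rewrite (eq_bigr (fun k => nat_of_bool (x k))); last by move=> k /negbTE ki; rewrite ffunE ki.
by case: (x i); rewrite ?negbK.
Qed.

Lemma card_cube : #|{: cube n}| = (2 ^ n)%N.
Proof. by rewrite card_ffun card_bool card_ord. Qed.

Lemma card_flip i K : #|[set flip i x | x in K]| = #|K|.
Proof. exact: card_imset (@flip_inj _ i). Qed.

Lemma flip_imset_mem i K x : (x \in flip i @: K) = (flip i x \in K).
Proof. by rewrite -{1}(flipK i x) mem_imset //; exact: flip_inj. Qed.

Lemma card_flip_setI i K (A : {set cube n}) : #|(flip i @: K) :&: A| = #|K :&: (flip i @: A)|.
Proof.
rewrite -(card_flip i (K :&: _)) imsetI; last by move=> x y _ _; exact: flip_inj.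
by rewrite -imset_comp (eq_imset _ (flipK i)) imset_id.
Qed.

Lemma flip_parset i b : flip i @: parset b = parset (~~ b).
Proof.
by apply/setP => x; rewrite flip_imset_mem !inE par_flip; case: (par x); case: b.
Qed.

Lemma flip_facet i j s : flip i @: facet j s = facet j (s (+) (j == i)).
Proof.
apply/setP => x; rewrite flip_imset_mem !inE ffunE.
by case: (j == i); case: (x j); case: s.
Qed.

Lemma mixed_flip e i K : mixed e (flip i @: K) = mixed e K.
Proof.
apply/forallP/forallP => h b; have := h (~~ b).
  by rewrite card_flip_setI flip_parset negbK.
by rewrite card_flip_setI flip_parset.
Qed.

Lemma relaxed_flip_imp e i K : relaxed e K -> relaxed e (flip i @: K).
Proof.
rewrite /relaxed mixed_flip => /orP[->//|/existsP[k /existsP[s /existsP[j /existsP[u /andP[kj h]]]]]].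
apply/orP; right; apply/existsP; exists k; apply/existsP; exists (s (+) (k == i)).
apply/existsP; exists j; apply/existsP; exists (u (+) (j == i)); rewrite kj /=.
rewrite -setIA card_flip_setI imsetI; last by move=> x y _ _; exact: flip_inj.
by rewrite !flip_facet !addbK setIA.
Qed.

Lemma relaxed_flip e i K : relaxed e (flip i @: K) = relaxed e K.
Proof.
apply/idP/idP; last exact: relaxed_flip_imp.
move/(@relaxed_flip_imp e i); congr (relaxed e _).
by rewrite -imset_comp (eq_imset _ (flipK i)) imset_id.
Qed.

Lemma relaxed_mono e K : mixed (4 * e) K -> relaxed e K.
Proof. by rewrite /relaxed => ->. Qed.

End CubeEvents.

Section LowCount.
Variables (R : realType) (n : nat).
Local Notation d := n.+1.

(* The point of parity b above x; a set in the (n+1)-cube is a pair of slices in the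
   n-cube, and independence says that one slice avoids the closed neighbourhood of
   the other. *)
Definition ext (b : bool) (x : cube n) : cube d :=
  [ffun k => if unlift ord0 k is Some j then x j else par x (+) b].

Lemma ext_lift b x j : ext b x (lift ord0 j) = x j.
Proof. by rewrite ffunE liftK. Qed.

Lemma ext0 b x : ext b x ord0 = par x (+) b.
Proof. by rewrite ffunE unlift_none. Qed.

Lemma par_ext b x : par (ext b x) = b.
Proof.
rewrite /par big_ord_recl ext0 (eq_bigr (fun k => nat_of_bool (x k))); last by move=> k _; rewrite ext_lift.
by rewrite oddD -/(par x); case: (par x); case: b.
Qed.

Lemma ext_inj b : injective (ext b).
Proof. by move=> x y /ffunP h; apply/ffunP => j; have := h (lift ord0 j); rewrite !ext_lift. Qed.

Lemma parset_ext b : parset d b = ext b @: setT.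
Proof.
apply/setP => y; rewrite inE; apply/eqP/imsetP => [yb|[x _ ->]]; last exact: par_ext.
exists [ffun j => y (lift ord0 j)]; rewrite ?inE //.
apply/ffunP => k; case: (unliftP ord0 k) => [j ->|->]; first by rewrite ext_lift ffunE.
have e : y = y by []; rewrite ext0 -yb /par big_ord_recl oddD.
rewrite (eq_bigr (fun j => nat_of_bool (y (lift ord0 j)))); last by move=> j _; rewrite ffunE.
by rewrite addbCA addbb addbF oddb.
Qed.

Lemma card_parset b : #|parset d b| = (2 ^ n)%N.
Proof. by rewrite parset_ext card_imset ?cardsT ?card_cube //; exact: ext_inj. Qed.

Definition slice (b : bool) (K : {set cube d}) : {set cube n} := [set x | ext b x \in K].

Lemma card_slice b K : #|slice b K| = #|K :&: parset d b|.
Proof.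
rewrite -(card_imset _ (@ext_inj b)); apply: eq_card => y; rewrite inE parset_ext.
apply/imsetP/andP => [[x]|[yK /imsetP[x _ yx]]].
  by rewrite inE => xK ->; rewrite xK imset_f.
by exists x => //; rewrite inE -yx.
Qed.

Lemma slice_inj K L : slice false K = slice false L -> slice true K = slice true L -> K = L.
Proof.
move=> h0 h1; apply/setP => y.
have : y \in parset d (par y) by rewrite inE.
rewrite parset_ext => /imsetP[x _ ->].
by case: (par y); [move/setP/(_ x): h1|move/setP/(_ x): h0]; rewrite !inE.
Qed.

Lemma slice_disjoint K : cube_indep K ->
  slice true K \subset ~: nbhd (@cube_rel n) (slice false K).
Proof.
move=> /forallP ind; apply/subsetP => y; rewrite !in_setC inE => yK.
apply/nbhdP => -[x]; rewrite inE => xK /orP[/eqP xy|/existsP[i /eqP yi]].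
  have := ind (ext false x); rewrite xK /= => /forallP/(_ ord0)/negP; apply.
  suff -> : flip ord0 (ext false x) = ext true y by [].
  rewrite -xy; apply/ffunP => k; rewrite ffunE; case: (unliftP ord0 k) => [j ->|->].
    by rewrite !ext_lift.
  by rewrite !ext0; case: (par x).
have := ind (ext false x); rewrite xK /= => /forallP/(_ (lift ord0 i))/negP; apply.
suff -> : flip (lift ord0 i) (ext false x) = ext true y by [].
apply/ffunP => k; rewrite ffunE yi; case: (unliftP ord0 k) => [j ->|->].
  by rewrite (inj_eq lift_inj) !ext_lift ffunE.
by rewrite !ext0 par_flip; case: (par x).
Qed.

End LowCount.

(** * Counting mixed and sparse patterns of one cube *)

Section MixedCount.
Variables (R : realType) (n : nat).
Local Notation d := n.+1.
Local Notation N := (2 ^ n)%N.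
Local Notation nb := (nbhd (@cube_rel n)).

(** K is a pair of slices, the second avoiding the neighbourhood of the first, so the count is a sum
    of weights, sorted by the gap t between [nb A] and the closure of A. Occupation of both classes
    makes t large by isoperimetry, and the container bound applies to each such t; N + 1 is the
    number of values of t. *)
Lemma card_mixed (e : nat) : (0 < e)%N -> 1 <= ln d%:R :> R ->
  24 * 24 * ln d%:R ^+ 3 <= e%:R^-1 * Num.sqrt d%:R :> R -> (d <= N)%N ->
  #|[set K : {set cube d} | cube_indep K && mixed e K]|%:R <=
  (N%:R + 1) * (2 * pow2 (N%:R : R) * expR (- (e%:R^-1 * N%:R / Num.sqrt d%:R / (16 * ln d%:R)))).
Proof.
move=> e0 l1 hD dN.
have er0 : 0 < e%:R :> R by rewrite ltr0n.
have N0 : 0 < N%:R :> R by rewrite ltr0n expn_gt0.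
have sd0 : 0 < Num.sqrt d%:R :> R by rewrite sqrtr_gt0 ltr0n.
pose cond (A : {set cube n}) := (2 ^ d <= e * #|A|)%N && (2 ^ d <= e * #|~: nb A|)%N.
pose P := [set p : {set cube n} * {set cube n} | cond p.1 && (p.2 \subset ~: nb p.1)].
have card_le : (#|[set K : {set cube d} | cube_indep K && mixed e K]| <= #|P|)%N.
  pose f (K : {set cube d}) := (slice false K, slice true K).
  rewrite -(card_imset _ (_ : injective f)); last by move=> K L [h0 h1]; exact: slice_inj.
  apply: subset_leq_card; apply/subsetP => _ /imsetP[K KI ->]; move: KI; rewrite inE => /andP[ind /forallP mx].
  rewrite inE /cond /=; have sub := slice_disjoint ind; rewrite sub andbT.
  have := mx false; have := mx true; rewrite -!card_slice => m1 ->.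
  by rewrite (leq_trans m1) // leq_mul2l subset_leq_card ?orbT.
have sumP : #|P|%:R = \sum_(A | cond A) weight (@cube_rel n) R A.
  rewrite -sum1_card natr_sum (eq_bigl (fun p : {set cube n} * {set cube n} => cond p.1 && (p.2 \subset ~: nb p.1))); last first.
    by move=> p; rewrite inE.
  rewrite -(pair_big_dep cond (fun A (B : {set cube n}) => B \subset ~: nb A) (fun _ _ => 1)) /=.
  apply: eq_bigr => A _; rewrite sumr_const /weight -[in RHS](cardsC (nb A)) natrD addrAC subrr add0r pow2_nat.
  by rewrite -natrX -card_powerset; congr (_%:R); apply: eq_card => B; rewrite powersetE.
apply: (@le_trans _ _ #|P|%:R); first by rewrite ler_nat.
rewrite sumP; pose gap A := (#|nb A| - #|inner (@cube_rel n) (nb A)|)%N.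
have innS A : (#|inner (@cube_rel n) (nb A)| <= #|nb A|)%N.
  apply: subset_leq_card; apply/subsetP => x; rewrite inE => /subsetP; apply.
  by rewrite inE /cube_rel eqxx.
have gapN A : (gap A < N.+1)%N.
  by rewrite ltnS /gap (leq_trans (leq_subr _ _)) // -card_cube max_card.
rewrite (partition_big (fun A => Ordinal (gapN A)) xpredT) //=.
have -> : N%:R + 1 = #|'I_N.+1|%:R :> R by rewrite card_ord natr1.
rewrite mulr_natl -sumr_const; apply: ler_sum => t _.
(* Smaller gaps do not occur: the closure has between 2 N / e and N - 2 N / e points, so
   isoperimetry forces t sqrt d >= N / e. *)
have [tN|tN] := boolP (e%:R^-1 * N%:R <= t%:R * Num.sqrt d%:R :> R); last first.
  rewrite big_pred0 => [|A].
    apply: mulr_ge0; last exact: expR_ge0.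
    by apply: mulr_ge0; [exact: ler0n|exact: pow2_ge0].
  apply/negP => /andP[/andP[c1 c2] /eqP/(congr1 val)/= gt]; move/negP: tN; apply.
  have iso := @cube_vertex_isoperimetry R n (inner (@cube_rel n) (nb A)).
  have gE : #|nb A|%:R - #|inner (@cube_rel n) (nb A)|%:R = t%:R :> R.
    by rewrite -natrB ?innS // -/(gap A) gt.
  move: iso; rewrite nbhd_inner card_cube gE.
  set w := #|inner _ _|; have wA : (#|A| <= w)%N by apply: subset_leq_card; exact: sub_inner_nbhd.
  have wC : (#|~: nb A| <= N - w)%N.
    by rewrite leq_subRL -?card_cube ?max_card // -(cardsC (nb A)) leq_add2r innS.
  have wN : (w <= N)%N by rewrite -card_cube max_card.
  have a1 : 2 * N%:R <= e%:R * w%:R :> R.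
    by rewrite -!natrM ler_nat -expnS (leq_trans c1) // leq_mul2l wA orbT.
  have a2 : 2 * N%:R <= e%:R * (N%:R - w%:R) :> R.
    by rewrite -natrB // -!natrM ler_nat -expnS (leq_trans c2) // leq_mul2l wC orbT.
  move: (w%:R : R) a1 a2 => x a1 a2 iso.
  have sn : Num.sqrt n%:R <= Num.sqrt d%:R :> R by rewrite ler_sqrt ?ler0n // ler_nat.
  have iso2 : x * (N%:R - x) <= t%:R * Num.sqrt d%:R * N%:R.
    by apply: (le_trans iso); rewrite ler_pM2r // mulrC ler_wpM2l ?ler0n.
  have h : e%:R^-1 * N%:R * N%:R <= x * (N%:R - x).
    have ei : 0 < e%:R^-1 :> R by rewrite invr_gt0.
    have b1 : 2 * N%:R * e%:R^-1 <= x by rewrite ler_pdivrMr // (mulrC x).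
    have b2 : 2 * N%:R * e%:R^-1 <= N%:R - x by rewrite ler_pdivrMr // (mulrC (_ - x)).
    move: (e%:R^-1 : R) (N%:R : R) ei b1 b2 N0 => y z y0 b1 b2 z0.
    have p0 : 0 <= 2 * z * y by rewrite !mulr_ge0 ?ltW.
    have [xz|xz] := leP x (z / 2).
      have xz' : z / 2 <= z - x by lra.
      have := ler_pM p0 (_ : 0 <= z / 2) b1 xz' => /(_ ltac:(lra)); lra.
    have := ler_pM (_ : 0 <= z / 2) p0 (ltW xz) b2 => /(_ ltac:(lra)); lra.
  by rewrite -(ler_pM2r N0); apply: le_trans h iso2.
apply: (@le_trans _ _ (2 * pow2 (N%:R : R) * expR (- (t%:R / (16 * ln d%:R))))); last first.
  rewrite ler_wpM2l ?mulr_ge0 ?pow2_ge0 ?ler0n // ler_expR lerN2 ler_pM2r.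
    by rewrite ler_pdivrMr.
  by rewrite invr_gt0 mulr_gt0 //; lra.
have tle : (t <= N)%N by rewrite -ltnS.
have := @container_count (cube n) (@cube_rel n) d (@cube_rel_sym n) (@cube_rel_reg n) R (e%:R^-1) t.
rewrite card_cube invr_gt0 er0 invf_le1 // ler1n e0 => /(_ isT isT isT l1 hD dN tle tN) h.
apply: le_trans h; rewrite big_mkcond [leRHS]big_mkcond ler_sum // => A _.
case: ifP => [/andP[_ /eqP/(congr1 val)/= gt]|_]; last by case: ifP => // _; exact: pow2_ge0.
by rewrite -gt subnKC ?innS // eqxx.
Qed.

(** As d > 2 there is a third coordinate k. Flipping it together with i or j preserves parity and
    matches the four faces within a parity class. *)
Lemma card_parset_facets b (i j : 'I_d) s u : i != j -> (2 < d)%N ->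
  (4 * #|parset d b :&: facet i s :&: facet j u| = N)%N.
Proof.
move=> ij d2; have [k ki kj] : exists2 k : 'I_d, k != i & k != j.
  have : (0 < #|~: [set i; j]|)%N by have := cardsC [set i; j]; rewrite cards2 ij card_ord; lia.
  by case/card_gt0P => k; rewrite !inE negb_or => /andP[? ?]; exists k.
pose A v w := parset d b :&: facet i v :&: facet j w.
have flip2 (l : 'I_d) v w : k != l -> #|A v w| = #|A (v (+) (i == l)) (w (+) (j == l))|.
  move=> kl; rewrite -[LHS](card_flip l) -[LHS](card_flip k) /A.
  apply: eq_card => x; rewrite !flip_imset_mem !inE !par_flip negbK !ffunE.
  rewrite !(eq_sym _ k) (negbTE ki) (negbTE kj).
  by case: (i == l); case: (j == l); case: (x i); case: (x j); case: v; case: w.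
have ji : (j == i) = false by rewrite eq_sym; exact: negbTE.
have e1 v w : #|A v w| = #|A (~~ v) w| by rewrite (flip2 i) // eqxx ji addbF addbT.
have e2 v w : #|A v w| = #|A v (~~ w)| by rewrite (flip2 j) // eqxx (negbTE ij) addbF addbT.
have f1 w : #|A false w| = #|A true w| := e1 false w.
have f2 v : #|A v false| = #|A v true| := e2 v false.
have e v w : #|A v w| = #|A true true| by case: v; case: w; rewrite ?f1 ?f2.
have D (B : {set cube d}) l : B :\: facet l true = B :&: facet l false.
  by apply/setP => x; rewrite !inE andbC; case: (x l).
have := cardsID (facet i true) (parset d b); have := cardsID (facet j true) (parset d b :&: facet i true).
have := cardsID (facet j true) (parset d b :&: facet i false).
by rewrite !D -!/(A _ _) !e card_parset; lia.
Qed.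

Lemma ln_pow2_inv k : - k%:R <= ln (2^-1 ^+ k : R).
Proof.
rewrite lnXn ?invr_gt0 // lnV ?posrE // -[leRHS]mulr_natr mulNr lerN2.
by rewrite ler_piMl ?ler0n // ln2_le1.
Qed.

Lemma card_dyadic_subsets (T : finType) (Y : {set T}) k : 
  #|[set X : {set T} | (X \subset Y) && (2 ^ k * #|X| <= #|Y|)%N]|%:R
    <= expR (#|Y|%:R * (2^-1 ^+ k * (1 + k%:R))) :> R.
Proof.
have p0 : 0 < 2^-1 ^+ k :> R by rewrite exprn_gt0 ?invr_gt0.
have p1 : 2^-1 ^+ k <= 1 :> R by rewrite exprn_ile1 ?invr_ge0 // invf_le1 // ler1n.
have := card_small_subsets Y p0 p1.
have -> : [set X : {set T} | (X \subset Y) && (#|X|%:R <= 2^-1 ^+ k * #|Y|%:R :> R)] =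
          [set X : {set T} | (X \subset Y) && (2 ^ k * #|X| <= #|Y|)%N].
  apply/setP => X; rewrite !inE; congr andb.
  by rewrite -(@ler_nat R) natrM natrX exprVn [_ * #|Y|%:R]mulrC ler_pdivlMr ?exprn_gt0 // mulrC.
move=> h; apply: (le_trans h); rewrite ler_expR ler_wpM2l ?ler0n // ler_pM2l // lerD2l.
by rewrite lerNl; exact: ln_pow2_inv.
Qed.

(** Class b and a quarter of the other class are nearly empty, which leaves 3 N / 4 free points. The
    entropies 12 N / 2^11 and 7 (N / 4) / 2^6 of the sparse parts are well below the loss ln 2 * N /
    4. *)
Lemma card_sparse_face b (i j : 'I_d) s u : i != j -> (2 < d)%N ->
  #|[set K : {set cube d} | (2 ^ 11 * #|K :&: parset d b| <= N)%N &&
     (2 ^ 6 * #|K :&: (parset d (~~ b) :&: facet i s :&: facet j u)| <=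
        #|parset d (~~ b) :&: facet i s :&: facet j u|)%N]|%:R
  <= pow2 (N%:R : R) * expR (- (N%:R / 16)).
Proof.
move=> ij d2; set Y1 := parset d b; set Y2 := parset d (~~ b) :&: facet i s :&: facet j u.
pose Y3 := parset d (~~ b) :\: Y2.
pose A1 := [set X : {set cube d} | (X \subset Y1) && (2 ^ 11 * #|X| <= #|Y1|)%N].
pose A2 := [set X : {set cube d} | (X \subset Y2) && (2 ^ 6 * #|X| <= #|Y2|)%N].
pose f (K : {set cube d}) := (K :&: Y1, K :&: Y2, K :&: Y3).
have cY1 : #|Y1| = N by exact: card_parset.
have cY2 : (4 * #|Y2| = N)%N by exact: card_parset_facets.
have Y2s : Y2 \subset parset d (~~ b) by rewrite /Y2 -setIA subsetIl.
have cY3 : (#|Y2| + #|Y3| = N)%N by rewrite -(card_parset n (~~ b)) -(cardsID Y2 (parset d (~~ b))) (setIidPr Y2s).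
have finj : injective f.
  move=> K L [h1 h2 h3]; apply/setP => x.
  have : x \in Y1 :|: Y2 :|: Y3.
    rewrite !in_setU in_setD; case: (boolP (x \in Y2)) => [|_]; rewrite ?orbT //= orbF.
    by rewrite !inE; clear; case: (par x) b => -[].
  have aux (Y : {set cube d}) : x \in Y -> K :&: Y = L :&: Y -> (x \in K) = (x \in L).
    by move=> xY /setP/(_ x); rewrite !in_setI xY !andbT.
  by rewrite !in_setU => /orP[/orP[xY|xY]|xY]; [exact: aux xY h1|exact: aux xY h2|exact: aux xY h3].
apply: (@le_trans _ _ (#|setX (setX A1 A2) (powerset Y3)|%:R)).
  rewrite ler_nat -(card_imset _ finj); apply: subset_leq_card.
  apply/subsetP => _ /imsetP[K KI ->]; move: KI; rewrite inE => /andP[k1 k2].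
  by rewrite !in_setX !inE !subsetIr /= cY1 k1 k2.
rewrite !cardsX !natrM card_powerset natrX -pow2_nat.
apply: (@le_trans _ _ (expR (#|Y1|%:R * (2^-1 ^+ 11 * (1 + 11%:R))) * expR (#|Y2|%:R * (2^-1 ^+ 6 * (1 + 6%:R))) * pow2 (#|Y3|%:R : R))).
  apply: ler_wpM2r; first exact: pow2_ge0.
  by apply: ler_pM; rewrite ?ler0n //; exact: card_dyadic_subsets.
have -> : #|Y3|%:R = N%:R - #|Y2|%:R :> R by rewrite -cY3 natrD addrAC subrr add0r.
rewrite cY1 /pow2 -!expRD ler_expR.
have -> : N%:R = 4 * #|Y2|%:R :> R by rewrite -natrM cY2.
have h0 : 0 <= #|Y2|%:R :> R by exact: ler0n.
move: (#|Y2|%:R : R) h0 => y y0.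
have := ler_wpM2r y0 (ln2_ge_half R).
have -> : ln 2 * (4 * y - y) = 3 * (ln 2 * y) by ring.
have -> : ln 2 * (4 * y) = 4 * (ln 2 * y) by ring.
move: (ln 2 * y) => z h.
have -> : 2^-1 ^+ 11 = 1 / (32 * 64) :> R by field.
have -> : 2^-1 ^+ 6 = 1 / 64 :> R by field.
lra.
Qed.

Lemma card_le_cover (T I : finType) (A : {set T}) (P : pred I) (B : I -> {set T}) :
  (forall x, x \in A -> exists2 i, P i & x \in B i) -> (#|A| <= \sum_(i | P i) #|B i|)%N.
Proof.
move=> h; rewrite -sum1_card.
under [leqRHS]eq_bigr => i _ do rewrite -sum1_card big_mkcond /=.
rewrite exchange_big /= [leqLHS]big_mkcond; apply: leq_sum => x _; case: ifP => // /h[i Pi xi].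
by rewrite (bigD1 i) //= xi.
Qed.

(** With e >= 2^10 the thresholds in [relaxed] become the dyadic densities 2^-11 and 2^-6 of
    [card_sparse_face]. *)
Lemma sparse_arith (e x y z m : nat) : (2 ^ 10 <= e)%N -> (4 * e * x < 2 * m)%N ->
  (e * y < 2 * (2 * m))%N -> (4 * z = m)%N -> (2 ^ 11 * x <= m)%N && (2 ^ 6 * y <= z)%N.
Proof.
rewrite (expnD 2 6 4) (expnD 2 6 5); move: (2 ^ 6)%N => k h1 h2 h3 h4.
have h5 : (k * 2 ^ 4 * x <= e * x)%N by rewrite leq_mul2r h1 orbT.
have h6 : (k * 2 ^ 4 * y <= e * y)%N by rewrite leq_mul2r h1 orbT.
by apply/andP; split; lia.
Qed.

Lemma card_relaxed_le (e : nat) : (2 ^ 10 <= e)%N -> 1 <= ln d%:R :> R ->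
  24 * 24 * ln d%:R ^+ 3 <= (4 * e)%:R^-1 * Num.sqrt d%:R :> R -> (d <= N)%N -> (2 < d)%N ->
  #|[set K : {set cube d} | cube_indep K && relaxed e K]|%:R <=
  (N%:R + 1) * (2 * pow2 (N%:R : R) * expR (- ((4 * e)%:R^-1 * N%:R / Num.sqrt d%:R / (16 * ln d%:R))))
  + (8 * d ^ 2)%:R * (pow2 (N%:R : R) * expR (- (N%:R / 16))).
Proof.
move=> e1 l1 hD dN d2; have e0 : (0 < 4 * e)%N by rewrite muln_gt0 /= (leq_trans _ e1).
pose I := (bool * ('I_d * bool) * ('I_d * bool))%type.
pose P (t : I) := t.1.2.1 != t.2.1.
pose B (t : I) : {set {set cube d}} := [set K : {set cube d} | (2 ^ 11 * #|K :&: parset d t.1.1| <= N)%N &&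
     (2 ^ 6 * #|K :&: (parset d (~~ t.1.1) :&: facet t.1.2.1 t.1.2.2 :&: facet t.2.1 t.2.2)| <=
        #|parset d (~~ t.1.1) :&: facet t.1.2.1 t.1.2.2 :&: facet t.2.1 t.2.2|)%N].
pose A0 : {set {set cube d}} := [set K : {set cube d} | cube_indep K && mixed (4 * e) K].
have split : (#|[set K : {set cube d} | cube_indep K && relaxed e K]| <= #|A0| + \sum_(t | P t) #|B t|)%N.
  set A := [set K | _]; rewrite -(cardsID A0 A); apply: leq_add; first exact/subset_leq_card/subsetIr.
  apply: card_le_cover => K; rewrite !inE => /andP[h /andP[ind]]; rewrite ind /= in h.
  rewrite /relaxed (negbTE h) /= => /existsP[i /existsP[s /existsP[j /existsP[u /andP[ij q]]]]].
  move: h; rewrite negb_forall => /existsP[b]; rewrite -ltnNge => hb.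
  exists (b, (i, s), (j, u)) => //; rewrite inE /=.
  have sub : (#|K :&: (parset d (~~ b) :&: facet i s :&: facet j u)| <= #|K :&: facet i s :&: facet j u|)%N.
    by apply: subset_leq_card; apply/subsetP => x; rewrite !in_setI => /and3P[-> /andP[_ ->] ->].
  apply: (@sparse_arith e _ _ _ N) => //; last exact: card_parset_facets.
    by rewrite -expnS.
  by rewrite -expnS; apply: leq_ltn_trans q; rewrite leq_mul2l sub orbT.
apply: (@le_trans _ _ (#|A0|%:R + \sum_(t | P t) #|B t|%:R)).
  by rewrite -natr_sum -natrD ler_nat.
apply: lerD; first exact: card_mixed.
apply: (@le_trans _ _ (\sum_(t : I) (pow2 (N%:R : R) * expR (- (N%:R / 16))))).
  rewrite big_mkcond; apply: ler_sum => t _; case: ifP => [Pt|_]; first exact: card_sparse_face.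
  by apply: mulr_ge0; [exact: pow2_ge0|exact: expR_ge0].
rewrite sumr_const -[_ *+ _]mulr_natl; apply: ler_wpM2r.
  by apply: mulr_ge0; [exact: pow2_ge0|exact: expR_ge0].
by rewrite ler_nat !card_prod !card_bool !card_ord; lia.
Qed.

(** Three quarters of the exponent Z swallow the prefactors, one quarter is kept. *)
Lemma absorb (x y Z : R) : 0 <= x -> Z <= N%:R / 64 -> 2 * (N%:R + 1) + x <= expR (3 / 4 * Z) ->
  0 <= y -> (N%:R + 1) * (2 * y * expR (- Z)) + x * (y * expR (- (N%:R / 16))) <=
  y * expR (- (Z / 4)).
Proof.
move=> x0 ZN h y0.
have Z16 : expR (- (N%:R / 16)) <= expR (- Z).
  by rewrite ler_expR lerN2; have := ler0n R N; lra.
apply: (@le_trans _ _ (y * ((2 * (N%:R + 1) + x) * expR (- Z)))).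
  have := ler_wpM2l (mulr_ge0 x0 y0) Z16; rewrite -!mulrA; lra.
apply: ler_wpM2l => //; apply: (le_trans (ler_wpM2r (expR_ge0 _) h)).
rewrite -expRD ler_expR; lra.
Qed.

End MixedCount.

(** The factor 16 * 32 collects 4 from the weaker mixing threshold, 16 from the container bound, 4
    from the quarter kept by [absorb], and 2 because a parity class is half of the cube. *)
Definition gain (R : realType) (e d : nat) : R := (16 * 32 * e%:R * Num.sqrt d%:R * ln d%:R)^-1.

Lemma evt_card_relaxed (R : realType) (e : nat) : (2 ^ 10 <= e)%N ->
  evt (fun d => #|[set K : {set cube d} | cube_indep K && relaxed e K]|%:R <=
     pow2 ((2 ^ d.-1)%:R : R) * expR (- (gain R e d * (2 ^ d)%:R))).
Proof.
move=> e10; have e0 : (0 < e)%N by apply: leq_trans e10.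
have er0 : 1 <= e%:R :> R by rewrite ler1n.
have := evt_and (evt_ge 3) (evt_and (@evt_ln_ge R 1) (evt_and (@evt_ln_sqrt R (24 * 24 * (4 * e%:R)) 3)
  (evt_and (@evt_pow2 R 2 1) (evt_and (@evt_pow2 R (2 + 8) 2) (@evt_pow2 R (32 * 32 * e%:R) 3))))).
apply: evt_impl; case=> [|n]; first by case.
set d := n.+1; move=> [d3 [l1 [hD [dN [d2 hd]]]]].
have d1 : 1 <= d%:R :> R by rewrite ler1n.
have s1 : 1 <= Num.sqrt d%:R :> R by rewrite -[leLHS]sqrtr1 ler_sqrt ?ler0n.
have sd := @sqrt_le_nat R d; have ld := @ln_le_nat R d.
have N2 : 2 ^+ d = 2 * (2 ^ n)%:R :> R by rewrite natrX exprS.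
have dN' : (d <= 2 ^ n)%N by rewrite -(@ler_nat R); move: dN; rewrite N2 expr1; lra.
have hD' : 24 * 24 * ln d%:R ^+ 3 <= (4 * e)%:R^-1 * Num.sqrt d%:R :> R.
  rewrite -(ler_pM2l (_ : 0 < (4 * e)%:R)); last by rewrite ltr0n muln_gt0.
  rewrite mulVKf ?pnatr_eq0 ?muln_eq0 -?lt0n ?e0 // natrM.
  by apply: le_trans hD; rewrite le_eqVlt; apply/orP; left; apply/eqP; ring.
apply: (le_trans (card_relaxed_le e10 l1 hD' dN' d3)) => /=.
set Z := (4 * e)%:R^-1 * _ / _ / _.
have ZE : Z * (64 * e%:R * (Num.sqrt d%:R * ln d%:R)) = (2 ^ n)%:R.
  rewrite /Z natrM; field; rewrite ?gt_eqF //; lra.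
have -> : gain R e d * (2 ^ d)%:R = Z / 4.
  have -> : (2 ^ d)%:R = 2 * (2 ^ n)%:R :> R by rewrite expnS natrM.
  rewrite -ZE /gain; field; rewrite ?gt_eqF //; lra.
have q1 : 1 <= Num.sqrt d%:R * ln d%:R :> R by rewrite -[leLHS](mulr1 1); apply: ler_pM; lra.
have q2 : Num.sqrt d%:R * ln d%:R <= d%:R ^+ 2 :> R by rewrite expr2; apply: ler_pM => //; lra.
move: (Num.sqrt d%:R * ln d%:R) q1 q2 ZE => q q1 q2 ZE.
have Z0 : 0 <= Z.
  rewrite leNgt; apply/negP => Zn; have := ler0n R (2 ^ n); rewrite -ZE => h.
  have : 0 < 64 * e%:R * q by rewrite !mulr_gt0 //; lra.
  by move=> p; move: h; rewrite pmulr_lge0 // leNgt Zn.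
apply: absorb; rewrite ?pow2_ge0 ?ler0n //.
  have h : 1 <= e%:R * q by rewrite -[leLHS](mulr1 1); apply: ler_pM; lra.
  rewrite ler_pdivlMr // -ZE; apply: ler_wpM2l => //; lra.
have Z8 : 8 * d%:R <= Z.
  have h : 64 * e%:R * q <= 64 * e%:R * d%:R ^+ 2 by apply: ler_wpM2l => //; lra.
  have h2 : (2 ^ n)%:R <= Z * (64 * e%:R * d%:R ^+ 2) by rewrite -ZE; apply: ler_wpM2l.
  have p : 0 < 64 * e%:R * d%:R ^+ 2 :> R by rewrite !mulr_gt0 ?exprn_gt0 //; lra.
  rewrite -(ler_pM2r p); apply: le_trans h2; move: hd; rewrite N2 exprS.
  move: (d%:R ^+ 2 : R) => dd; lra.
apply: (@le_trans _ _ (expR (1 * d.+1%:R))); last by rewrite mul1r ler_expR -natr1; lra.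
rewrite expRM_natr.
apply: (@le_trans _ _ (2 ^+ d.+1)).
  have -> : (8 * n.+1 ^ 2)%:R = 8 * d%:R ^+ 2 :> R by rewrite natrM natrX.
  rewrite [leRHS]exprS; move: d2; rewrite N2.
  have : 1 <= d%:R ^+ 2 :> R by exact: exprn_ege1.
  move: (d%:R ^+ 2 : R) => dd; lra.
by rewrite lerXn2r ?nnegrE ?expR_ge0 //; have := expR_ge1Dx (1 : R); lra.
Qed.

(** * Reflection positivity and the chessboard estimate *)

Lemma cauchy_schwarz_nat (S : finType) (a b : S -> nat) :
  ((\sum_s a s * b s) ^ 2 <= (\sum_s a s ^ 2) * (\sum_s b s ^ 2))%N.
Proof.
rewrite -(leq_pmul2l (ltn0Sn 1)) -mulnn.
have -> : (2 * ((\sum_s a s * b s) * (\sum_s a s * b s)) =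
  \sum_s \sum_t 2 * ((a s * b t) * (a t * b s)))%N.
  rewrite big_distrlr big_distrr /=; apply: eq_bigr => s _; rewrite big_distrr.
  by apply: eq_bigr => t _ /=; congr muln; rewrite mulnACA (mulnC (b s)) mulnACA.
have -> : (2 * ((\sum_s a s ^ 2) * (\sum_s b s ^ 2)) =
  \sum_s \sum_t ((a s * b t) ^ 2 + (a t * b s) ^ 2))%N.
  under [RHS]eq_bigr => s _ do rewrite big_split.
  rewrite big_split /= mul2n -addnn; congr addn.
    rewrite big_distrlr /=; apply: eq_bigr => s _; apply: eq_bigr => t _; by rewrite expnMn.
  rewrite exchange_big big_distrlr /=; apply: eq_bigr => s _; apply: eq_bigr => t _; by rewrite expnMn.
by apply: leq_sum => s _; apply: leq_sum => t _; exact: nat_Cauchy.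
Qed.

Section ReflectionPositivity.
Variables (V : finType) (rho : V -> V) (Hp Hm : {set V}).
Hypotheses (rhoK : involutive rho) (Hcover : Hp :|: Hm = setT).
Hypotheses (rhoH : forall x, (rho x \in Hm) = (x \in Hp)).
Hypothesis rho_fix : forall x, x \in Hp :&: Hm -> rho x = x.

Let left_ext (f : pred {set V}) (s : {set V}) :=
  [set A : {set V} | [&& A \subset Hp, A :&: Hm == s & f A]].
Let right_ext (f : pred {set V}) (s : {set V}) :=
  [set A : {set V} | [&& A \subset Hm, A :&: Hp == s & f A]].

Let rho_inj : injective rho := can_inj rhoK.

Lemma mem_rho (A : {set V}) x : (x \in rho @: A) = (rho x \in A).
Proof. by rewrite -{1}(rhoK x) mem_imset. Qed.

Lemma imset_rhoK (A : {set V}) : rho @: (rho @: A) = A.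
Proof. by apply/setP => x; rewrite !mem_rho rhoK. Qed.

Lemma rhoHp x : (rho x \in Hp) = (x \in Hm).
Proof. by rewrite -rhoH rhoK. Qed.

Lemma card_split_halves (f g : pred {set V}) :
  (forall A, f A = f (A :&: Hp)) -> (forall A, g A = g (A :&: Hm)) ->
  #|[set A : {set V} | f A && g A]| = (\sum_s #|left_ext f s| * #|right_ext g s|)%N.
Proof.
move=> fH gH.
pose P := [set p : {set V} * {set V} | [&& p.1 \subset Hp, p.2 \subset Hm, p.1 :&: Hm == p.2 :&: Hp, f p.1 & g p.2]].
have -> : (\sum_s #|left_ext f s| * #|right_ext g s|)%N = #|P|.
  rewrite -sum1_card (partition_big (fun p => p.1 :&: Hm) xpredT) //=; apply: eq_bigr => s _.
  rewrite -cardsX -sum1_card; apply: eq_bigl => -[A B]; rewrite !inE /=.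
  apply/andP/andP => [[/and3P[-> /eqP -> ->] /and3P[-> /eqP -> ->]]|[/and5P[-> -> /eqP e -> ->] /eqP <-]].
    by rewrite !eqxx.
  by rewrite e eqxx.
pose phi (A : {set V}) := (A :&: Hp, A :&: Hm).
rewrite -(card_imset _ (_ : injective phi)); last first.
  by move=> A B [h1 h2]; rewrite -(setIT A) -(setIT B) -Hcover !setIUr h1 h2.
apply: eq_card => -[A B]; rewrite [RHS]inE /=; apply/imsetP/and5P.
  case=> C; rewrite inE => /andP[fC gC] [-> ->]; rewrite !subsetIr -fH -gH; split => //.
  by rewrite setIAC.
case=> AH BH /eqP AB fA gB.
have hp : (A :|: B) :&: Hp = A by rewrite setIUl -AB (setIidPl AH); apply/setUidPl; exact: subsetIl.
have hm : (A :|: B) :&: Hm = B by rewrite setIUl AB (setIidPl BH); apply/setUidPr; exact: subsetIl.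
by exists (A :|: B); rewrite ?inE /phi ?hp ?hm // fH hp gH hm fA.
Qed.

Lemma card_reflect (f : pred {set V}) s :
  #|right_ext (fun A => f (rho @: A)) s| = #|left_ext f s|.
Proof.
rewrite -(card_imset (mem (right_ext _ s)) (imset_inj rho_inj)); apply: eq_card => A.
have fixI (B : {set V}) : rho @: (B :&: Hm :&: Hp) = B :&: Hm :&: Hp.
  apply/setP => x; rewrite mem_rho !in_setI rhoH rhoHp.
  have [xp|] := boolP (x \in Hp); last by rewrite !andbF.
  have [xm|] := boolP (x \in Hm); last by rewrite !andbF.
  by rewrite rho_fix // in_setI xp.
have IE (B : {set V}) : B \subset Hm -> (rho @: B) :&: Hm = B :&: Hp.
  move=> BH; rewrite -{2}(setIidPl BH) -fixI (setIidPl BH); apply/setP => x.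
  by rewrite in_setI !mem_rho in_setI rhoHp.
have SE (B : {set V}) : (rho @: B \subset Hp) = (B \subset Hm).
  apply/subsetP/subsetP => h x; first by move=> xB; rewrite -rhoHp h // mem_imset.
  by rewrite mem_rho => /h; rewrite rhoH.
apply/imsetP/idP => [[B]|]; rewrite inE => /and3P[h1 h2 h3].
  by move=> ->; rewrite inE SE h1 IE // h2 h3.
exists (rho @: A); rewrite ?imset_rhoK // inE imset_rhoK h3 -SE imset_rhoK h1 /=.
by rewrite -IE ?imset_rhoK ?h2 // -SE imset_rhoK.
Qed.

Lemma card_reflect' (g : pred {set V}) s :
  #|left_ext (fun A => g (rho @: A)) s| = #|right_ext g s|.
Proof.
rewrite -card_reflect; apply: eq_card => A; rewrite !inE imset_rhoK //.
Qed.

(** Given the trace s on the common part of Hp and Hm, the two halves are independent, and rho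
    carries the extensions of s on one side to those on the other. Cauchy-Schwarz over s does the
    rest. *)
Lemma reflection_positivity (f g : pred {set V}) :
  (forall A, f A = f (A :&: Hp)) -> (forall A, g A = g (A :&: Hm)) ->
  (#|[set A : {set V} | f A && g A]| ^ 2 <=
   #|[set A : {set V} | f A && f (rho @: A)]| * #|[set A : {set V} | g (rho @: A) && g A]|)%N.
Proof.
move=> fH gH.
have imI (A B : {set V}) : rho @: (A :&: B) = (rho @: A) :&: (rho @: B).
  by apply: imsetI => x y _ _; exact: rho_inj.
have rHp : rho @: Hp = Hm by apply/setP => x; rewrite mem_rho rhoHp.
have rHm : rho @: Hm = Hp by apply/setP => x; rewrite mem_rho rhoH.
rewrite (card_split_halves fH gH) (card_split_halves fH (g := fun A => f (rho @: A))); last first.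
  by move=> A; rewrite fH imI rHm.
rewrite (card_split_halves (f := fun A => g (rho @: A)) _ gH); last first.
  by move=> A; rewrite gH imI rHp.
under [X in (_ <= X * _)%N]eq_bigr => s _ do rewrite card_reflect mulnn.
under [X in (_ <= _ * X)%N]eq_bigr => s _ do rewrite card_reflect' mulnn.
exact: cauchy_schwarz_nat.
Qed.

End ReflectionPositivity.

(** * Unit cubes and reflections of the torus *)

Section Torus.
Variables n d : nat.
Local Notation L := n.+2.
Local Notation V := (torus L d).
Implicit Types (x y j : V) (i k : 'I_d) (a c : 'I_L) (I : {set V}) (b : cube d).

Definition unitv i : V := [ffun k => if k == i then 1 else 0].
Definition emb b : V := [ffun k => if b k then 1 else 0].
Definition upd x i c : V := [ffun k => if k == i then c else x k].
Definition local I j : {set cube d} := [set b | j + emb b \in I].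

Lemma in_local I j b : (b \in local I j) = (j + emb b \in I).
Proof. by rewrite inE. Qed.

Lemma val_ordD a c : val (a + c) = ((a + c) %% L)%N.
Proof. by []. Qed.

Lemma val_succ a : val (a + 1) = (if a == n.+1 :> nat then 0 else a.+1).
Proof.
rewrite val_ordD /= addn1; case: eqP => [->|/eqP ne]; first by rewrite modnn.
by rewrite modn_small // ltnS ltn_neqAle ne -ltnS ltn_ord.
Qed.

Lemma val_opp a : val (- a) = (if a == 0%N :> nat then 0 else L - a)%N.
Proof.
rewrite /= ; case: eqP => [->|/eqP ne]; first by rewrite subn0 modnn.
by rewrite modn_small // ltn_subrL lt0n ne.
Qed.

Lemma val_oppS a : val (- 1 - a) = (n.+1 - a)%N.
Proof.
have -> : -1 - a = - (a + 1) by rewrite opprD addrC.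
rewrite val_opp val_succ; case: (eqVneq (a : nat) n.+1) => [->|ne] /=; first by rewrite subnn.
by rewrite subSS.
Qed.

Lemma succ_neq a : a + 1 != a.
Proof. by rewrite -subr_eq0 addrAC subrr add0r. Qed.

Lemma unitvE i k : unitv i k = (if k == i then 1 else 0).
Proof. by rewrite ffunE. Qed.

Lemma addvE x y k : (x + y) k = x k + y k.
Proof. by rewrite ffunE. Qed.

Lemma oppvE x k : (- x) k = - x k.
Proof. by rewrite ffunE. Qed.

Lemma torus_adj_unitv x i : torus_adj x (x + unitv i).
Proof.
have e : [set k | x k != (x + unitv i) k] = [set i].
  apply/setP => k; rewrite !inE addvE unitvE; case: (eqVneq k i) => [->|_]; last by rewrite addr0 eqxx.
  by rewrite eq_sym succ_neq.
rewrite /torus_adj e cards1 eqxx /=; apply/forallP => k; apply/implyP => ne.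
have : k \in [set k | x k != (x + unitv i) k] by rewrite inE.
rewrite e inE => /eqP ->; rewrite /differ_by_1_mod addvE unitvE eqxx val_ordD modn_mod.
by rewrite eqxx.
Qed.

Lemma torus_adj_sym x y : torus_adj x y = torus_adj y x.
Proof.
rewrite /torus_adj; congr andb.
  by congr (_ == _); apply: eq_card => k; rewrite !inE eq_sym.
by apply: eq_forallb => k; rewrite eq_sym /differ_by_1_mod orbC.
Qed.

Lemma torus_adjP x y : reflect (exists i, y = x + unitv i \/ x = y + unitv i) (torus_adj x y).
Proof.
apply: (iffP idP) => [/andP[/cards1P[i e] /forallP h]|[i [->|->]]]; last first.
- by rewrite torus_adj_sym torus_adj_unitv.
- exact: torus_adj_unitv.
have mem k : (x k != y k) = (k == i) by have := in_set1 k i; rewrite -e inE.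
exists i; have ki k : k != i -> x k = y k by move=> ne; apply/eqP; rewrite -[_ == _]negbK mem.
have := h i; rewrite mem eqxx /= => /orP[] /eqP q; [left|right];
  apply/ffunP => k; rewrite addvE unitvE; case: (eqVneq k i) => [->|/ki ->]; rewrite ?addr0 //;
  by apply/val_inj; rewrite val_ordD /= q modn_small.
Qed.

Lemma independentP I : reflect (forall x i, x \in I -> x + unitv i \notin I) (independent I).
Proof.
apply: (iffP forall_inP) => [h x i xI|h x xI].
  apply/negP => yI; have /forall_inP/(_ _ yI)/negP := h x xI; apply; exact: torus_adj_unitv.
apply/forall_inP => y yI; apply/torus_adjP => -[i [e|e]]; first by have := h x i xI; rewrite -e yI.
by have := h y i yI; rewrite -e xI.
Qed.

Lemma emb_flip b i : ~~ b i -> emb (flip i b) = emb b + unitv i.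
Proof.
move=> bi; apply/ffunP => k; rewrite addvE !ffunE; case: eqP => [->|_]; last by rewrite addr0.
by rewrite bi (negbTE bi) add0r.
Qed.

Lemma local_indep I j : independent I -> cube_indep (local I j).
Proof.
move=> /independentP ind; apply/forall_inP => b; rewrite inE => bI; apply/forallP => i.
rewrite inE; case: (boolP (b i)) => bi; last by rewrite (emb_flip bi) addrA; exact: ind.
apply/negP => cI; have /negP := ind _ i cI; apply.
by rewrite -addrA -emb_flip ?flipK // ffunE eqxx bi.
Qed.

Definition rsite i c x : V := upd x i (c + c - x i).
(** In direction i the cube spans j i and j i + 1. Its mirror image spans 2 c - 1 - j i and 2 c - j
    i, hence the shift by one against [rsite]. *)
Definition rcube i c j : V := upd j i (c + c - 1 - j i).

Lemma rsiteK i c : involutive (rsite i c).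
Proof.
move=> x; apply/ffunP => k; rewrite !ffunE eqxx; case: eqP => // ->.
by rewrite opprB addrC subrK.
Qed.

Lemma rcubeK i c : involutive (rcube i c).
Proof.
move=> x; apply/ffunP => k; rewrite !ffunE eqxx; case: eqP => // ->.
by rewrite opprB addrC subrK.
Qed.

Lemma rsite_emb i c j b : rsite i c (j + emb b) = rcube i c j + emb (flip i b).
Proof.
apply/ffunP => k; rewrite !ffunE; case: eqP => [->|_ //].
by case: (b i) => /=; ring.
Qed.

Lemma local_reflect I i c j : local (rsite i c @: I) j = flip i @: local I (rcube i c j).
Proof.
apply/setP => b; rewrite flip_imset_mem !inE -rsite_emb.
by rewrite -{1}(rsiteK i c (j + emb b)) mem_imset //; exact: can_inj (rsiteK i c).
Qed.

Lemma rsite_unitv_neq i c x k : k != i -> rsite i c (x + unitv k) = rsite i c x + unitv k.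
Proof.
move=> ki; apply/ffunP => l; rewrite !ffunE.
case: (eqVneq l i) => [->|//]; rewrite eq_sym (negbTE ki) !addr0 //.
Qed.

Lemma rsite_unitv i c x : rsite i c (x + unitv i) + unitv i = rsite i c x.
Proof.
apply/ffunP => l; rewrite !ffunE.
by case: (eqVneq l i) => _; rewrite ?eqxx ?addr0 // opprD addrA subrK.
Qed.

Lemma independent_reflect i c I : independent (rsite i c @: I) = independent I.
Proof.
have imp J : independent J -> independent (rsite i c @: J).
  move=> /independentP ind; apply/independentP => x k.
  rewrite !(mem_rho (rsiteK i c)) => xJ.
  case: (eqVneq k i) => [->|ki]; last by rewrite rsite_unitv_neq //; exact: ind.
  by apply/negP => yJ; have /negP := ind _ i yJ; rewrite rsite_unitv.
apply/idP/idP; last exact: imp.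
by move/imp; rewrite imset_rhoK //; exact: rsiteK.
Qed.

End Torus.

Section Fold.
Variables n d e : nat.
Hypothesis n_even : ~~ odd n.
Local Notation L := n.+2.
Local Notation V := (torus L d).
Local Notation h := n./2.+1.
Variables (i : 'I_d) (p : 'I_L).

(* The pair of hyperplanes through coordinates p and p + L/2 in direction i, which both
   halves contain. *)
Definition height (x : V) : nat := val (x i - p).
Definition upper : {set V} := [set x | height x <= h]%N.
Definition lower : {set V} := [set x | (h <= height x) || (height x == 0)]%N.
Definition upper_cube : {set V} := [set j | height j < h]%N.

Lemma half_L : L = (h + h)%N.
Proof. by rewrite addSn addnS addnn even_halfK. Qed.

Lemma height_lt x : (height x < L)%N.
Proof. exact: ltn_ord. Qed.

Lemma height_rsite x : height (rsite i p x) = (if height x == 0 then 0 else L - height x)%N.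
Proof.
rewrite /height ffunE eqxx -val_opp; congr val; ring.
Qed.

Lemma height_rcube x : height (rcube i p x) = (n.+1 - height x)%N.
Proof. rewrite /height ffunE eqxx -val_oppS; congr val; ring. Qed.

Lemma height_unitv x : height (x + unitv n i) = (if height x == n.+1 then 0 else (height x).+1).
Proof. by rewrite /height addvE unitvE eqxx -val_succ; congr val; ring. Qed.

Lemma height_unitv_neq x k : k != i -> height (x + unitv n k) = height x.
Proof. by move=> ki; rewrite /height addvE unitvE eq_sym (negbTE ki) addr0. Qed.

Lemma height_emb x b : height (x + emb n b) =
  (if b i then if height x == n.+1 then 0 else (height x).+1 else height x).
Proof.
rewrite -height_unitv /height !addvE unitvE eqxx ffunE.
by case: (b i); rewrite ?addr0.
Qed.

Lemma upperU_lower : upper :|: lower = setT.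
Proof. by apply/setP => x; rewrite !inE; case: (leqP (height x) h) => //= /ltnW ->. Qed.

Lemma rsite_lower x : (rsite i p x \in lower) = (x \in upper).
Proof.
rewrite !inE height_rsite; have := height_lt x; have := half_L.
by case: eqP => [->|] //=; lia.
Qed.

Lemma rsite_fix x : x \in upper :&: lower -> rsite i p x = x.
Proof.
rewrite !inE => hx; apply/ffunP => k; rewrite ffunE; case: eqP => // ->.
have e0 : height (rsite i p x) = height x.
  rewrite height_rsite; have := half_L; have := height_lt x.
  by case: eqP => [->|] //; lia.
apply: (addIr (- p)); apply: val_inj; rewrite -[RHS]e0 /height ffunE eqxx //.
Qed.

Lemma upper_cube_emb j b : j \in upper_cube -> j + emb n b \in upper.
Proof.
rewrite !inE height_emb; have := half_L; case: (b i); last by move=> _; exact: ltnW.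
by case: eqP => //; lia.
Qed.

Lemma lower_cube_emb j b : j \notin upper_cube -> j + emb n b \in lower.
Proof.
rewrite !inE -leqNgt height_emb => hj; case: (b i); last by rewrite hj.
by case: eqP => // _; rewrite (leq_trans hj).
Qed.

Lemma rcube_upper j : (rcube i p j \in upper_cube) = (j \notin upper_cube).
Proof. by rewrite !inE height_rcube -leqNgt; have := height_lt j; have := half_L; lia. Qed.

Lemma edge_upper_lower x k : (x \in upper) && (x + unitv n k \in upper) || (x \in lower) && (x + unitv n k \in lower).
Proof.
have := half_L; case: (eqVneq k i) => [->|ki].
  rewrite !inE height_unitv; have := height_lt x; case: (eqVneq (height x) n.+1) => [->|]; lia.
by rewrite !inE height_unitv_neq //; lia.
Qed.

(** The halves share both hyperplanes, so every edge lies within one of them and independence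
    factors as reflection positivity requires. *)
Lemma independent_split (I : {set V}) :
  independent I = independent (I :&: upper) && independent (I :&: lower).
Proof.
apply/idP/andP => [/independentP ind|[/independentP i1 /independentP i2]].
  split; apply/independentP => x k /setIP[xI _]; rewrite in_setI negb_and ind //.
apply/independentP => x k xI; apply/negP => yI; case/orP: (edge_upper_lower x k) => /andP[xh yh].
  by have := i1 x k; rewrite !in_setI xI xh yI yh => /(_ isT).
by have := i2 x k; rewrite !in_setI xI xh yI yh => /(_ isT).
Qed.

Lemma local_upper I j : j \in upper_cube -> local (I :&: upper) j = local I j.
Proof. by move=> jC; apply/setP => b; rewrite !in_local in_setI (upper_cube_emb b jC) andbT. Qed.

Lemma local_lower I j : j \notin upper_cube -> local (I :&: lower) j = local I j.
Proof. by move=> jC; apply/setP => b; rewrite !in_local in_setI (lower_cube_emb b jC) andbT. Qed.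

Lemma relaxed_reflect (I : {set V}) j :
  relaxed e (local (rsite i p @: I) j) = relaxed e (local I (rcube i p j)).
Proof. by rewrite local_reflect relaxed_flip. Qed.

Definition relaxed_on (J : {set V}) : {set {set V}} :=
  [set I : {set V} | independent I && [forall j in J, relaxed e (local I j)]].

(** The preimage of J under [fold_up] is the upper part of J together with its mirror image;
    [fold_down] does the same with the lower part. *)
Definition fold_up (j : V) : V := if j \in upper_cube then j else rcube i p j.
Definition fold_down (j : V) : V := if j \in upper_cube then rcube i p j else j.

Lemma fold_inequality (J : {set V}) :
  (#|relaxed_on J| ^ 2 <= #|relaxed_on (fold_up @^-1: J)| * #|relaxed_on (fold_down @^-1: J)|)%N.
Proof.
pose f (I : {set V}) := independent (I :&: upper) && [forall j in J :&: upper_cube, relaxed e (local (I :&: upper) j)].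
pose g (I : {set V}) := independent (I :&: lower) && [forall j in J :\: upper_cube, relaxed e (local (I :&: lower) j)].
have rK := @rsiteK n d i p.
have fH (I : {set V}) : f I = f (I :&: upper) by rewrite /f -setIA setIid.
have gH (I : {set V}) : g I = g (I :&: lower) by rewrite /g -setIA setIid.
have imI (A B : {set V}) : rsite i p @: (A :&: B) = (rsite i p @: A) :&: (rsite i p @: B).
  by apply: imsetI => x y _ _; exact: (can_inj rK).
have rU : rsite i p @: upper = lower.
  by apply/setP => x; rewrite (mem_rho rK) -rsite_lower rK.
have rL : rsite i p @: lower = upper.
  by apply/setP => x; rewrite (mem_rho rK) rsite_lower.
have indU (I : {set V}) : independent ((rsite i p @: I) :&: upper) = independent (I :&: lower).
  by rewrite -rL -imI independent_reflect.
have indL (I : {set V}) : independent ((rsite i p @: I) :&: lower) = independent (I :&: upper).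
  by rewrite -rU -imI independent_reflect.
have := reflection_positivity rK upperU_lower rsite_lower rsite_fix fH gH.
congr (_ ^ 2 <= _ * _)%N; apply: eq_card => I; rewrite !inE /f /g ?indU ?indL.
- rewrite (independent_split I) andbACA; congr andb.
  apply/andP/forall_inP => [[/forall_inP h1 /forall_inP h2] j jJ|h1].
    have [jC|jC] := boolP (j \in upper_cube).
      by rewrite -(local_upper I jC) h1 // in_setI jJ.
    by rewrite -(local_lower I jC) h2 // in_setD jJ jC.
  split; apply/forall_inP => j; first by move=> /setIP[jJ jC]; rewrite (local_upper _ jC) h1.
  by move=> /setDP[jJ jC]; rewrite (local_lower _ jC) h1.
- rewrite (independent_split I) andbACA; congr andb.
  apply/andP/forall_inP => [[/forall_inP h1 /forall_inP h2] j|h1].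
    rewrite inE /fold_up; case: ifP => jC jJ.
      by rewrite -(local_upper I jC) h1 // in_setI jJ.
    have rC : rcube i p j \in upper_cube by rewrite rcube_upper jC.
    have := h2 (rcube i p j); rewrite in_setI jJ rC => /(_ isT).
    by rewrite (local_upper _ rC) relaxed_reflect rcubeK.
  split; apply/forall_inP => j /setIP[jJ jC]; rewrite (local_upper _ jC).
    by apply: h1; rewrite inE /fold_up jC.
  rewrite relaxed_reflect; apply: h1.
  by rewrite inE /fold_up rcube_upper jC rcubeK.
- rewrite (independent_split I) andbACA; congr andb.
  apply/andP/forall_inP => [[/forall_inP h1 /forall_inP h2] j|h1].
    rewrite inE /fold_down; case: ifP => jC jJ.
      have rC : rcube i p j \notin upper_cube by rewrite rcube_upper jC.
      have := h1 (rcube i p j); rewrite in_setD jJ rC => /(_ isT).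
      by rewrite (local_lower _ rC) relaxed_reflect rcubeK.
    by rewrite -(local_lower I (negbT jC)) h2 // in_setD jJ jC.
  split; apply/forall_inP => j /setDP[jJ jC]; rewrite (local_lower _ jC).
    rewrite relaxed_reflect; apply: h1.
    by rewrite inE /fold_down rcube_upper jC rcubeK.
  by apply: h1; rewrite inE /fold_down (negbTE jC).
Qed.

Lemma card_fold (J : {set V}) : (#|fold_up @^-1: J| + #|fold_down @^-1: J| = 2 * #|J|)%N.
Proof.
have rinj : injective (rcube i p) := can_inj (@rcubeK n d i p).
have e1 : #|(fold_up @^-1: J) :&: upper_cube| = #|J :&: upper_cube|.
  by apply: eq_card => j; rewrite !in_setI [_ \in _ @^-1: _]inE /fold_up; case: (boolP (j \in upper_cube)); rewrite ?andbF.
have e2 : #|(fold_up @^-1: J) :\: upper_cube| = #|J :&: upper_cube|.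
  rewrite -(card_imset _ rinj); apply: eq_card => j; rewrite (mem_rho (@rcubeK n d i p)).
  rewrite in_setD in_setI [_ \in _ @^-1: _]inE /fold_up rcube_upper negbK andbC.
  by case: (boolP (j \in upper_cube)); rewrite ?andbF // rcubeK.
have e3 : #|(fold_down @^-1: J) :&: upper_cube| = #|J :\: upper_cube|.
  rewrite -(card_imset _ rinj); apply: eq_card => j; rewrite (mem_rho (@rcubeK n d i p)).
  rewrite in_setD in_setI [_ \in _ @^-1: _]inE /fold_down rcube_upper andbC.
  by case: (boolP (j \in upper_cube)); rewrite ?andbF //= rcubeK.
have e4 : #|(fold_down @^-1: J) :\: upper_cube| = #|J :\: upper_cube|.
  by apply: eq_card => j; rewrite !in_setD [_ \in _ @^-1: _]inE /fold_down; case: (boolP (j \in upper_cube)).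
rewrite -(cardsID upper_cube (fold_up @^-1: J)) -(cardsID upper_cube (fold_down @^-1: J)) e1 e2 e3 e4.
by rewrite -(cardsID upper_cube J); lia.
Qed.

End Fold.

Section Chessboard.
Variables (R : realType) (n d e : nat).
Hypothesis n_even : ~~ odd n.
Local Notation L := n.+2.
Local Notation V := (torus L d).
Local Notation h := n./2.+1.
Implicit Types (x y j : V) (i k : 'I_d) (J : {set V}).

Lemma updE x i c k : upd x i c k = if k == i then c else x k.
Proof. by rewrite ffunE. Qed.

Lemma upd_const (A : Type) (G : V -> A) :
  (forall x i c, G (upd x i c) = G x) -> forall x y, G x = G y.
Proof.
move=> Gu x y.
suff H (s : seq 'I_d) : G [ffun k => if k \in s then y k else x k] = G x.
  by rewrite -(H (enum 'I_d)); congr G; apply/ffunP => k; rewrite ffunE mem_enum.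
elim: s => [|i s <-]; first by congr G; apply/ffunP => k; rewrite ffunE.
rewrite -[RHS](Gu _ i (y i)); congr G; apply/ffunP => k; rewrite !ffunE in_cons.
by case: eqP => [->|].
Qed.

Lemma val_sub (a c : 'I_L) : val (a - c) = (if c <= a then a - c else L + a - c)%N.
Proof.
rewrite val_ordD val_opp; have aL := ltn_ord a; have cL := ltn_ord c.
case: (eqVneq (c : nat) 0%N) => [->|c0]; first by rewrite addn0 subn0 leq0n modn_small.
case: leqP => ca; last by rewrite modn_small; lia.
by rewrite (_ : a + (L - c) = a - c + L)%N ?modnDr ?modn_small; lia.
Qed.

(* A fold at the hyperplane r extends independence of the coordinate i from below r to
   below 2 r, so that the folds at 1, 2, ..., L/2 exhaust this coordinate. *)
Definition flat_below i r J := forall x, (x i < r)%N -> (x \in J) = (upd x i 0 \in J).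
Definition flat i J := forall x c, (upd x i c \in J) = (x \in J).

Lemma flat_below_fold i r J (p : 'I_L) : p = r :> nat -> (0 < r)%N -> (r <= h)%N -> flat_below i r J ->
  flat_below i (r + r) (fold_down i p @^-1: J).
Proof.
move=> pr r0 rh cJ; have hL := half_L n_even.
have low x : (x i < r)%N -> fold_down i p x = x.
  move=> xr; have hx : height i p x = (L + x i - r)%N by rewrite /height val_sub pr leqNgt xr.
  have up : (x \in upper_cube i p) = false by rewrite inE hx; lia.
  by rewrite /fold_down up.
move=> x xr; rewrite !inE; have x0 : (upd x i 0%R i < r)%N by rewrite updE eqxx.
rewrite (low _ x0); have [xr1|xr1] := ltnP (x i) r; first by rewrite low //; exact: cJ.
have hx : height i p x = (x i - r)%N by rewrite /height val_sub pr xr1.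
have up : x \in upper_cube i p by rewrite inE hx; lia.
have ri : (rcube i p x i < r)%N.
  rewrite updE eqxx (_ : p + p - 1 - x i = (p - 1) - (x i - p)); last by ring.
  have v1 : p - 1 = r.-1 :> nat by rewrite [LHS]val_sub pr /= r0 subn1.
  have v2 : x i - p = (x i - r)%N :> nat := hx.
  by rewrite [X in (X < r)%N]val_sub v1 v2; case: ifP; lia.
rewrite /fold_down up (cJ _ ri); congr (_ \in J); apply/ffunP => k; rewrite !updE.
by case: eqP.
Qed.

Lemma flat_fold i k J (p : 'I_L) : k != i -> flat k J -> flat k (fold_down i p @^-1: J).
Proof.
move=> ki fJ x c; rewrite !inE.
have -> : fold_down i p (upd x k c) = upd (fold_down i p x) k c.
  rewrite /fold_down !inE /height updE eq_sym (negbTE ki); case: ifP => // _.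
  apply/ffunP => l; rewrite !updE; case: (eqVneq l i) => [->|//].
  by rewrite eq_sym (negbTE ki).
exact: fJ.
Qed.

Lemma flat_of_below i J : flat_below i L J -> flat i J.
Proof.
move=> f x c; rewrite f ?ltn_ord // [RHS]f ?ltn_ord //; congr (_ \in J).
by apply/ffunP => k; rewrite !updE; case: eqP.
Qed.

Section Maximum.
Variable g : R.
Let Z : R := #|[set I : {set V} | independent I]|%:R.
Let Phi J : R := #|relaxed_on e J|%:R * expR (g * #|J|%:R).
Let maximizer J := forall J', Phi J' <= Phi J.

Let Z0 : 0 < Z.
Proof.
rewrite ltr0n; apply/card_gt0P; exists set0; rewrite inE.
by apply/independentP => x i; rewrite inE.
Qed.

Let Phi0 : Phi set0 = Z.
Proof.
rewrite /Phi cards0 mulr0 expR0 mulr1; congr (_%:R); apply: eq_card => I; rewrite !inE.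
by case: (independent I) => //=; apply/forall_inP => j; rewrite inE.
Qed.

(** The two folds of J have 2 #|J| points together, so Phi J ^ 2 is at most the product of their
    values. When Phi J is the maximum, both factors attain it. *)
Let maximizer_fold i p J : maximizer J -> maximizer (fold_down i p @^-1: J).
Proof.
move=> mJ J'; apply: (le_trans (mJ J')).
have PJ : 0 < Phi J by apply: lt_le_trans (mJ set0); rewrite Phi0.
have ineq : Phi J ^+ 2 <= Phi (fold_up i p @^-1: J) * Phi (fold_down i p @^-1: J).
  rewrite /Phi mulrACA -expRD -mulrDr -natrD card_fold // exprMn expr2 -!natrM -expRM_natl.
  rewrite mulrCA -natrM ler_wpM2r ?expR_ge0 // ler_nat mulnn.
  exact: fold_inequality.
rewrite leNgt; apply/negP => lt.
have : Phi J ^+ 2 < Phi J ^+ 2.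
  apply: (le_lt_trans ineq); rewrite expr2.
  apply: (@le_lt_trans _ _ (Phi J * Phi (fold_down i p @^-1: J))).
    by rewrite ler_wpM2r ?mulr_ge0 ?ler0n ?expR_ge0.
  by rewrite ltr_pM2l.
by rewrite ltxx.
Qed.

Let flatten_coord i (s : seq 'I_d) J : i \notin s -> maximizer J -> (forall k, k \in s -> flat k J) ->
  exists J', [/\ maximizer J', flat i J' & forall k, k \in s -> flat k J'].
Proof.
move=> iNs mJ fJ; have hL := half_L n_even.
have H r : (0 < r <= h)%N -> exists J', [/\ maximizer J', flat_below i r J' & forall k, k \in s -> flat k J'].
  elim: r => // r IH /andP[_ rh]; case: (posnP r) => [->|r0].
    exists J; split => // x; rewrite ltnS leqn0 => /eqP x0; congr (_ \in J); apply/ffunP => k; rewrite updE.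
    by case: eqP => // ->; apply: val_inj.
  have [|J' [mJ' cJ' fJ']] := IH; first by rewrite r0 ltnW.
  have rL : (r < L)%N by lia.
  (* Only r.+1 of the 2 r values gained are kept, so that the next fold may sit at r.+1; the last
     one, at h, reaches L exactly. *)
  exists (fold_down i (Ordinal rL) @^-1: J'); split; first exact: maximizer_fold.
    move=> x xr; apply: (flat_below_fold (r := r)) => //; first exact: ltnW.
    by apply: leq_trans xr _; lia.
  move=> k ks; apply: flat_fold (fJ' k ks); by apply: contraNneq iNs => <-.
have [|J' [mJ' cJ' fJ']] := H h; first by rewrite leqnn.
have rL : (h < L)%N by lia.
exists (fold_down i (Ordinal rL) @^-1: J'); split; first exact: maximizer_fold.
  by apply: flat_of_below => x xL; apply: (flat_below_fold (r := h)) => //; rewrite -hL.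
move=> k ks; apply: flat_fold (fJ' k ks); by apply: contraNneq iNs => <-.
Qed.

(** Folding turns some maximizer of Phi into one that is constant in every coordinate, hence empty
    or everything. Phi is Z at the empty set and at most Z at [setT] by hypothesis. *)
Lemma chessboard_of_constant :
  #|relaxed_on e (setT : {set V})|%:R <= Z * expR (- (g * #|{: V}|%:R)) ->
  forall J, #|relaxed_on e J|%:R <= Z * expR (- (g * #|J|%:R)).
Proof.
move=> hT J; rewrite expRN ler_pdivlMr ?expR_gt0 // -/(Phi J).
have [J0 mJ0] : exists J0, maximizer J0.
  by case: (@Order.TotalTheory.arg_maxP _ _ _ set0 xpredT Phi isT) => J0 _ m; exists J0 => J'; exact: m.
have [J1 [mJ1 fJ1]] : exists J1, maximizer J1 /\ forall k, k \in enum 'I_d -> flat k J1.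
  elim: (enum 'I_d) (enum_uniq 'I_d) => [_|i s IH /= /andP[iNs us]]; first by exists J0.
  have [J1 [mJ1 fJ1]] := IH us; have [J2 [m2 f2 f2']] := flatten_coord iNs mJ1 fJ1.
  by exists J2; split => // k; rewrite in_cons => /orP[/eqP->|/f2'].
apply: (le_trans (mJ1 J)).
have const := upd_const (G := fun x => x \in J1) (fun x i c => fJ1 i (mem_enum _ _) x c).
have [->|[x xJ]] := set_0Vmem J1; first by rewrite Phi0.
have -> : J1 = setT by apply/setP => y; rewrite -(const x y) xJ inE.
by rewrite /Phi cardsT -ler_pdivlMr ?expR_gt0 // -expRN.
Qed.

End Maximum.

End Chessboard.

(** * Tiling the torus by disjoint unit cubes *)

Section Tiling.
Variables (R : realType) (n d e : nat).
Hypothesis n_even : ~~ odd n.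
Local Notation L := n.+2.
Local Notation V := (torus L d).
Local Notation h := n./2.+1.
Implicit Types (x y j : V) (i k : 'I_d) (I : {set V}).

Definition parity x : bool := odd (\sum_k x k).
Definition sublattice (s : bool) : {set V} := [set x | parity x == s].

Lemma parity_unitv x i : parity (x + unitv n i) = ~~ parity x.
Proof.
rewrite /parity (bigD1 i) // [in RHS](bigD1 i) //= !oddD addvE unitvE eqxx.
rewrite (eq_bigr (fun k => nat_of_ord (x k))); last first.
  by move=> k ki; rewrite addvE unitvE (negbTE ki) addr0.
rewrite [nat_of_ord (x i + 1)]val_succ.
case: (eqVneq (x i : nat) n.+1) => [->|_]; last by rewrite /= addNb.
by rewrite /= n_even; case: (odd _).
Qed.

Lemma card_sublattice s (i : 'I_d) : (#|sublattice s| * 2 = #|{: V}|)%N.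
Proof.
have inj : injective (fun x => x + unitv n i) by exact: addIr.
have e1 : #|sublattice (~~ s)| = #|sublattice s|.
  rewrite -(card_imset (mem (sublattice s)) inj); apply: eq_card => y; rewrite inE; apply/eqP/imsetP.
    move=> ys; exists (y - unitv n i); last by rewrite subrK.
    by move: ys; rewrite -{1}(subrK (unitv n i) y) parity_unitv => /negb_inj ys; rewrite inE ys.
  by case=> x; rewrite inE => /eqP <- ->; rewrite parity_unitv.
rewrite muln2 -addnn -{2}e1 -(cardsC (sublattice s)); congr addn.
by apply: eq_card => x; rewrite !inE; case: (parity x); case: (s).
Qed.

Lemma independent_sublattice I s : I \subset sublattice s -> independent I.
Proof.
move=> /subsetP sub; apply/independentP => x i xI; apply/negP => yI.
have := sub _ yI; have := sub _ xI; rewrite !inE parity_unitv => /eqP ->; by case: (s).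
Qed.

Lemma card_independent_ge (i : 'I_d) : pow2 (#|{: V}|%:R / 2 : R) <= #|[set I : {set V} | independent I]|%:R.
Proof.
rewrite -(card_sublattice false i) natrM mulfK ?pnatr_eq0 // pow2_nat -natrX -card_powerset ler_nat.
by apply: subset_leq_card; apply/subsetP => I; rewrite powersetE inE; exact: independent_sublattice.
Qed.

Definition tile (t : {ffun 'I_d -> 'I_h}) : V := [ffun i => inord (t i).*2].

Lemma val_tile t i : tile t i = (t i).*2 :> nat.
Proof.
rewrite ffunE inordK //; have := ltn_ord (t i); have := half_L n_even; lia.
Qed.

Lemma tile_cover x : exists t b, x = tile t + emb n b.
Proof.
have hx i : ((x i)./2 < h)%N by have := ltn_ord (x i); have := half_L n_even; lia.
exists [ffun i => Ordinal (hx i)], [ffun i => odd (x i)]; apply/ffunP => i.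
rewrite addvE [emb _ _ _]ffunE.
have e1 : tile [ffun i => Ordinal (hx i)] i = (x i)./2.*2 :> nat by rewrite val_tile ffunE.
move: (tile _ i) e1 => w e1; rewrite ffunE; apply: val_inj.
have := odd_double_half (x i); case: (odd (x i)) => ox; last by rewrite addr0 /= e1 -{1}ox.
rewrite [RHS]val_succ e1; case: eqP => [e2|_]; last by rewrite /= -{1}ox.
by have := congr1 odd e2; rewrite odd_double /= (negbTE n_even).
Qed.

(** As L is even, the cubes with even corners cover the torus, so a set is determined by its
    patterns on these h ^ d cubes. *)
Lemma card_relaxed_everywhere :
  (#|relaxed_on e (setT : {set V})| <= #|[set K : {set cube d} | cube_indep K && relaxed e K]| ^ (h ^ d))%N.
Proof.
pose f I := [ffun t => local I (tile t)] : {ffun {ffun 'I_d -> 'I_h} -> {set cube d}}.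
have finj : injective f.
  move=> I I' /ffunP eI; apply/setP => x; have [t [b ->]] := tile_cover x.
  by have := eI t; rewrite !ffunE => /setP/(_ b); rewrite !in_local.
have -> : (h ^ d = #|{: {ffun 'I_d -> 'I_h}}|)%N by rewrite card_ffun !card_ord.
rewrite -card_ffun_on -(card_imset _ finj); apply: subset_leq_card.
apply/subsetP => _ /imsetP[I II ->]; move: II; rewrite inE => /andP[ind /forall_inP rel].
apply/ffun_onP => t; rewrite ffunE inE local_indep // rel //.
Qed.

Lemma chessboard (g : R) (J : {set V}) : (0 < d)%N ->
  #|[set K : {set cube d} | cube_indep K && relaxed e K]|%:R <=
     pow2 ((2 ^ d.-1)%:R : R) * expR (- (g * (2 ^ d)%:R)) ->
  #|relaxed_on e J|%:R <= #|[set I : {set V} | independent I]|%:R * expR (- (g * #|J|%:R)).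
Proof.
move=> d0 hA; apply: chessboard_of_constant => //.
have cV : #|{: V}| = (2 ^ d * h ^ d)%N.
  by rewrite card_ffun !card_ord -expnMn; congr (_ ^ _)%N; rewrite half_L // addnn mul2n.
apply: (@le_trans _ _ (#|[set K : {set cube d} | cube_indep K && relaxed e K]|%:R ^+ (h ^ d))).
  by rewrite -natrX ler_nat card_relaxed_everywhere.
apply: (@le_trans _ _ ((pow2 ((2 ^ d.-1)%:R : R) * expR (- (g * (2 ^ d)%:R))) ^+ (h ^ d))).
  by apply: lerXn2r hA; rewrite nnegrE ?ler0n //; apply: mulr_ge0; [exact: pow2_ge0|exact: expR_ge0].
rewrite exprMn -!expRM_natl cV natrM mulrN mulrCA.
have -> : g * ((2 ^ d)%:R * (h ^ d)%:R) = (h ^ d)%:R * (g * (2 ^ d)%:R) by ring.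
rewrite ler_wpM2r ?expR_ge0 //; have := card_independent_ge (Ordinal d0).
rewrite cV /pow2 natrM => le; apply: le_trans le; rewrite ler_expR.
have -> : (2 ^ d)%:R = 2 * (2 ^ d.-1)%:R :> R by rewrite -natrM -expnS prednK.
by rewrite le_eqVlt; apply/orP; left; apply/eqP; field.
Qed.

End Tiling.

(** * Bad cubes of the torus *)

Section Skew.
Variable d : nat.
Local Notation N := (2 ^ d)%N.
Implicit Types (X : {set cube d}) (i k : 'I_d).

(** In every other direction both facets hold at least a quarter of X, so each neighbour sees a
    substantial part of it. *)
Definition skewed X : {set 'I_d} := [set i | [exists s, 4 * #|X :&: facet i s| < #|X|]%N].

Let sgn i (s : bool) (x : cube d) : int := if x i == s then -1 else 1.

Let sum_sgn i s k u : \sum_x sgn i s x * sgn k u x = if i == k then (-1) ^+ (s (+) u) * N%:Z else 0.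
Proof.
case: (eqVneq i k) => [<-|ik].
  rewrite (eq_bigr (fun=> (-1) ^+ (s (+) u))); last first.
    by move=> x _; rewrite /sgn; case: (x i); case: (s); case: (u).
  by rewrite sumr_const card_cube -mulr_natr natz.
have : \sum_x sgn i s x * sgn k u x = - \sum_x sgn i s x * sgn k u x.
  rewrite {1}(reindex_inj (@flip_inj d i)) /= -sumrN; apply: eq_bigr => x _.
  by rewrite /sgn !ffunE eqxx [k == i]eq_sym (negbTE ik); case: (x i); case: (x k); case: (s); case: (u).
by move=> e; apply/eqP; rewrite -[_ == 0](@mulrn_eq0 int _ 2) mulr2n {1}e addNr.
Qed.

Let second_moment_arith (D m z a b : int) : 4 * z * m * a <= m * m * b + 4 * z * z * m ->
  m * m * b <= m * m * (D * z) -> z * m * (D * m) <= z * m * (2 * a) -> D * m * (z * m) <= 4 * z * (z * m).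
Proof. lra. Qed.

(* Bessel's inequality for the first level characters of the cube. *)
Lemma card_skewed X : (#|skewed X| * #|X| <= 4 * N)%N.
Proof.
have [->|[x0 x0X]] := set_0Vmem X; first by rewrite cards0 muln0.
have X0 : (0 < #|X|)%N by apply/card_gt0P; exists x0.
pose side i := odflt true [pick s | 4 * #|X :&: facet i s| < #|X|]%N.
have sideP i : i \in skewed X -> (4 * #|X :&: facet i (side i)| < #|X|)%N.
  by rewrite inE => /existsP[s hs]; rewrite /side; case: pickP => // /(_ s); rewrite hs.
pose S x : int := \sum_(i in skewed X) sgn i (side i) x.
pose D := #|skewed X|; pose m := #|X|.
have sumX : (D%:Z * m%:Z <= 2 * \sum_(x in X) S x).
  rewrite exchange_big /= mulr_sumr; have -> : D%:Z * m%:Z = \sum_(i in skewed X) m%:Z.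
    by rewrite sumr_const -mulr_natl natz.
  apply: ler_sum => i /sideP hi.
  have -> : \sum_(x in X) sgn i (side i) x = m%:Z - 2 * #|X :&: facet i (side i)|%:Z.
    rewrite -!natz -!sumr_const; apply/eqP; rewrite eq_sym subr_eq; apply/eqP.
    have -> : \sum_(x in X :&: facet i (side i)) (1 : int) = \sum_(x in X) (x i == side i)%:R.
      rewrite big_mkcond [RHS]big_mkcond; apply: eq_bigr => x _; rewrite !inE.
      by case: (x \in X); case: (x i == side i).
    by rewrite mulr_sumr -big_split; apply: eq_bigr => x _; rewrite /= /sgn; case: (x i == side i).
  by move: hi; rewrite -/m; lia.
have sumS2 : \sum_x S x * S x = D%:Z * N%:Z.
  rewrite (eq_bigr (fun x => \sum_(i in skewed X) \sum_(k in skewed X) sgn i (side i) x * sgn k (side k) x)); last first.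
    by move=> x _; rewrite /S big_distrlr.
  rewrite exchange_big /=.
  have -> : D%:Z * N%:Z = \sum_(i in skewed X) N%:Z by rewrite sumr_const -mulr_natl natz.
  apply: eq_bigr => i iS; rewrite exchange_big /=.
  under eq_bigr => k _ do rewrite sum_sgn.
  rewrite (bigD1 i) //= eqxx addbb mul1r big1 ?addr0 // => k /andP[_ ki].
  by rewrite eq_sym (negbTE ki).
have sumX2 : \sum_(x in X) S x * S x <= D%:Z * N%:Z.
  rewrite -sumS2 big_mkcond; apply: ler_sum => x _; case: ifP => // _; exact: sqr_ge0.
(* Sum over X of the squares (m S x - 2 N)^2: Cauchy-Schwarz with its optimal multiplier put in, in
   integers. *)
have cross : 4 * N%:Z * m%:Z * \sum_(x in X) S x <= m%:Z * m%:Z * \sum_(x in X) S x * S x + 4 * N%:Z * N%:Z * m%:Z.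
  have -> : 4 * N%:Z * N%:Z * m%:Z = \sum_(x in X) 4 * N%:Z * N%:Z by rewrite sumr_const -[RHS]mulr_natr -/m [m%:R]natz.
  rewrite !mulr_sumr -big_split; apply: ler_sum => x _ /=.
  rewrite -subr_ge0; move: (N%:Z) (m%:Z) (S x) => z y v.
  have -> : y * y * (v * v) + 4 * z * z - 4 * z * y * v = (y * v - 2 * z) ^+ 2 by ring.
  exact: sqr_ge0.
have N0 : 0 < N%:Z by rewrite ltz_nat expn_gt0.
have m0 : 0 < m%:Z by rewrite ltz_nat.
have h1 := ler_wpM2l (ltW (mulr_gt0 m0 m0)) sumX2.
have h2 := ler_wpM2l (ltW (mulr_gt0 N0 m0)) sumX.
rewrite -lez_nat !PoszM -/D -/m -(ler_pM2r (mulr_gt0 N0 m0)).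
exact: (second_moment_arith cross h1 h2).
Qed.
End Skew.

Section Propagation.
Variables (n d : nat).
Hypothesis n2 : (1 < n)%N.
Local Notation L := n.+2.
Local Notation V := (torus L d).
Implicit Types (x y j : V) (i k : 'I_d) (I : {set V}) (b : cube d).

Definition step (t : 'I_d * bool) : V := if t.2 then unitv n t.1 else - unitv n t.1.

Lemma emb_flip_add j b i : b i -> j + emb n b = (j + unitv n i) + emb n (flip i b).
Proof.
move=> bi; rewrite -addrA; congr (j + _).
by rewrite addrC -emb_flip ?flipK // ffunE eqxx bi.
Qed.

Lemma card_facet_shift I j i (A B : {set cube d}) : flip i @: A = B ->
  #|local I j :&: A :&: facet i true| = #|local I (j + unitv n i) :&: B :&: facet i false|.
Proof.
move=> AB; rewrite -(card_flip i); apply: eq_card => b.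
rewrite flip_imset_mem !in_setI !in_local -AB flip_imset_mem !inE ffunE eqxx.
case: (boolP (b i)) => bi; first by rewrite !andbF.
by rewrite !andbT (@emb_flip_add j (flip i b) i) ?flipK // ffunE eqxx.
Qed.

(** Neighbouring cubes share a facet, which changes sides; in the new coordinates the parity classes
    are exchanged. *)
Lemma card_facet_shift_step I j i s (A B : {set cube d}) : flip i @: A = B ->
  #|local I j :&: A :&: facet i s| = #|local I (j + step (i, s)) :&: B :&: facet i (~~ s)|.
Proof.
move=> AB; case: s; first exact: card_facet_shift.
rewrite /step /= -{1}(subrK (unitv n i) j) -(@card_facet_shift _ _ i B) //.
by rewrite -AB -imset_comp (eq_imset _ (flipK i)) imset_id.
Qed.

(** In a mixed cube each class has at least 2^d / e points, hence at most 4 e skewed directions; in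
    all others the common facet makes the neighbour mixed at level 4 e. A nearly empty facet in
    direction k gives a nearly empty face of codimension two to the neighbours in all directions but
    k. *)
Lemma bad_neighbours e I j : (0 < e)%N -> bad e (local I j) ->
  exists2 D : {set 'I_d}, (#|D| <= 8 * e)%N &
    forall i s, i \notin D -> relaxed e (local I (j + step (i, s))).
Proof.
move=> e0 /orP[mx|/existsP[k /existsP[u hu]]].
  exists (\bigcup_b skewed (local I j :&: parset d b)).
    have h (b : bool) : (#|skewed (local I j :&: parset d b)| <= 4 * e)%N.
      have := card_skewed (local I j :&: parset d b); have /forallP/(_ b) m := mx.
      set X := _ :&: _ in m * => c.
      have X0 : (0 < #|X|)%N by have := expn_gt0 2 d; case: (#|X|) m => // ; rewrite muln0; lia.
      rewrite -(leq_pmul2r X0); apply: (leq_trans c); rewrite -mulnA leq_mul2l m //.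
    have -> : (8 * e = 4 * e + 4 * e)%N by lia.
    rewrite big_bool; apply: leq_trans (leq_add (h true) (h false)).
    by have [c _] := leq_card_setU (skewed (local I j :&: parset d true)) (skewed (local I j :&: parset d false)).
  move=> i s iD; apply: relaxed_mono; apply/forallP => b.
  have : i \notin skewed (local I j :&: parset d (~~ b)).
    by apply: contra iD => iS; apply/bigcupP; exists (~~ b).
  rewrite inE negb_exists => /forallP/(_ s); rewrite -leqNgt => h.
  have /forallP/(_ (~~ b)) m := mx.
  rewrite (@card_facet_shift_step I j i s _ (parset d b)) in h; last by rewrite flip_parset negbK.
  have c : (#|local I (j + step (i, s))%R :&: parset d b :&: facet i (~~ s)| <= #|local I (j + step (i, s))%R :&: parset d b|)%N.
    by apply: subset_leq_card; exact: subsetIl.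
  apply: (leq_trans m); rewrite -mulnA (mulnCA 4) leq_mul2l; apply/orP; right.
  by apply: (leq_trans h); rewrite leq_mul2l c.
exists [set k]; first by rewrite cards1; lia.
move=> i s; rewrite inE => ik; apply/orP; right.
apply/existsP; exists k; apply/existsP; exists u; apply/existsP; exists i; apply/existsP; exists (~~ s).
rewrite eq_sym ik /= -(@card_facet_shift_step I j i s (facet k u)); last first.
  by rewrite flip_facet eq_sym (negbTE ik) addbF.
by apply: leq_ltn_trans hu; rewrite leq_mul2l subset_leq_card ?orbT // subsetIl.
Qed.

Lemma step_inj j : injective (fun t => j + step t).
Proof.
move=> [i s] [k u] /addrI; rewrite /step /= => e.
have one_neq : (1 : 'I_L) != -1.
  by apply/eqP => /(congr1 val); rewrite [RHS]val_opp /= modn_small //; lia.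
have sk : (if u then unitv n k else - unitv n k) i = (if s then 1 else -1).
  by rewrite -e; case: (s); rewrite ?oppvE unitvE eqxx.
have ki : i = k.
  apply/eqP; rewrite eq_sym; apply: contraT => ki; move: sk.
  case: (u); rewrite ?oppvE unitvE eq_sym (negbTE ki) ?oppr0; case: (s) => /eqP; rewrite eq_sym ?oppr_eq0 oner_eq0 //.
move: sk; rewrite -ki; case: (u); case: (s); rewrite ?oppvE unitvE eqxx // => /eqP q; first by rewrite (negbTE one_neq) in q.
by rewrite eq_sym (negbTE one_neq) in q.
Qed.

Definition sphere x : {set V} := [set x + step t | t : 'I_d * bool].

End Propagation.

(** * Many separated bad cubes at once *)

Section BadCount.
Variables (R : realType) (n d e : nat) (g : R).
Hypotheses (n2 : (1 < n)%N) (e0 : (0 < e)%N) (ed : (8 * e <= d)%N) (g0 : 0 <= g).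
Local Notation L := n.+2.
Local Notation V := (torus L d).
Let Z : R := #|[set I : {set V} | independent I]|%:R.
Hypothesis chess : forall J : {set V}, #|relaxed_on e J|%:R <= Z * expR (- (g * #|J|%:R)).

(* d ^ (8 e) bounds the choices of the directions in which a neighbour of a bad cube
   may fail to be relaxed. *)
Definition bad_weight : R := d%:R ^+ (8 * e) * expR (- (g * (2 * (d - 8 * e))%:R)).

(** The exceptional directions are listed by f with repetitions, which makes them d ^ (8 e)
    choices. *)
Definition sphere_avoiding (x : V) (f : {ffun 'I_(8 * e) -> 'I_d}) : {set V} :=
  [set x + step n t | t in [set t : 'I_d * bool | t.1 \notin codom f]].

Lemma card_sphere_avoiding x f : (2 * (d - 8 * e) <= #|sphere_avoiding x f|)%N.
Proof.
rewrite card_imset; last exact: step_inj.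
have -> : [set t : 'I_d * bool | t.1 \notin codom f] = setX (~: [set i in codom f]) setT.
  by apply/setP => t; rewrite !inE andbT.
rewrite cardsX cardsT card_bool mulnC leq_mul2r /=.
have := cardsC [set i in codom f]; rewrite card_ord => c.
have := leq_image_card f (mem 'I_(8 * e)); rewrite card_ord => c2.
have c3 : (#|[set i in codom f]| <= 8 * e)%N.
  by rewrite cardsE; exact: c2.
by rewrite leq_subLR -[leqLHS]c leq_add2r.
Qed.

Lemma codom_cover (D : {set 'I_d}) : (#|D| <= 8 * e)%N ->
  exists f : {ffun 'I_(8 * e) -> 'I_d}, forall i, i \in D -> i \in codom f.
Proof.
move=> hD; have d0 : (0 < d)%N by apply: leq_trans ed; rewrite muln_gt0.
exists [ffun k : 'I_(8 * e) => nth (Ordinal d0) (enum D) k] => i iD.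
have ix : (index i (enum D) < 8 * e)%N by apply: leq_trans hD; rewrite cardE index_mem mem_enum.
by apply/codomP; exists (Ordinal ix); rewrite ffunE /= nth_index // mem_enum.
Qed.

Definition bad_relaxed (s : seq V) (J : {set V}) : {set {set V}} :=
  [set I : {set V} | [&& independent I, all (fun x => bad e (local I x)) s & [forall j in J, relaxed e (local I j)]]].

(** Induction on s: a bad cube is traded for at least 2 (d - 8 e) relaxed neighbours, with a union
    bound over the exceptional directions. The spheres are disjoint from each other and from J, so
    the numbers of relaxed cubes add up. *)
Lemma card_bad_relaxed (s : seq V) (J : {set V}) : uniq s ->
  {in s &, forall x y, x != y -> [disjoint sphere x & sphere y]} ->
  {in s, forall x, [disjoint J & sphere x]} ->
  #|bad_relaxed s J|%:R <= Z * expR (- (g * #|J|%:R)) * bad_weight ^+ size s.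
Proof.
elim: s J => [|x s IH] J.
  move=> _ _ _; rewrite expr0 mulr1; apply: le_trans (chess J); rewrite ler_nat.
  by apply: subset_leq_card; apply/subsetP => I; rewrite !inE.
move=> /= /andP[xs us] sep dJ.
have sub f : sphere_avoiding x f \subset sphere x.
  by apply/subsetP => _ /imsetP[t _ ->]; exact: imset_f.
have cover : (#|bad_relaxed (x :: s) J| <= \sum_(f : {ffun 'I_(8 * e) -> 'I_d}) #|bad_relaxed s (J :|: sphere_avoiding x f)|)%N.
  apply: card_le_cover => I; rewrite inE /= => /and3P[ind /andP[bx bs] /forall_inP rJ].
  have [D cD hD] := bad_neighbours n2 e0 bx; have [f hf] := codom_cover cD.
  exists f => //; rewrite inE ind bs /=; apply/forall_inP => j /setUP[|]; first exact: rJ.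
  by case/imsetP => -[i u]; rewrite inE /= => iN ->; apply: hD; apply: contra iN; exact: hf.
apply: (@le_trans _ _ (\sum_(f : {ffun 'I_(8 * e) -> 'I_d}) #|bad_relaxed s (J :|: sphere_avoiding x f)|%:R)).
  by rewrite -natr_sum ler_nat.
have bw0 : 0 <= bad_weight by rewrite mulr_ge0 ?exprn_ge0 ?ler0n ?expR_ge0.
have step1 (f : {ffun 'I_(8 * e) -> 'I_d}) : #|bad_relaxed s (J :|: sphere_avoiding x f)|%:R <=
   Z * expR (- (g * #|J|%:R)) * bad_weight ^+ size s * expR (- (g * (2 * (d - 8 * e))%:R)).
  have dis : [disjoint J & sphere_avoiding x f].
    by rewrite disjoint_sym (disjointWl (sub f)) // disjoint_sym dJ ?mem_head.
  apply: (le_trans (IH _ us _ _)).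
  - by move=> y z ys zs; apply: sep; rewrite in_cons ?ys ?zs orbT.
  - move=> y ys; rewrite disjoint_sym disjoints_subset setCU subsetI -!disjoints_subset.
    rewrite disjoint_sym dJ ?in_cons ?ys ?orbT //= disjoint_sym (disjointWl (sub f)) //.
    by apply: sep; rewrite ?in_cons ?eqxx ?ys ?orbT //; apply: contraNneq xs => ->.
  rewrite [leRHS]mulrAC ler_wpM2r ?exprn_ge0 // -[leRHS]mulrA ler_wpM2l ?ler0n // -expRD ler_expR -opprD lerN2.
  rewrite -mulrDr ler_wpM2l // -natrD ler_nat.
  by rewrite cardsU (disjoint_setI0 dis) cards0 subn0 leq_add2l card_sphere_avoiding.
apply: (le_trans (ler_sum _ (fun f _ => step1 f))).
rewrite sumr_const card_ffun !card_ord -[_ *+ (d ^ (8 * e))%N]mulr_natl natrX /bad_weight exprS.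
rewrite le_eqVlt; apply/orP; left; apply/eqP; ring.
Qed.

Lemma card_bad_sites (X : {set V}) :
  {in X &, forall x y, x != y -> [disjoint sphere x & sphere y]} ->
  #|[set I : {set V} | independent I && [forall x in X, bad e (local I x)]]|%:R <= Z * bad_weight ^+ #|X|.
Proof.
move=> sep; have := @card_bad_relaxed (enum X) set0 (enum_uniq _) _ _.
rewrite cards0 mulr0 oppr0 expR0 mulr1 -cardE => h; apply: le_trans (h _ _).
- rewrite ler_nat; apply: subset_leq_card; apply/subsetP => I; rewrite !inE => /andP[-> /forall_inP bX] /=.
  apply/andP; split; first by apply/allP => x; rewrite mem_enum; exact: bX.
  by apply/forall_inP => x; rewrite inE.
- by move=> x y; rewrite !mem_enum; exact: sep.
- by move=> x _; rewrite disjoints_subset sub0set.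
Qed.

End BadCount.

(** * Geometry of the box *)

Section Box.
Variables n d : nat.
Local Notation L := n.+2.
Local Notation V := (torus L d).
Implicit Types (x y z : V) (i k : 'I_d) (a c : 'I_L) (U : {set V}).

(** The condition p.1 p.2 < n.+1 drops the edges that wrap around: the box, unlike the torus, has no
    closed edge form that is not a coboundary. *)
Definition boundary U : {set V * 'I_d} :=
  [set p : V * 'I_d | (p.1 p.2 < n.+1)%N && ((p.1 \in U) (+) (p.1 + unitv n p.2 \in U))].

Lemma nat_crossing (f : nat -> bool) (M a b : nat) : (a <= M)%N -> (b <= M)%N -> f a != f b ->
  exists2 c, (c < M)%N & f c (+) f c.+1.
Proof.
move=> aM bM fab; have [/existsP[c hc]|/existsPn h] := boolP [exists c : 'I_M, f c (+) f c.+1].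
  by exists c.
have cst u : (u <= M)%N -> f u = f 0%N.
  elim: u => // u IH uM; have := h (Ordinal uM); rewrite -IH 1?ltnW //=.
  by case: (f u); case: (f u.+1).
by rewrite !cst // eqxx in fab.
Qed.

Lemma val_unitv x i : (x i < n.+1)%N -> (x + unitv n i) i = (x i).+1 :> nat.
Proof.
move=> xi; rewrite addvE unitvE eqxx [LHS]val_succ ifN //; apply: contraTneq xi => ->; by rewrite ltnn.
Qed.

Lemma line_crossing U z i c : (z \in U) != (upd z i c \in U) -> exists a, (upd z i a, i) \in boundary U.
Proof.
move=> h; pose f (t : nat) := upd z i (inord t) \in U.
have fE (a : 'I_L) : f a = (upd z i a \in U) by rewrite /f inord_val.
have [|t aL fa] := @nat_crossing f n.+1 (z i) c (leq_ord _) (leq_ord _).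
  by rewrite !fE (_ : upd z i (z i) = z) //; apply/ffunP => k; rewrite updE; case: eqP => [->|].
exists (inord t); rewrite inE /= updE eqxx inordK ?aL //=; last by rewrite ltnW.
rewrite (_ : _ + _ = upd z i (inord t.+1)) //; apply/ffunP => k; rewrite addvE unitvE !updE.
case: eqP => [_|_]; last by rewrite addr0.
have tL : (t < L)%N by exact: ltnW.
apply: val_inj; rewrite [LHS]val_succ (inordK tL) [RHS]inordK // ifN //.
by apply: contraTneq aL => ->; rewrite ltnn.
Qed.

Definition hybrid (t : nat) x y : V := [ffun k : 'I_d => if (k < t)%N then y k else x k].

Lemma hybrid_step (k : 'I_d) x y : hybrid k.+1 x y = upd (hybrid k x y) k (y k).
Proof.
apply/ffunP => j; rewrite updE !ffunE; case: eqP => [->|/eqP jk]; first by rewrite ltnSn.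
by rewrite ltnS leq_eqVlt [(j == k :> nat)](negbTE jk).
Qed.

Lemma hybrid_crossing U x y : x \in U -> y \notin U ->
  exists k : 'I_d, (hybrid k x y \in U) && (upd (hybrid k x y) k (y k) \notin U).
Proof.
move=> xU yU; have [//|/existsPn h] := boolP [exists k : 'I_d, (hybrid k x y \in U) && (upd (hybrid k x y) k (y k) \notin U)].
  by move/existsP.
have al t : (t <= d)%N -> hybrid t x y \in U.
  elim: t => [_|t IH td].
    by rewrite (_ : hybrid 0 x y = x) //; apply/ffunP => k; rewrite ffunE.
  have := h (Ordinal td); rewrite -hybrid_step /= IH 1?ltnW //= negbK //.
move: (al d (leqnn d)); rewrite (_ : hybrid d x y = y) ?(negbTE yU) //.
by apply/ffunP => k; rewrite ffunE ltn_ord.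
Qed.

Lemma boundary_setC U : boundary (~: U) = boundary U.
Proof. by apply/setP => p; rewrite !inE addbN addNb negbK. Qed.

Lemma boundary0 U : boundary U = set0 -> U = set0 \/ U = setT.
Proof.
move=> b0; have [->|[x xU]] := set_0Vmem U; first by left.
right; apply/setP => y; rewrite inE; apply/negPn/negP => yU.
have [k /andP[h1 h2]] := hybrid_crossing xU yU.
have [|a] := @line_crossing U (hybrid k x y) k (y k); first by rewrite h1 (negbTE h2).
by rewrite b0 inE.
Qed.

(* Exchanging initial segments of the coordinates of x and y is a bijection of pairs,
   and turns a pair separated by U into one separated along a single line. *)
Lemma card_boundary_product U : (#|U| * #|~: U| <= L * #|{: V}| * #|boundary U|)%N.
Proof.
pose A (k : 'I_d) := [set p : V * V | (p.1 \in U) && (upd p.1 k (p.2 k) \notin U)].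
pose bdk k := [set x | (x, k) \in boundary U].
have cA k : (#|A k| <= L * #|{: V}| * #|bdk k|)%N.
  have ex (p : V * V) : p \in A k -> exists a, (upd p.1 k a, k) \in boundary U.
    by rewrite inE => /andP[h1 h2]; apply: (@line_crossing U p.1 k (p.2 k)); rewrite h1 (negbTE h2).
  pose f (p : V * V) : ('I_L * V) * V :=
    ((p.1 k, p.2), odflt p.1 (omap (upd p.1 k) [pick a | (upd p.1 k a, k) \in boundary U])).
  have fK p : p \in A k -> f p \in setX setT (bdk k) /\ upd (f p).2 k (f p).1.1 = p.1.
    move/ex => [a ha]; rewrite /f; case: pickP => [b hb|/(_ a)]; last by rewrite ha.
    split; first by rewrite in_setX in_setT in_set.
    apply/ffunP => j; rewrite !updE; by case: eqP => [->|].
  have -> : (L * #|{: V}| * #|bdk k| = #|setX [set: 'I_L * V] (bdk k)|)%N.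
    by rewrite cardsX cardsT card_prod card_ord.
  rewrite -(@card_in_imset _ _ f (mem (A k))).
    by apply: subset_leq_card; apply/subsetP => _ /imsetP[p pA ->]; case: (fK _ pA).
  move=> p q pA qA fpq; rewrite (surjective_pairing q) (surjective_pairing p); congr pair.
    by have [_ <-] := fK _ pA; have [_ <-] := fK _ qA; rewrite fpq.
  by have := congr1 (fun u => u.1.2) fpq.
have -> : (#|boundary U| = \sum_k #|bdk k|)%N.
  rewrite -sum1_card (eq_bigr (fun p => 1%N)) // (partition_big (fun p : V * 'I_d => p.2) predT) //=.
  apply: eq_bigr => k _; rewrite sum1_card -(@card_imset _ _ (fun x => (x, k))); last by move=> x y [].
  apply: eq_card => -[x j]; transitivity (((x, j) \in boundary U) && (j == k)) => //; apply/andP/imsetP => [[h /eqP jk]|[y]].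
    by rewrite jk in h *; exists x => //; rewrite in_set.
  by rewrite in_set => h [-> ->].
rewrite -cardsX big_distrr /=; apply: leq_trans (leq_sum _ (fun k _ => cA k)).
pose sw (k : 'I_d) (p : V * V) := (hybrid k p.1 p.2, hybrid k p.2 p.1).
have swK k : involutive (sw k).
  by move=> [x y]; congr pair; apply/ffunP => j; rewrite !ffunE; case: ltnP.
rewrite (eq_bigr (fun k => #|sw k @: A k|)); last by move=> k _; rewrite card_imset //; exact: inv_inj.
apply: card_le_cover => -[x y]; rewrite !inE /= => /andP[xU yU].
have [k h] := hybrid_crossing xU yU; exists k => //.
by rewrite -(swK k (x, y)) imset_f // inE /= [hybrid k y x k]ffunE ltnn.
Qed.

(* With fewer than L boundary edges, some hyperplane in each direction meets none
   inside and U is constant on it; two directions force the same constant. *)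
Lemma box_isoperimetry_pure U i0 i1 : i0 != i1 -> (#|boundary U| < L)%N ->
  exists2 U', U' = U \/ U' = ~: U & (#|U'| <= #|boundary U| * #|boundary U|)%N.
Proof.
move=> i01 mL; pose m := #|boundary U|.
pose impure i := [set p.1 i | p : V * 'I_d in [set p in boundary U | p.2 != i]].
have c_imp i : (#|impure i| <= m)%N.
  apply: leq_trans (leq_imset_card _ _) _; apply: subset_leq_card; apply/subsetP => p; by rewrite inE => /andP[].
have pureP i c x y : c \notin impure i -> x i = c -> y i = c -> (x \in U) = (y \in U).
  suff imp (u v : V) : c \notin impure i -> u i = c -> v i = c -> u \in U -> v \in U.
    by move=> hc xc yc; apply/idP/idP; exact: imp.
  move=> hc uc vc uU; apply/negPn/negP => vU; have [k /andP[h1 h2]] := hybrid_crossing uU vU.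
  have ki : k != i.
    apply: contraTneq h1 => ki; rewrite (_ : hybrid k u v = upd (hybrid k u v) k (v k)) //.
    by apply/ffunP => j; rewrite updE; case: eqP => // ->; rewrite ffunE ltnn ki uc vc.
  have [|a ha] := @line_crossing U (hybrid k u v) k (v k); first by rewrite h1 (negbTE h2).
  move/negP: hc; apply; apply/imsetP; exists (upd (hybrid k u v) k a, k); first by rewrite inE ha.
  by rewrite /= updE eq_sym (negbTE ki) ffunE uc vc if_same.
have ex i : exists c, c \notin impure i.
  apply/existsP; rewrite -negb_forall; apply/negP => /forallP h.
  have : (#|'I_L| <= #|impure i|)%N by apply: subset_leq_card; apply/subsetP => c _; exact: h.
  by rewrite card_ord => /leq_trans/(_ (c_imp i)); rewrite leqNgt mL.
have [c0 h0] := ex i0; have [c1 h1] := ex i1.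
pose w : V := [ffun=> c1].
pose U' := [set x | (x \in U) != (w \in U)].
have pure0 x : x i0 \notin impure i0 -> (x \in U) = (w \in U).
  move=> hx; rewrite (pureP i0 (x i0) x (upd w i0 (x i0))) ?updE ?eqxx //.
  by apply: (pureP i1 c1) => //; rewrite ?updE ?ffunE // eq_sym (negbTE i01).
exists U'.
  case: (boolP (w \in U)) => wU; [right|left]; apply/setP => x; rewrite !inE ?wU ?(negbTE wU).
    by case: (x \in U).
  by case: (x \in U).
have ln x : x \in U' -> exists a, (upd x i0 a, i0) \in boundary U.
  rewrite inE => hx; apply: (@line_crossing U x i0 c0).
  by rewrite [X in _ != X](pure0 (upd x i0 c0)) // updE eqxx.
pose f x : 'I_L * V := (x i0, odflt x (omap (upd x i0) [pick a | (upd x i0 a, i0) \in boundary U])).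
have fK x : x \in U' -> (f x \in setX (impure i0) [set p.1 | p in boundary U]) /\ upd (f x).2 i0 (f x).1 = x.
  move=> xU; have [a ha] := ln _ xU; rewrite /f; case: pickP => [b hb|/(_ a)]; last by rewrite ha.
  split; last by apply/ffunP => j; rewrite !updE; case: eqP => [->|].
  rewrite inE /= (imset_f (fun p : V * 'I_d => p.1) hb) andbT; apply: contraLR xU => h.
  by rewrite inE pure0 // eqxx.
have inj : {in U' &, injective f} by move=> x y /fK[_ ex'] /fK[_ ey] exy; rewrite -ex' -ey exy.
rewrite -(card_in_imset inj); apply: (@leq_trans #|setX (impure i0) [set p.1 | p in boundary U]|).
  by apply: subset_leq_card; apply/subsetP => _ /imsetP[x /fK[h _] ->].
by rewrite cardsX leq_mul // leq_imset_card.
Qed.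

(** The minimum serves both volume bounds needed later: linear in the boundary with a factor L, and
    quadratic in the boundary. *)
Lemma box_isoperimetry U i0 i1 : i0 != i1 ->
  exists2 U', U' = U \/ U' = ~: U & (#|U'| <= 2 * #|boundary U| * minn L #|boundary U|)%N.
Proof.
move=> i01; case: (ltnP #|boundary U| L) => [mL|Lm].
  have [U' e h] := box_isoperimetry_pure i01 mL; exists U' => //; apply: leq_trans h _.
  by rewrite -mulnA leq_pmull.
exists (if (#|U| <= #|~: U|)%N then U else ~: U); first by case: ifP; [left|right].
set U' := if _ then _ else _.
have h := card_boundary_product U; have cs := cardsC U.
have V0 : (0 < #|{: V}|)%N by apply/card_gt0P; exists 0.
have U2 : (#|{: V}| * #|U'| <= 2 * (#|U| * #|~: U|))%N.
  rewrite -cs /U' mul2n -addnn mulnDl; case: (leqP #|U| #|~: U|) => uv.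
    by rewrite [(#|~: U| * _)%N]mulnC leq_add2r leq_mul2l uv orbT.
  by rewrite leq_add2l leq_mul2r (ltnW uv) orbT.
move: h U2 V0; move: #|boundary U| (#|U| * #|~: U|)%N #|U'| #|{: V}| => m u u' v h U2 V0.
rewrite -(leq_pmul2l V0); apply: leq_trans U2 _; apply: (@leq_trans (2 * (L * v * m))); first by rewrite leq_mul2l h.
by move: n.+2 => l; rewrite leq_eqVlt; apply/orP; left; apply/eqP; ring.
Qed.

(* A mod-2 edge form which vanishes on all unit squares is a coboundary; the
   potential integrates it along the path that raises the coordinates from 0
   one after the other, in increasing order. *)
Section Exactness.
Variable form : V -> 'I_d -> bool.

Definition last_nonzero x i : bool := (x i != 0) && [forall k : 'I_d, (i < k)%N ==> (x k == 0)].

Fixpoint potential (N : nat) x : bool :=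
  if N is N'.+1 then
    if [pick i | last_nonzero x i] is Some i then
      potential N' (x - unitv n i) (+) form (x - unitv n i) i
    else false
  else false.

Definition coord_sum x : nat := (\sum_i x i)%N.

Lemma last_nonzero_inj x i k : last_nonzero x i -> last_nonzero x k -> i = k.
Proof.
move=> /andP[xi /forallP hi] /andP[xk /forallP hk]; apply: val_inj => /=.
have := hi k; have := hk i; rewrite (negbTE xi) (negbTE xk) !implybF -!leqNgt => h1 h2.
by apply/eqP; rewrite eqn_leq h1 h2.
Qed.

Lemma coord_sum_unitv x i : (x i < n.+1)%N -> coord_sum (x + unitv n i) = (coord_sum x).+1.
Proof.
move=> xi; rewrite /coord_sum (bigD1 i) // [in RHS](bigD1 i) //= val_unitv // addSn; congr (_ + _).+1.
by apply: eq_bigr => k ki; rewrite addvE unitvE (negbTE ki) addr0.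
Qed.

Lemma val_pred a : a != 0 -> (val (a - 1)).+1 = a.
Proof.
move=> a0; have := @val_succ n (a - 1); rewrite subrK; case: eqP => [_ e|_ -> //].
by move: a0; rewrite -(inj_eq val_inj) e.
Qed.

Lemma sub_unitv_lt x i : x i != 0 -> ((x - unitv n i)%R i < n.+1)%N.
Proof.
move=> xi; rewrite addvE oppvE unitvE eqxx; have := val_pred xi; have := ltn_ord (x i).
by move=> h /= e; rewrite -ltnS e.
Qed.

Definition coboundary_of (U : {set V}) : Prop :=
  forall x i, (x i < n.+1)%N -> form x i = (x \in U) (+) (x + unitv n i \in U).

Lemma exactness :
  (forall x i k, i != k -> (x i < n.+1)%N -> (x k < n.+1)%N ->
     form x i (+) form (x + unitv n i) k (+) form (x + unitv n k) i (+) form x k = false) ->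
  exists U, coboundary_of U.
Proof.
move=> closed; pose u x := potential (coord_sum x) x.
have uE x i : last_nonzero x i -> u x = u (x - unitv n i) (+) form (x - unitv n i) i.
  move=> xi; have /andP[x0 _] := xi; rewrite /u.
  have -> : coord_sum x = (coord_sum (x - unitv n i)).+1 by rewrite -{1}(subrK (unitv n i) x) coord_sum_unitv ?sub_unitv_lt.
  rewrite /=; case: pickP => [k xk|/(_ i)]; last by rewrite xi.
  by rewrite (last_nonzero_inj xk xi).
have main N : forall x k, coord_sum x = N -> (x k < n.+1)%N -> u (x + unitv n k) = u x (+) form x k.
  elim: N => [|N IH] x k hx xk.
    have x0 i : x i = 0 by apply: val_inj; move/eqP: hx; rewrite sum_nat_eq0 => /forallP/(_ i)/eqP.
    rewrite (uE _ k) ?addrK //; apply/andP; split.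
      by rewrite addvE unitvE eqxx x0 add0r oner_eq0.
    apply/forallP => j; apply/implyP => kj; rewrite addvE unitvE x0 add0r ifN //.
    by apply: contraTneq kj => ->; rewrite ltnn.
  set y := x + unitv n k.
  have yk : y k != 0 by have := val_unitv xk; rewrite -/y; case: eqP => // ->.
  have [i yi] : exists i, last_nonzero y i.
    exists [arg max_(i > k | y i != 0) (i : nat)]; case: arg_maxnP => // i yi0 mx.
    apply/andP; split=> //; apply/forallP => j; apply/implyP => ij; apply/negPn/negP => yj.
    by have := mx j yj; rewrite /geq /= leqNgt ij.
  (* If k is the last nonzero coordinate of y, the path to y passes through x. Otherwise the path to
     y ends with a step in direction i > k, and the square at z = x - unitv n i compares it with the
     path to x. *)
  case: (eqVneq i k) yi => [->|ik] yi; first by rewrite (uE _ _ yi) /y addrK.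
  have xyi : x i = y i by rewrite /y addvE unitvE (negbTE ik) addr0.
  have ki : (k < i)%N.
    rewrite ltn_neqAle eq_sym ik leqNgt; apply/negP => ki; have /andP[_ /forallP/(_ k)] := yi.
    by rewrite ki (negbTE yk).
  have xi : last_nonzero x i.
    have /andP[yi0 /forallP hy] := yi; rewrite /last_nonzero xyi yi0; apply/forallP => j; apply/implyP => ij.
    have := hy j; rewrite ij /y addvE unitvE ifN ?addr0 //; apply: contraTneq ij => ->; by rewrite -leqNgt ltnW.
  have /andP[xi0 _] := xi.
  rewrite (uE _ _ yi) (uE _ _ xi); set z := x - unitv n i.
  have -> : y - unitv n i = z + unitv n k by rewrite /y /z addrAC.
  have xz : x = z + unitv n i by rewrite /z subrK.
  have zi : (z i < n.+1)%N by exact: sub_unitv_lt.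
  have zk : z k = x k by rewrite /z addvE oppvE unitvE eq_sym (negbTE ik) subr0.
  rewrite IH ?zk //; last by apply/eqP; rewrite -eqSS -hx xz coord_sum_unitv.
  have := closed z i k ik zi; rewrite zk -xz => /(_ xk).
  by move: (u z) (form z k) (form (z + unitv n k) i) (form z i) (form x k) => [] [] [] [] [].
exists [set x | u x] => x i xi; rewrite !in_set (main (coord_sum x)) //.
by rewrite addbA addbb.
Qed.

End Exactness.

End Box.

(** * Cluster expansion *)

Section Clusters.
Variables (T : finType) (r : rel T).
Hypothesis r_sym : symmetric r.
Implicit Types (x y z : T) (C D S : {set T}).

(** Connectedness in the form of cuts, the form in which a walk is extended to a new point. *)
Definition cluster C : bool :=
  (C != set0) && [forall D : {set T}, (D \proper C) && (D != set0) ==>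
     [exists x in D, exists y in C :\: D, r x y]].

(* Walking around a spanning tree. *)
Lemma cluster_walk C x : cluster C -> x \in C ->
  exists p, [/\ path r x p, size p = (2 * #|C|.-1)%N & [set y in x :: p] = C].
Proof.
move=> /andP[_ /forallP cut] xC.
have grow k : (k < #|C|)%N -> exists p, [/\ path r x p, size p = (2 * k)%N,
    [set y in x :: p] \subset C & #|[set y in x :: p]| = k.+1].
  elim: k => [_|k IH kC].
    exists [::]; rewrite set_seq1 cards1 sub1set; split => //.
  have [p [pp sp pC cp]] := IH (ltnW kC).
  set D := [set y in x :: p] in pC cp.
  have : D \proper C by rewrite properEcard pC cp.
  move=> DC; have := cut D; rewrite DC /= -card_gt0 cp /= => /existsP[y /andP[yD /existsP[z /andP[zCD ryz]]]].
  move: zCD; rewrite inE => /andP[zD zC].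
  have yp : y \in x :: p by rewrite inE in yD.
  have ce : forall p1 p2, [set w in x :: p1 ++ [:: z, last x p1 & p2]] = z |: [set w in x :: p1 ++ p2].
    move=> p1 p2; apply/setP => w; rewrite in_setU1 !in_set -!cat_cons !mem_cat !inE.
    have := mem_last x p1; rewrite inE.
    case: (eqVneq w z) => [->|wz]; first by rewrite !orbT.
    case: (eqVneq w (last x p1)) => [->|_] //=.
    by rewrite orbT => ->.
  have [p1 [p2 [ep ly]]] : exists p1 p2, p = p1 ++ p2 /\ last x p1 = y.
    by case/splitPl: yp => p1 p2 ly; exists p1, p2.
  move: pp sp zD pC cp; rewrite /D ep => pp sp zD pC cp.
  exists (p1 ++ [:: z, last x p1 & p2]); rewrite ce; split.
  - move: pp; rewrite !cat_path /= ly ryz /=; by rewrite [r z y]r_sym ryz; case/andP => -> ->.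
  - move: sp; rewrite !size_cat /=; lia.
  - by rewrite subUset sub1set zC pC.
  - by rewrite cardsU1 zD cp.
have C0 : (0 < #|C|)%N by apply/card_gt0P; exists x.
have [|p [pp sp pC cp]] := grow #|C|.-1; first by rewrite ltn_predL.
by exists p; split=> //; apply/eqP; rewrite eqEcard pC cp prednK ?leqnn.
Qed.

Variable D : nat.
Hypothesis r_deg : forall x, (#|[set y | r x y]| <= D)%N.

Fixpoint walks (m : nat) x : seq (seq T) :=
  if m is m'.+1 then flatten [seq [seq y :: p | p <- walks m' y] | y <- enum [set y | r x y]] else [:: [::]].

Lemma size_walks m x : (size (walks m x) <= D ^ m)%N.
Proof.
elim: m x => //= m IH x; rewrite size_flatten /shape -map_comp sumnE big_map expnS.
apply: (@leq_trans (\sum_(y <- enum [set y | r x y]) D ^ m)).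
  by apply: leq_sum => y _; rewrite /= size_map.
by rewrite big_const_seq count_predT iter_addn_0 mulnC -cardE leq_mul2r r_deg orbT.
Qed.

Lemma mem_walks x p : path r x p -> p \in walks (size p) x.
Proof.
elim: p x => //= y p IH x /andP[xy yp]; apply/flattenP; exists [seq y :: p | p <- walks (size p) y].
  by apply/mapP; exists y; rewrite // mem_enum inE.
by apply/mapP; exists p; rewrite // IH.
Qed.

Lemma card_clusters k : (#|[set C : {set T} | cluster C && (#|C| == k.+1)]| <= #|T| * D ^ (2 * k))%N.
Proof.
pose s := flatten [seq [seq [set y in x :: p] | p <- walks (2 * k) x] | x <- enum T].
apply: (@leq_trans (size s)).
  apply: leq_trans (card_size s); apply: subset_leq_card; apply/subsetP => C; rewrite inE => /andP[cC /eqP kC].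
  have [x xC] : exists x, x \in C by apply/set0Pn; case/andP: cC.
  have [p [pp sp <-]] := cluster_walk cC xC.
  apply/flattenP; exists [seq [set y in x :: p] | p <- walks (2 * k) x].
    by apply/mapP; exists x; rewrite // mem_enum.
  by apply/mapP; exists p => //; have := mem_walks pp; rewrite sp kC.
rewrite size_flatten /shape -map_comp sumnE big_map.
apply: (@leq_trans (\sum_(x <- enum T) D ^ (2 * k))).
  by apply: leq_sum => y _; rewrite /= size_map size_walks.
by rewrite big_const_seq count_predT iter_addn_0 -cardE mulnC.
Qed.

Definition linked S : rel T := [rel x y | [&& x \in S, y \in S & r x y]].
Definition components S : {set {set T}} := equivalence_partition (connect (linked S)) S.

Lemma linked_sym S : connect_sym (linked S).
Proof. by apply: sym_connect_sym => x y; rewrite /linked /= r_sym andbCA. Qed.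

Lemma linked_equiv S : {in S & &, equivalence_rel (connect (linked S))}.
Proof.
by move=> x y z _ _ _; split=> [|xy]; [exact: connect0|rewrite (same_connect (linked_sym S) xy)].
Qed.

Lemma components_partition S : partition (components S) S.
Proof. exact: equivalence_partitionP (linked_equiv (S := S)). Qed.

Lemma component_closed S C x y : C \in components S -> x \in C -> y \in S -> r x y -> y \in C.
Proof.
move=> CS xC yS xy; have /and3P[/eqP cov triv _] := components_partition S.
have xS : x \in S by rewrite -cov; apply/bigcupP; exists C.
rewrite -(def_pblock triv CS xC) (pblock_equivalence_partition (@linked_equiv S)) //.
by apply: connect1; rewrite /linked /= xS yS.
Qed.

Lemma component_cluster S C : C \in components S -> cluster C.
Proof.
move=> CS; have /and3P[/eqP cov triv n0] := components_partition S.
apply/andP; split; first by apply: contraNneq n0 => <-.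
apply/forallP => E; apply/implyP => /andP[EC /set0Pn[x xE]].
have [sub [y yC yE]] := properP EC.
apply: contraT; rewrite negb_exists => /forallP cut.
have subS z : z \in C -> z \in S by move=> zC; rewrite -cov; apply/bigcupP; exists C.
have imp u v : r u v -> v \in S -> u \in E -> v \in E.
  move=> uv vS uE; apply: contraT => vE; have := cut u; rewrite uE negb_exists => /forallP/(_ v).
  by rewrite !inE uv vE (component_closed CS (subsetP sub _ uE) vS uv).
have cl : closed (linked S) E.
  by move=> u v /and3P[uS vS uv]; apply/idP/idP; apply: imp => //; rewrite r_sym.
have : connect (linked S) x y.
  rewrite -(pblock_equivalence_partition (@linked_equiv S) (subS _ (subsetP sub _ xE)) (subS _ yC)).
  by rewrite (def_pblock triv CS (subsetP sub _ xE)).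
by move/(closed_connect cl); rewrite xE (negbTE yE).
Qed.

End Clusters.

Section ClusterExpansion.
Variables (R : realType) (T X : finType) (r : rel T) (D : nat) (Om : {set X}) (S : X -> {set T}).
Hypothesis r_sym : symmetric r.
Hypothesis r_deg : forall x, (#|[set y | r x y]| <= D)%N.
Variables (Z q : R) (h : nat -> R).
Hypotheses (Z0 : 0 <= Z) (q0 : 0 <= q) (h0 : forall k, 0 <= h k).
Hypothesis dilute : forall Y : {set T}, #|[set I in Om | Y \subset S I]|%:R <= Z * q ^+ #|Y|.

Let clusters : {set {set T}} := [set C | cluster r C].

(** Expand each product over subfamilies E of the components and sum over I first. The members of E
    are disjoint clusters with union inside S I, so diluteness bounds their number of occurrences by
    Z times the product of the q ^ #|C|. Dropping disjointness turns the sum over E back into a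
    product, at most the exponential. *)
Lemma cluster_expansion :
  \sum_(I in Om) \prod_(C in components r (S I)) (1 + h #|C|) <=
  Z * expR (\sum_(C in clusters) h #|C| * q ^+ #|C|).
Proof.
have step1 I : \prod_(C in components r (S I)) (1 + h #|C|) =
    \sum_(E : {set {set T}} | E \subset components r (S I)) \prod_(C in E) h #|C|.
  by rewrite -sum_subset_prod.
under eq_bigr => I _ do rewrite step1 big_mkcond /=.
rewrite exchange_big /=.
apply: (@le_trans _ _ (\sum_(E : {set {set T}} | E \subset clusters) Z * \prod_(C in E) (h #|C| * q ^+ #|C|))).
  rewrite [leRHS]big_mkcond /=; apply: ler_sum => E _.
  have [/existsP[I0 /andP[I0O EI0]]|/existsPn no] := boolP [exists I, (I \in Om) && (E \subset components r (S I))]; last first.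
    rewrite big1 => [|I IO]; last by have := no I; rewrite IO /= => /negbTE->.
    case: ifP => // _; apply: mulr_ge0 => //; apply: prodr_ge0 => C _.
    by rewrite mulr_ge0 ?exprn_ge0.
  have /and3P[/eqP cov0 triv0 _] := components_partition r_sym (S I0).
  have triv : trivIset E by apply: trivIsetS triv0.
  have -> : E \subset clusters.
    by apply: subset_trans EI0 _; apply/subsetP => C; rewrite inE; exact: component_cluster.
  rewrite -big_mkcondr big_split /= -expr_sum mulrCA sumr_const -mulr_natl mulrC.
  apply: ler_wpM2l; first exact: prodr_ge0.
  have := eqP triv; rewrite /trivIset => ->.
  apply: le_trans (dilute (cover E)); rewrite ler_nat; apply: subset_leq_card.
  apply/subsetP => I; rewrite !inE => /andP[-> EI] /=.
  have /and3P[/eqP cov _ _] := components_partition r_sym (S I).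
  apply: (@subset_trans _ _ (mem (cover (components r (S I))))); last by rewrite cov.
  by apply/bigcupsP => C CE; apply: bigcup_sup; exact: (subsetP EI).
rewrite -mulr_sumr ler_wpM2l // sum_subset_prod expR_sum; apply: ler_prod => C _.
by rewrite addr_ge0 ?mulr_ge0 ?exprn_ge0 //= expR_ge1Dx.
Qed.

Lemma sum_clusters_le : \sum_(C in clusters) h #|C| * q ^+ #|C| <=
  #|T|%:R * \sum_(k < #|T|) D%:R ^+ (2 * k) * (h k.+1 * q ^+ k.+1).
Proof.
pose w (C : {set T}) := h #|C| * q ^+ #|C|.
have w0 C : 0 <= w C by rewrite mulr_ge0 ?exprn_ge0.
apply: (@le_trans _ _ (\sum_(k < #|T|) \sum_(C in clusters | #|C| == k.+1) w C)).
  under [leRHS]eq_bigr => k _ do rewrite big_mkcondr /=.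
  rewrite exchange_big /=; apply: ler_sum => C; rewrite inE => /andP[C0 _].
  have Ck : (#|C|.-1 < #|T|)%N by rewrite prednK ?card_gt0 ?max_card.
  rewrite (bigD1 (Ordinal Ck)) //= prednK ?card_gt0 // eqxx lerDl.
  by apply: sumr_ge0 => k _; case: ifP.
rewrite mulr_sumr; apply: ler_sum => k _.
rewrite (eq_bigr (fun=> h k.+1 * q ^+ k.+1)); last by move=> C /andP[_ /eqP]; rewrite /w => ->.
rewrite sumr_const -[_ *+ _]mulr_natl [leRHS]mulrA ler_wpM2r ?mulr_ge0 ?exprn_ge0 //.
rewrite -natrX -natrM ler_nat; apply: leq_trans (card_clusters r_sym r_deg k).
by apply: subset_leq_card; apply/subsetP => C /andP[]; rewrite !inE => -> ->.
Qed.

End ClusterExpansion.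

(** Since (k+1)^2 <= 4^k, the terms are at most u 2^(-k). *)
Lemma sum_squares_geometric (R : realType) (N : nat) (u : R) : 0 <= u -> u <= 8^-1 ->
  \sum_(k < N) k.+1%:R ^+ 2 * u ^+ k.+1 <= 2 * u.
Proof.
move=> u0 u8; apply: (@le_trans _ _ (\sum_(k < N) u * (2^-1) ^+ k)).
  apply: ler_sum => k _; rewrite [u ^+ _]exprS mulrCA ler_wpM2l //.
  have sq (j : nat) : j.+1%:R ^+ 2 <= (4 : R) ^+ j.
    rewrite -!natrX ler_nat; elim: j => // j IH; rewrite [(4 ^ _)%N]expnS; apply: (@leq_trans (4 * j.+1 ^ 2)); last by rewrite leq_mul2l IH.
    by rewrite -!mulnn; nia.
  apply: (@le_trans _ _ (4 ^+ k * (8^-1) ^+ k)).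
    by apply: ler_pM; rewrite ?exprn_ge0 ?sq // ; apply: lerXn2r; rewrite ?nnegrE // invr_ge0.
  rewrite -exprMn; apply: lerXn2r; rewrite ?nnegrE; lra.
rewrite -mulr_sumr mulrC ler_wpM2r //.
have g := @subrX1 R 2^-1 N.
have p : 0 <= 2^-1 ^+ N :> R by rewrite exprn_ge0 // invr_ge0.
move: g p; move: (\sum_(k < N) _) (2^-1 ^+ N) => s z; lra.
Qed.

Section ClusterTail.
Variables (R : realType) (T X : finType) (r : rel T) (D : nat) (Om : {set X}) (S : X -> {set T}).
Hypothesis r_sym : symmetric r.
Hypothesis r_deg : forall x, (#|[set y | r x y]| <= D)%N.
Variables (Z q a b : R) (F : nat -> R).
Hypotheses (Z0 : 0 <= Z) (q0 : 0 <= q) (a0 : 0 < a) (b0 : 0 <= b).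
Hypotheses (F0 : forall k, 0 <= F k) (Fa : forall k, F k <= a * k%:R) (Fb : forall k, F k <= b * k%:R ^+ 2).
Hypothesis dilute : forall Y : {set T}, #|[set I in Om | Y \subset S I]|%:R <= Z * q ^+ #|Y|.
Let y : R := expR 1 * D%:R ^+ 2 * q.
Hypotheses (D0 : (0 < D)%N) (y8 : y <= 8^-1).

(** Exponential Markov at rate 1 / a. The linear bound on F caps the tilt of a cluster of k points
    by e^k, which joins D^2 q in y; the quadratic bound supplies the small prefactor b / a. *)
Lemma cluster_tail (A : R) :
  #|[set I in Om | A <= \sum_(C in components r (S I)) F #|C|]|%:R <=
  Z * expR (#|T|%:R * (b / a) * (2 * y) - A / a).
Proof.
pose h k := expR (F k / a) - 1.
have ia : 0 < a^-1 by rewrite invr_gt0.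
have h0 k : 0 <= h k by rewrite subr_ge0 -expR0 ler_expR divr_ge0 // ltW.
have hle k : h k <= b / a * k%:R ^+ 2 * expR 1 ^+ k.
  apply: (@le_trans _ _ (F k / a * expR (F k / a))).
    have := expR_ge1Dx (- (F k / a)); rewrite expRN /h.
    move: (F k / a) => f; have := expR_gt0 f; move: (expR f) => E E0 fE.
    have : (1 - f) * E <= E^-1 * E by rewrite ler_pM2r.
    by rewrite mulVf ?lt0r_neq0 // mulrBl mul1r; lra.
  rewrite -expRM_natl mulr1; apply: ler_pM.
  - by apply: divr_ge0 => //; exact: ltW.
  - exact: expR_ge0.
  - by rewrite mulrAC ler_pM2r.
  - by rewrite ler_expR ler_pdivrMr // mulrC.
have tilt : expR (A / a) * #|[set I in Om | A <= \sum_(C in components r (S I)) F #|C|]|%:R <=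
    \sum_(I in Om) \prod_(C in components r (S I)) (1 + h #|C|).
  rewrite mulrC mulr_natl -sumr_const; rewrite [leLHS]big_mkcond [leRHS]big_mkcond /=.
  apply: ler_sum => I _; rewrite inE; case: (I \in Om) => //=.
  have -> : \prod_(C in components r (S I)) (1 + h #|C|) = expR (\sum_(C in components r (S I)) F #|C| / a).
    by rewrite expR_sum; apply: eq_bigr => C _; rewrite addrC subrK.
  case: ifP => [AI|_]; last exact: expR_ge0.
  by rewrite ler_expR -mulr_suml ler_pM2r.
have ce := cluster_expansion r_sym Z0 q0 h0 dilute.
have sc := @sum_clusters_le R T r D r_sym r_deg q h q0 h0.
have y0 : 0 <= y by rewrite !mulr_ge0 ?exprn_ge0 ?expR_ge0.
have sb : \sum_(k < #|T|) D%:R ^+ (2 * k) * (h k.+1 * q ^+ k.+1) <= b / a * (2 * y).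
  apply: (@le_trans _ _ (\sum_(k < #|T|) b / a * (k.+1%:R ^+ 2 * y ^+ k.+1))); last first.
    rewrite -mulr_sumr; apply: ler_wpM2l; first by apply: divr_ge0 => //; exact: ltW.
    exact: sum_squares_geometric.
  apply: ler_sum => k _.
  have D1 : 1 <= D%:R ^+ 2 :> R by rewrite -natrX ler1n expn_gt0 D0.
  apply: (@le_trans _ _ (D%:R ^+ (2 * k.+1) * (b / a * k.+1%:R ^+ 2 * expR 1 ^+ k.+1 * q ^+ k.+1))).
    apply: ler_pM.
    - by rewrite exprn_ge0.
    - by apply: mulr_ge0; rewrite ?exprn_ge0.
    - by apply: ler_weXn2l; [rewrite ler1n|rewrite leq_mul2l leqnSn].
    - by apply: ler_wpM2r; rewrite ?exprn_ge0.
  rewrite /y exprM; move: (D%:R ^+ 2) => u; rewrite !exprMn le_eqVlt; apply/orP; left; apply/eqP; ring.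
have -> : #|T|%:R * (b / a) * (2 * y) - A / a = - (A / a) + #|T|%:R * (b / a * (2 * y)) by ring.
rewrite expRD mulrCA -ler_pdivrMl ?expR_gt0 // -expRN opprK; apply: (le_trans tilt); apply: (le_trans ce).
rewrite ler_wpM2l // ler_expR; apply: (le_trans sc); exact: ler_wpM2l.
Qed.

End ClusterTail.

(** * Contours *)

Section Balls.
Variables n d : nat.
Local Notation L := n.+2.
Local Notation V := (torus L d).
Implicit Types (x y z : V) (j k : nat) (B C S U : {set V}).

Definition moves : {set V} := [set (0 : V)] :|: ([set step n t | t : 'I_d * bool] : {set V}).
Fixpoint ball (k : nat) : {set V} :=
  if k is k'.+1 then [set p.1 + p.2 | p : V * V in setX (ball k') moves] else [set (0 : V)].
Definition near k : rel V := fun x y => y - x \in ball k.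

Lemma card_moves : (#|moves| <= (2 * d).+1)%N.
Proof.
have [c _] := leq_card_setU [set (0 : V)] ([set step n t | t : 'I_d * bool] : {set V}).
apply: leq_trans c _; rewrite cards1 add1n ltnS.
by apply: leq_trans (leq_imset_card _ _) _; rewrite card_prod card_ord card_bool mulnC.
Qed.

Lemma card_ball k : (#|ball k| <= (2 * d).+1 ^ k)%N.
Proof.
elim: k => [|k IH]; first by rewrite /= cards1.
rewrite /= expnS mulnC; apply: leq_trans (leq_imset_card _ _) _.
by rewrite cardsX leq_mul // card_moves.
Qed.

Lemma moves_opp x : x \in moves -> - x \in moves.
Proof.
case/setU1P => [->|/imsetP[[i s] _ ->]]; first by rewrite oppr0 setU11.
apply/setU1P; right; apply/imsetP; exists (i, ~~ s) => //.
by rewrite /step; case: (s); rewrite ?opprK.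
Qed.

Lemma ball_addS k x y : x \in ball k -> y \in moves -> x + y \in ball k.+1.
Proof. by move=> xk ym; apply/imsetP; exists (x, y); rewrite // in_setX xk. Qed.

Lemma ball_add j k x y : x \in ball j -> y \in ball k -> x + y \in ball (j + k).
Proof.
elim: k y => [y xj|k IH y xj].
  by rewrite inE => /eqP ->; rewrite addr0 addn0.
case/imsetP => -[u v]; rewrite in_setX => /andP[uk vm] ->.
by rewrite addnS addrA ball_addS // IH.
Qed.

Lemma ball_opp k x : x \in ball k -> - x \in ball k.
Proof.
elim: k x => [x|k IH x]; first by rewrite !inE => /eqP ->; rewrite oppr0.
case/imsetP => -[u v]; rewrite in_setX => /andP[uk vm] ->.
by rewrite opprD ball_addS ?IH ?moves_opp.
Qed.

Lemma ball0 k : 0 \in ball k.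
Proof. by elim: k => [|k IH]; [rewrite inE|rewrite -[0]addr0 ball_addS ?setU11]. Qed.

Lemma ball_mono j k x : (j <= k)%N -> x \in ball j -> x \in ball k.
Proof. by move=> /subnK <- xj; rewrite -[x]add0r ball_add ?ball0. Qed.

Lemma moves_ball x : x \in moves -> x \in ball 1.
Proof. by move=> xm; rewrite -[x]add0r ball_addS ?ball0. Qed.

Lemma near_sym k : symmetric (near k).
Proof. by move=> x y; apply/idP/idP => /ball_opp; rewrite opprB. Qed.

Lemma near_trans j k x y z : near j x y -> near k y z -> near (j + k) x z.
Proof. by move=> xy yz; have := ball_add xy yz; rewrite addrC addrA subrK. Qed.

Lemma card_near k x : (#|[set y | near k x y]| <= (2 * d).+1 ^ k)%N.
Proof.
apply: leq_trans (card_ball k); rewrite -(card_imset _ (addIr (- x))); apply: subset_leq_card.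
by apply/subsetP => u /imsetP[y]; rewrite inE => xy ->.
Qed.

Definition separated S : bool := [forall x in S, forall y in S, (x != y) ==> ~~ near 2 x y].

Lemma separated_spheres S x y : separated S -> x \in S -> y \in S -> x != y -> [disjoint sphere x & sphere y].
Proof.
move=> /forall_inP sep xS yS xy; have /forall_inP/(_ _ yS) := sep x xS; rewrite xy /= => nxy.
rewrite disjoint_subset; apply/subsetP => _ /imsetP[t _ ->]; rewrite inE; apply/negP => /imsetP[u _ e].
move/negP: nxy; apply; rewrite /near.
have -> : y - x = step n t - step n u by apply/eqP; rewrite subr_eq addrAC eq_sym subr_eq -e addrC.
by apply: (@ball_add 1 1); apply: moves_ball; rewrite ?moves_opp // inE imset_f ?orbT.
Qed.

Lemma separated_net B : exists S : {set V},
  [/\ S \subset B, separated S & forall y, y \in B -> exists2 s, s \in S & near 2 s y].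
Proof.
have P0 : (set0 \subset B) && separated set0.
  by rewrite sub0set; apply/forall_inP => x; rewrite inE.
have [S /maxsetP[/andP[SB sep] mx] _] := @maxset_exists _ (fun S => (S \subset B) && separated S) _ P0.
exists S; split => // y yB; apply/exists_inP; apply: contraT => /exists_inPn far.
have yS : y \notin S by apply/negP => /far; rewrite /near subrr ball0.
suff : y |: S = S by move=> e; move: yS; rewrite -e setU11.
apply: mx; last exact: subsetUr.
rewrite subUset sub1set yB SB /=; apply/forall_inP => u /setU1P[->|uS]; apply/forall_inP => v /setU1P[->|vS]; apply/implyP => uv.
- by rewrite eqxx in uv.
- by rewrite near_sym far.
- by rewrite far.
- by have /forall_inP/(_ _ uS)/forall_inP/(_ _ vS) := sep; rewrite uv.
Qed.

End Balls.

Section Contours.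
Variables n d : nat.
Local Notation L := n.+2.
Local Notation V := (torus L d).
Implicit Types (x y z : V) (i k : 'I_d) (C : {set V}).
Variables (U B S : {set V}).
Hypothesis boundary_bad : forall p, p \in boundary U -> (p.1 \in B) || (p.1 + unitv n p.2 \in B).
Hypothesis net : forall y, y \in B -> exists2 s, s \in S & near 2 s y.
Local Notation comps := (components (@near n d 6) S).

Definition bad_end (p : V * 'I_d) : V := if p.1 \in B then p.1 else p.1 + unitv n p.2.
Definition contour C : {set V * 'I_d} :=
  [set p in boundary U | [exists s in C, near 2 s (bad_end p)]].

Lemma mem_contour C p : (p \in contour C) = (p \in boundary U) && [exists s in C, near 2 s (bad_end p)].
Proof. by rewrite [LHS]in_set. Qed.

Lemma bad_endP p : p \in boundary U -> bad_end p \in B.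
Proof. by move=> /boundary_bad; rewrite /bad_end; case: ifP. Qed.

(* Bad ends within distance 2 have net points within distance 6. *)
Lemma contour_near C p q : C \in comps -> p \in contour C -> q \in boundary U ->
  near 2 (bad_end p) (bad_end q) -> q \in contour C.
Proof.
move=> CS; rewrite !mem_contour => /andP[pU /existsP[s /andP[sC sp]]] qU pq; rewrite qU /=.
have [u uS uq] := net (bad_endP qU); apply/existsP; exists u; rewrite uq andbT.
apply: (component_closed (@near_sym n d 6) CS sC uS).
by rewrite (@near_trans _ _ 4 2 s (bad_end q)) ?(@near_trans _ _ 2 2 s (bad_end p)) // near_sym.
Qed.

Lemma contour_unique C C' p : C \in comps -> C' \in comps -> p \in contour C -> p \in contour C' -> C = C'.
Proof.
move=> CS CS'; rewrite !mem_contour => /andP[pU /existsP[s /andP[sC sp]]] /andP[_ /existsP[u /andP[uC up]]].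
have /and3P[/eqP cov triv _] := components_partition (@near_sym n d 6) S.
have uS : u \in S by rewrite -cov; apply/bigcupP; exists C'.
have uC' : u \in C.
  apply: (component_closed (@near_sym n d 6) CS sC uS); apply: (@ball_mono _ _ 4) => //.
  by apply: (@near_trans _ _ 2 2 s (bad_end p)) => //; rewrite near_sym.
by rewrite -(def_pblock triv CS uC') (def_pblock triv CS' uC).
Qed.

Lemma contour_exists p : p \in boundary U -> exists2 C, C \in comps & p \in contour C.
Proof.
move=> pU; have [s sS sp] := net (bad_endP pU).
have /and3P[/eqP cov triv _] := components_partition (@near_sym n d 6) S.
have : s \in cover comps by rewrite cov.
case/bigcupP => C CS sC; exists C => //; rewrite mem_contour pU; apply/existsP; exists s.
by rewrite sC.
Qed.

Definition corner (x : V) i k (a b : bool) : V := x + (if a then unitv n i else 0) + (if b then unitv n k else 0).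

Lemma corner_near x i k a b a' b' : near 2 (corner x i k a b) (corner x i k a' b').
Proof.
have mv (l : 'I_d) (u v : bool) : (if u then unitv n l else 0) - (if v then unitv n l else 0) \in ball n d 1.
  apply: moves_ball; apply/setUP; case: u; case: v; rewrite ?subrr ?subr0 ?sub0r; try by left; rewrite inE.
    by right; apply/imsetP; exists (l, true).
  by right; apply/imsetP; exists (l, false).
rewrite /near /corner !opprD addrACA [X in X + _]addrACA subrr add0r.
exact: (@ball_add _ _ 1 1).
Qed.

(** The bad ends of the edges of a unit square are corners of it, hence within distance 2. So if the
    contour of C contains one of the edges, it agrees with the boundary of U on the whole square,
    where the mod-2 sum vanishes. *)
Lemma contour_closed C x i k : C \in comps -> (x i < n.+1)%N -> (x k < n.+1)%N -> i != k ->
  ((x, i) \in contour C) (+) ((x + unitv n i, k) \in contour C) (+)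
  ((x + unitv n k, i) \in contour C) (+) ((x, k) \in contour C) = false.
Proof.
move=> CS xi xk ik.
pose sq (p : V * 'I_d) := exists a b, bad_end p = corner x i k a b.
have s1 : sq (x, i).
  by rewrite /sq /bad_end /=; case: ifP => _; [exists false, false|exists true, false]; rewrite /corner ?addr0.
have s2 : sq (x + unitv n i, k).
  by rewrite /sq /bad_end /=; case: ifP => _; [exists true, false|exists true, true]; rewrite /corner ?addr0.
have s3 : sq (x + unitv n k, i).
  by rewrite /sq /bad_end /=; case: ifP => _; [exists false, true|exists true, true]; rewrite /corner ?addr0 // addrAC.
have s4 : sq (x, k).
  by rewrite /sq /bad_end /=; case: ifP => _; [exists false, false|exists false, true]; rewrite /corner ?addr0.
have xik : (x + unitv n k) i = x i by rewrite addvE unitvE (negbTE ik) addr0.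
have xki : (x + unitv n i) k = x k by rewrite addvE unitvE eq_sym (negbTE ik) addr0.
have key p : sq p -> p \in contour C -> 
   forall q, sq q -> (q \in contour C) = (q \in boundary U).
  move=> [a [b ep]] pC q [a' [b' eq]]; apply/idP/idP; first by rewrite mem_contour => /andP[].
  by move=> qU; apply: (contour_near CS pC qU); rewrite ep eq corner_near.
have all p : sq p -> p \in contour C -> 
  ((x, i) \in contour C) (+) ((x + unitv n i, k) \in contour C) (+)
  ((x + unitv n k, i) \in contour C) (+) ((x, k) \in contour C) = false.
  move=> sp pC; rewrite !(key p sp pC) // !inE /= xi xk xik xki xi xk /=.
  rewrite [x + unitv n k + unitv n i]addrAC.
  by case: (x \in U); case: (x + unitv n i \in U); case: (x + unitv n k \in U); case: (x + unitv n i + unitv n k \in U).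
have [h|h1] := boolP ((x, i) \in contour C); first by have := all _ s1 h; rewrite h.
have [h|h2] := boolP ((x + unitv n i, k) \in contour C); first by have := all _ s2 h; rewrite (negbTE h1) h.
have [h|h3] := boolP ((x + unitv n k, i) \in contour C); first by have := all _ s3 h; rewrite (negbTE h1) (negbTE h2) h.
have [h|//] := boolP ((x, k) \in contour C).
by have := all _ s4 h; rewrite (negbTE h1) (negbTE h2) (negbTE h3) h.
Qed.

Lemma contour_boundary C : C \in comps -> exists W, boundary W = contour C.
Proof.
move=> CS; have [|W hW] := @exactness n d (fun x i => (x, i) \in contour C).
  by move=> x i k ik xi xk; exact: contour_closed.
exists W; apply/setP => -[x i]; rewrite inE /=.
have [xi|xi] := ltnP (x i) n.+1; first by rewrite -hW.
by rewrite !inE /= ltnNge xi.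
Qed.

(** An edge is recovered from its bad end, its direction and which of its two ends that is. *)
Lemma card_contour C : (#|contour C| <= 2 * d * (2 * d).+1 ^ 2 * #|C|)%N.
Proof.
pose N2 : {set V} := \bigcup_(s in C) [set y | near 2 s y].
have cN : (#|N2| <= (2 * d).+1 ^ 2 * #|C|)%N.
  apply: leq_trans (card_le_cover (P := mem C) (B := fun s => [set y | near 2 s y]) _) _.
    by move=> y /bigcupP[s sC ys]; exists s.
  apply: (@leq_trans (\sum_(s in C) (2 * d).+1 ^ 2)); last by rewrite sum_nat_const mulnC.
  by apply: leq_sum => s _; exact: card_near.
pose f (p : V * 'I_d) := ((p.2, p.1 \in B), bad_end p).
have fi : injective f.
  move=> [x i] [y k] []; rewrite /bad_end /= => -> ->; case: ifP => _ => [->|/addIr ->] //.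
rewrite -(card_imset _ fi); apply: (@leq_trans #|setX [set: 'I_d * bool] N2|).
  apply: subset_leq_card; apply/subsetP => u /imsetP[p]; rewrite mem_contour => /andP[_ /existsP[s /andP[sC h]]] ->.
  by rewrite in_setX in_setT /=; apply/bigcupP; exists s; rewrite ?inE.
by rewrite cardsX cardsT card_prod card_ord card_bool [(d * 2)%N]mulnC -[leqRHS]mulnA leq_mul2l cN orbT.
Qed.

Lemma card_net : (#|B| <= (2 * d).+1 ^ 2 * #|S|)%N.
Proof.
apply: leq_trans (card_le_cover (P := mem S) (B := fun s => [set y | near 2 s y]) _) _.
  by move=> y /net[s sC ys]; exists s; rewrite ?inE.
apply: (@leq_trans (\sum_(s in S) (2 * d).+1 ^ 2)); last by rewrite sum_nat_const mulnC.
by apply: leq_sum => s _; exact: card_near.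
Qed.

(** The filling of a contour of at most c m edges, plus the bad cubes near its m net points. *)
Definition contour_volume (m : nat) : nat :=
  let c := (2 * d * (2 * d).+1 ^ 2)%N in (2 * (c * m) * minn L (c * m) + (2 * d).+1 ^ 2 * m)%N.

(* U and the mod-2 sum of the fillings W C have the same boundary, so they are equal or
   complementary. *)
Lemma peierls (i0 i1 : 'I_d) : i0 != i1 ->
  (minn #|U| #|~: U| + #|B| <= \sum_(C in comps) contour_volume #|C|)%N.
Proof.
move=> i01; pose c := (2 * d * (2 * d).+1 ^ 2)%N.
have ex C : exists W : {set V}, C \in comps ->
    boundary W = contour C /\ (#|W| <= 2 * (c * #|C|) * minn L (c * #|C|))%N.
  case: (boolP (C \in comps)) => CS; last by exists set0.
  have [W0 bW] := contour_boundary CS; have [W eW cW] := box_isoperimetry W0 i01.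
  have cc := card_contour C; rewrite -/c in cc.
  exists W => _; split; first by case: eW => ->; rewrite ?boundary_setC.
  apply: (leq_trans cW); rewrite bW; apply: leq_mul; first by rewrite leq_mul2l.
  by rewrite leq_min geq_minl /= (leq_trans (geq_minr _ _)).
have [W hW] := fin_all_exists ex.
pose w x := \big[addb/false]_(C in comps) (x \in W C).
pose Q : {set V} := [set x | (x \in U) (+) w x].
have bQ : boundary Q = set0.
  apply/setP => -[x i]; rewrite !inE /=; apply/negbTE; rewrite negb_and.
  have [xi /=|//] := boolP (x i < n.+1)%N.
  rewrite addbACA /w -big_split /=.
  have -> : \big[addb/false]_(C in comps) ((x \in W C) (+) (x + unitv n i \in W C)) =
     \big[addb/false]_(C in comps) ((x, i) \in contour C).
    by apply: eq_bigr => C CS; have [<- _] := hW C CS; rewrite inE /= xi.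
  have eU : (x \in U) (+) (x + unitv n i \in U) = ((x, i) \in boundary U) by rewrite inE /= xi.
  rewrite eU; case: (boolP ((x, i) \in boundary U)) => pU; last first.
    rewrite big1 // => C CS; apply/negbTE; apply: contra pU; by rewrite mem_contour => /andP[].
  have [C0 CS0 pC0] := contour_exists pU; rewrite (bigD1 C0) //= pC0 big1 // => C /andP[CS CC0].
  by apply/negbTE; apply: contra CC0 => pC; apply/eqP; exact: contour_unique CS CS0 pC pC0.
have cov (A : {set V}) : (forall x, x \in A -> w x) -> (#|A| <= \sum_(C in comps) #|W C|)%N.
  move=> hA; apply: card_le_cover => x /hA wx; apply/exists_inP; apply: contraLR wx => /exists_inPn no.
  by rewrite /w big1 // => C CS; apply/negbTE; exact: no.
have h1 : (minn #|U| #|~: U| <= \sum_(C in comps) #|W C|)%N.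
  case: (boundary0 bQ) => eQ; rewrite geq_min; apply/orP; [left|right]; apply: cov => x xU.
    by have := in_set0 x; rewrite -eQ inE xU; case: (w x).
  by have := in_setT x; rewrite -eQ inE; move: xU; rewrite inE => /negbTE ->.
have h2 : (#|B| <= \sum_(C in comps) (2 * d).+1 ^ 2 * #|C|)%N.
  have /and3P[/eqP covS triv _] := components_partition (@near_sym n d 6) S.
  by rewrite -big_distrr /= (eqP triv) covS card_net.
apply: leq_trans (leq_add h1 h2) _; rewrite -big_split /=; apply: leq_sum => C CS.
by rewrite /contour_volume leq_add2r; have [_ ?] := hW C CS.
Qed.

End Contours.

(** * Signs of the cubes that are not bad *)

Section Signs.
Variables n d e : nat.
Hypotheses (n_even : ~~ odd n) (e0 : (0 < e)%N).
Local Notation L := n.+2.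
Local Notation V := (torus L d).
Implicit Types (x y j : V) (i k : 'I_d) (I : {set V}) (b : cube d).

Definition bad_sites I : {set V} := [set j | bad e (local I j)].
(** Shifting the local parity by [parity j] makes signs comparable between cubes: the local class
    [parity j] is the part of I in the sublattice [false]. *)
Definition plus I : {set V} :=
  [set j | (j \notin bad_sites I) && (2 ^ d <= e * #|local I j :&: parset d (parity j)|)%N].

Lemma mem_plus I j : (j \in plus I) =
  (j \notin bad_sites I) && (2 ^ d <= e * #|local I j :&: parset d (parity j)|)%N.
Proof. by rewrite [LHS]in_set. Qed.

Lemma not_bad_sites I j : j \notin bad_sites I ->
  (forall i s, 2 * 2 ^ d <= e * #|local I j :&: facet i s|)%N /\
  exists s, (e * #|local I j :&: parset d s| < 2 ^ d)%N.
Proof.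
rewrite inE negb_or => /andP[]; rewrite /mixed negb_forall => /existsP[s hs] /existsPn h.
split; last by exists s; rewrite ltnNge.
by move=> i u; rewrite leqNgt; have /existsPn := h i; exact.
Qed.

Lemma card_setI_parset (K A : {set cube d}) s :
  #|K :&: A| = (#|K :&: parset d s :&: A| + #|K :&: parset d (~~ s) :&: A|)%N.
Proof.
rewrite -(cardsID (parset d s)); congr addn; apply: eq_card => x; rewrite !inE.
  by rewrite andbAC.
by rewrite andbC -andbA; case: (par x); case: (s); rewrite ?andbT ?andbF.
Qed.

(** The facet has at least 2 * 2^d / e points and the sparse class fewer than 2^d / e, so at least
    2^d / e points of class p are on it; the neighbour sees them in class ~~ p. *)
Lemma sign_transport I j i s p : (e * #|local I j :&: parset d (~~ p)| < 2 ^ d)%N ->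
  (2 * 2 ^ d <= e * #|local I j :&: facet i s|)%N ->
  (2 ^ d <= e * #|local I (j + step n (i, s))%R :&: parset d (~~ p)|)%N.
Proof.
move=> minor; rewrite (card_setI_parset _ _ p).
rewrite (@card_facet_shift_step n d I j i s (parset d p) (parset d (~~ p))); last exact: flip_parset.
have c1 : (#|local I j :&: parset d (~~ p) :&: facet i s| <= #|local I j :&: parset d (~~ p)|)%N.
  by apply: subset_leq_card; exact: subsetIl.
have c2 : (#|local I (j + step n (i, s))%R :&: parset d (~~ p) :&: facet i (~~ s)| <= #|local I (j + step n (i, s))%R :&: parset d (~~ p)|)%N.
  by apply: subset_leq_card; exact: subsetIl.
move: minor c1 c2; set a := #|_|; set b := #|_|; set c := #|_|; set c' := #|_|.
rewrite -[(b <= a)%N](leq_pmul2l e0) -[(c <= c')%N](leq_pmul2l e0) mulnDr.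
move: (2 ^ d)%N (e * a)%N (e * b)%N (e * c)%N (e * c')%N => N u v w z; lia.
Qed.

Lemma plus_unitv I j i : j \notin bad_sites I -> j + unitv n i \notin bad_sites I ->
  (j \in plus I) = (j + unitv n i \in plus I).
Proof.
move=> gj gk; rewrite !mem_plus gj gk /=.
have [fj [s hs]] := not_bad_sites gj; have [fk [u hu]] := not_bad_sites gk.
have tj := @sign_transport I j i true (~~ s); rewrite negbK in tj; have tjs := tj hs (fj i true).
have tk := @sign_transport I (j + unitv n i) i false (~~ u); rewrite negbK in tk; have := tk hu (fk i false).
rewrite /step /= addrK parity_unitv // => tks.
have us : u = ~~ s.
  by case: (eqVneq u s) hu => [->|]; [rewrite ltnNge tjs|case: (u); case: (s)].
rewrite us in hu tks.
have [->|->] : parity j = s \/ parity j = ~~ s by case: (parity j); case: (s); auto.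
  by rewrite [in LHS]leqNgt [in RHS]leqNgt hs hu.
by rewrite negbK tjs tks.
Qed.

Lemma plus_boundary I p : p \in boundary (plus I) -> (p.1 \in bad_sites I) || (p.1 + unitv n p.2 \in bad_sites I).
Proof.
rewrite [in X in X -> _]in_set => /andP[_ h]; apply: contraLR h; rewrite negb_or => /andP[g1 g2].
by rewrite (plus_unitv g1 g2) addbb.
Qed.

End Signs.

Section ContourEvent.
Variables (R : realType) (n d e : nat) (g : R).
Hypotheses (n_even : ~~ odd n) (n2 : (1 < n)%N) (e0 : (0 < e)%N) (ed : (8 * e <= d)%N) (g0 : 0 <= g).
Local Notation L := n.+2.
Local Notation V := (torus L d).
Local Notation c := (2 * d * (2 * d).+1 ^ 2)%N.
Let Z : R := #|[set I : {set V} | independent I]|%:R.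
Hypothesis chess : forall J : {set V}, #|relaxed_on e J|%:R <= Z * expR (- (g * #|J|%:R)).
Let y : R := expR 1 * ((2 * d).+1 ^ 6)%:R ^+ 2 * bad_weight d e g.

Lemma contour_volume_linear m : (contour_volume n d m <= 3 * (c * L) * m)%N.
Proof.
have d0 : (0 < d)%N by apply: leq_trans ed; rewrite muln_gt0.
rewrite /contour_volume; set k := ((2 * d).+1 ^ 2)%N.
have kc : (k <= 2 * d * k)%N by rewrite leq_pmull // muln_gt0.
move: kc; move: (2 * d * k)%N => u kc.
have h1 : (2 * (u * m) * minn L (u * m) <= 2 * (u * m) * L)%N by rewrite leq_mul2l geq_minl orbT.
have h2 : (k * m <= u * m * L)%N by apply: leq_trans (leq_pmulr _ _); rewrite ?leq_mul2r ?kc ?orbT.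
apply: leq_trans (leq_add h1 h2) _; move: n.+2 => l; nia.
Qed.

Lemma contour_volume_quadratic m : (contour_volume n d m <= 3 * c ^ 2 * m ^ 2)%N.
Proof.
have d0 : (0 < d)%N by apply: leq_trans ed; rewrite muln_gt0.
rewrite /contour_volume; set k := ((2 * d).+1 ^ 2)%N.
have kc : (k <= 2 * d * k)%N by rewrite leq_pmull // muln_gt0.
move: kc; move: (2 * d * k)%N => u kc.
have h1 : (2 * (u * m) * minn L (u * m) <= 2 * (u * m) * (u * m))%N by rewrite leq_mul2l geq_minr orbT.
have h2 : (k * m <= (u * m) * (u * m))%N.
  apply: (@leq_trans (u * m)); first by rewrite leq_mul2r kc orbT.
  by case: (u * m)%N => // j; rewrite leq_pmulr.
apply: leq_trans (leq_add h1 h2) _; rewrite -!mulnn; nia.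
Qed.

(** Of the exponent a |V| / (3 c L) of the tail bound, half pays for the sum over clusters, by 12
    c^2 y <= a, and half remains. *)
Lemma contour_event (a : R) : 0 <= a -> y <= 8^-1 -> 12 * (c ^ 2)%:R * y <= a ->
  #|[set I : {set V} | independent I &&
      (a * #|{: V}|%:R <= (minn #|plus e I| #|~: plus e I| + #|bad_sites e I|)%:R)]|%:R <=
  Z * expR (- (a * #|{: V}|%:R / (6 * (c * L)%:R))).
Proof.
move=> a0 y8 ya.
have d0 : (0 < d)%N by apply: leq_trans ed; rewrite muln_gt0.
have d1 : (1 < d)%N by apply: leq_trans ed; lia.
pose i0 := Ordinal d0; pose i1 := Ordinal d1.
have [S hS] := fin_all_exists (fun I : {set V} => separated_net (bad_sites e I)).
have q0 : 0 <= bad_weight d e g by rewrite mulr_ge0 ?exprn_ge0 ?expR_ge0.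
have Z0 : 0 <= Z by exact: ler0n.
pose Om := [set I : {set V} | independent I].
have dilute (Y : {set V}) : #|[set I in Om | Y \subset S I]|%:R <= Z * bad_weight d e g ^+ #|Y|.
  have [sepY|nsep] := boolP (separated Y).
    have sp : {in Y &, forall x z, x != z -> [disjoint sphere x & sphere z]}.
      by move=> x z xY zY; exact: separated_spheres sepY xY zY.
    apply: le_trans (card_bad_sites n2 e0 ed g0 chess sp); rewrite ler_nat; apply: subset_leq_card.
    apply/subsetP => I; rewrite !in_set => /andP[-> /subsetP YS]; apply/forall_inP => x /YS xS.
    by have [/subsetP/(_ _ xS)] := hS I; rewrite inE.
  (* Nets are separated, so none of them contains Y. *)
  rewrite (_ : [set I in Om | Y \subset S I] = set0) ?cards0 ?mulr_ge0 ?exprn_ge0 //.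
  apply/setP => I; rewrite [LHS]in_set in_set0; apply: contraNF nsep => /andP[_ /subsetP YS].
  have [_ /forall_inP sep _] := hS I; apply/forall_inP => x xY; apply/forall_inP => z zY.
  by have /forall_inP := sep x (YS _ xY); apply; exact: YS.
have c0 : (0 < c)%N by rewrite muln_gt0 muln_gt0 d0 expn_gt0.
have a1 : 0 < 3 * (c * L)%:R :> R by rewrite mulr_gt0 // ltr0n muln_gt0 c0.
have b1 : 0 <= 3 * (c ^ 2)%:R :> R by rewrite mulr_ge0.
have F0 k : 0 <= (contour_volume n d k)%:R :> R by [].
have Fa k : (contour_volume n d k)%:R <= 3 * (c * L)%:R * k%:R :> R.
  by rewrite -!natrM ler_nat contour_volume_linear.
have Fb k : (contour_volume n d k)%:R <= 3 * (c ^ 2)%:R * k%:R ^+ 2 :> R.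
  by rewrite -natrX -!natrM ler_nat contour_volume_quadratic.
have D0 : (0 < (2 * d).+1 ^ 6)%N by rewrite expn_gt0.
have := cluster_tail (@near_sym n d 6) (@card_near n d 6) Z0 q0 a1 b1 F0 Fa Fb dilute D0 y8 (a * #|{: V}|%:R).
move=> tail; apply: le_trans (le_trans tail _).
  rewrite ler_nat; apply: subset_leq_card; apply/subsetP => I; rewrite !in_set => /andP[-> h] /=.
  apply: (le_trans h); rewrite -natr_sum ler_nat.
  have [SB _ net] := hS I; apply: (@peierls n d _ _ _ _ net i0 i1) => //.
  by move=> p; exact: plus_boundary.
rewrite -/y ler_wpM2l // ler_expR.
have -> : #|{: V}|%:R * (3 * (c ^ 2)%:R / (3 * (c * L)%:R)) * (2 * y) - a * #|{: V}|%:R / (3 * (c * L)%:R) =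
   - (a * #|{: V}|%:R / (6 * (c * L)%:R)) + #|{: V}|%:R / (6 * (c * L)%:R) * (12 * (c ^ 2)%:R * y - a).
  have cL0 : (c * L)%:R != 0 :> R by rewrite pnatr_eq0 -lt0n muln_gt0 c0.
  by move: (c * L)%:R cL0 (c ^ 2)%:R (#|{: V}|%:R) y => u u0 v w z; field.
rewrite gerDl; apply: mulr_ge0_le0; last by rewrite subr_le0.
by apply: divr_ge0 => //; rewrite mulr_ge0.
Qed.

End ContourEvent.

(** * Balanced independent sets *)

Section Dominance.
Variables n d e : nat.
Hypotheses (n_even : ~~ odd n) (e0 : (0 < e)%N).
Local Notation L := n.+2.
Local Notation V := (torus L d).
Implicit Types (x y j : V) (i k : 'I_d) (I : {set V}) (b : cube d).

Lemma parity_emb j b : parity (j + emb n b) = parity j (+) par b.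
Proof.
rewrite /parity /par !(big_morph odd oddD (erefl _)) -big_split; apply: eq_bigr => k _ /=.
rewrite addvE [emb n b k]ffunE; case: (b k); last by rewrite addr0 addbF.
rewrite [nat_of_ord (_ + _)]val_succ; case: eqP => [->|_] /=; last by rewrite addbT.
by rewrite n_even.
Qed.

(** Every site lies in 2 ^ d unit cubes, in each of them in the same class relative to
    [parity j]. *)
Lemma sum_local_parity I s :
  (\sum_j #|local I j :&: parset d (parity j (+) s)| = 2 ^ d * #|I :&: sublattice n d s|)%N.
Proof.
transitivity (\sum_(j : V) \sum_(b : cube d) ((j + emb n b)%R \in I :&: sublattice n d s : nat))%N.
  apply: eq_bigr => j _; rewrite -sum1_card big_mkcond; apply: eq_bigr => b _.
  rewrite in_setI in_local !inE parity_emb.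
  rewrite (_ : (par b == parity j (+) s) = (parity j (+) par b == s)); first by case: (_ && _).
  by case: (par b); case: (parity j); case: (s).
rewrite exchange_big /= (eq_bigr (fun=> #|I :&: sublattice n d s|)) => [|b _].
  by rewrite sum_nat_const card_cube.
rewrite -sum1_card [RHS]big_mkcond /= (reindex_inj (addIr (- emb n b))) /=.
by apply: eq_bigr => j _; rewrite subrK; case: (_ \in _).
Qed.

Lemma sparse_sublattice I s (X : {set V}) :
  (forall j, j \notin X -> (e * #|local I j :&: parset d (parity j (+) s)| <= 2 ^ d)%N) ->
  (e * #|I :&: sublattice n d s| <= e * #|X| + #|{: V}|)%N.
Proof.
move=> h; rewrite -(leq_pmul2l (expn_gt0 2 d)) /= mulnCA -sum_local_parity big_distrr /=.
apply: (@leq_trans (\sum_(j : V) (e * 2 ^ d * (j \in X) + 2 ^ d))).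
  apply: leq_sum => j _; have [jX|jX] := boolP (j \in X); last by rewrite muln0 h.
  rewrite muln1; apply: leq_trans (leq_addr _ _); rewrite leq_mul2l -card_cube max_card orbT //.
rewrite big_split /= -big_distrr /= sum_nat_const.
have -> : (\sum_(j : V) (j \in X) = #|X|)%N.
  by rewrite -sum1_card [RHS]big_mkcond; apply: eq_bigr => j _; case: (_ \in _).
move: (2 ^ d)%N #|X| => N m; by rewrite mulnDr mulnAC [(e * m * N)%N]mulnC [(_ * N)%N]mulnC.
Qed.

(** Away from the bad cubes and the smaller of the two sign regions all signs agree, so one
    sublattice is sparse there. The exceptional cubes account for a and the sparse ones for 1 / e of
    the volume. *)
Lemma dominant_sublattice (R : realType) (a : R) I : 
  (minn #|plus e I| #|~: plus e I| + #|bad_sites e I|)%:R < a * #|{: V}|%:R ->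
  exists s, #|I :&: sublattice n d s|%:R <= (a + e%:R^-1) * #|{: V}|%:R.
Proof.
move=> h.
have er : 0 < e%:R :> R by rewrite ltr0n.
have fin s (X : {set V}) : #|X|%:R <= a * #|{: V}|%:R ->
  (forall j, j \notin X -> (e * #|local I j :&: parset d (parity j (+) s)| <= 2 ^ d)%N) ->
  #|I :&: sublattice n d s|%:R <= (a + e%:R^-1) * #|{: V}|%:R.
  move=> cX /sparse_sublattice; rewrite -(@ler_nat R) natrD !natrM -ler_pdivlMl // => hX.
  by apply: (le_trans hX); rewrite mulrDr mulKf ?gt_eqF // mulrDl lerD2r.
have [pm|pm] := leqP #|plus e I| #|~: plus e I|; move: h.
  rewrite (minn_idPl pm) => /ltW h; exists false; apply: (fin _ (plus e I :|: bad_sites e I)).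
    by apply: le_trans h; rewrite ler_nat; have [] := leq_card_setU (plus e I) (bad_sites e I).
  move=> j; rewrite in_setU negb_or => /andP[jp jb]; rewrite addbF ltnW // ltnNge.
  by apply: contra jp => h2; rewrite mem_plus jb.
rewrite (minn_idPr (ltnW pm)) => /ltW h; exists true; apply: (fin _ (~: plus e I)).
  by apply: le_trans h; rewrite ler_nat leq_addr.
move=> j; rewrite in_setC negbK mem_plus => /andP[jb je]; rewrite addbT ltnW //.
have [_ [s]] := not_bad_sites jb; case: (eqVneq s (parity j)) => [->|]; first by rewrite ltnNge je.
by case: (parity j); case: (s).
Qed.

End Dominance.

(** The entropy of a nearly empty A has a rate that tends to 0 with K, so it can be kept below half
    of the rate c gained on B. *)
Lemma card_lopsided (R : realType) (eta : R) : 0 < eta -> eta < 1 / 2 ->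
  exists K c : R, [/\ 0 < K, K <= eta, 0 < c &
    forall (T : finType) (A B : {set T}), #|A| = #|B| -> A :|: B = setT ->
    #|[set I : {set T} | (#|I :&: A|%:R <= K * #|A|%:R) && (#|I :&: B|%:R <= (1 / 2 - eta) * #|B|%:R)]|%:R
      <= 2 ^+ #|B| * expR (- (c * #|B|%:R))].
Proof.
move=> eta0 eta1; have [c [c0 half]] := card_subsets_lt_half eta0 eta1.
(* K is u^2 because ln u >= 1 - 1 / u then gives u^2 (1 - ln (u^2)) <= 2 u, which is at most c /
   2. *)
pose u := Num.min (c / 4) eta.
have u0 : 0 < u by rewrite lt_min divr_gt0.
have uc : u <= c / 4 by rewrite ge_min lexx.
have ue : u <= eta by rewrite ge_min lexx orbT.
have u1 : u < 1 by lra.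
have K0 : 0 < u ^+ 2 by rewrite exprn_gt0.
have Ku : u ^+ 2 <= u by rewrite expr2 -[leRHS]mulr1 ler_wpM2l // ltW.
have Ks : u ^+ 2 * (1 - ln (u ^+ 2)) <= c / 2.
  have iu : 0 < u^-1 by rewrite invr_gt0.
  have h := @le_ln1Dx R (u^-1 - 1) ltac:(lra).
  rewrite addrC subrK lnV ?posrE // in h.
  rewrite lnXn // -[ln u *+ 2]mulr_natl.
  have h2 := ler_wpM2l (ltW K0) h.
  have e1 : u ^+ 2 * (u^-1 - 1) = u - u ^+ 2 by field; exact: lt0r_neq0.
  rewrite e1 in h2; move: h2 (ltW K0) uc; rewrite mulrN => h2 h3 h4.
  have -> : u ^+ 2 * (1 - 2 * ln u) = u ^+ 2 - 2 * (u ^+ 2 * ln u) by ring.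
  lra.
exists (u ^+ 2), (c / 2); split => //; [exact: le_trans ue|lra|].
move=> T A B AB AUB.
pose SA := [set X : {set T} | (X \subset A) && (#|X|%:R <= u ^+ 2 * #|A|%:R)].
pose SB := [set X : {set T} | (X \subset B) && (#|X|%:R <= (1 / 2 - eta) * #|B|%:R)].
apply: (@le_trans _ _ (#|SA|%:R * #|SB|%:R)).
  rewrite -natrM -cardsX ler_nat; pose f (I : {set T}) := (I :&: A, I :&: B).
  have fi : injective f by move=> I J [e1 e2]; rewrite -[I]setIT -[J]setIT -AUB !setIUr e1 e2.
  rewrite -(card_imset _ fi); apply: subset_leq_card; apply/subsetP => p /imsetP[I].
  by rewrite in_set => /andP[h1 h2] ->; rewrite in_setX !in_set !subsetIr h1 h2.
have hA := @card_small_subsets R T A (u ^+ 2) K0 ltac:(lra).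
apply: (@le_trans _ _ (expR (#|A|%:R * (u ^+ 2 * (1 - ln (u ^+ 2)))) * (2 ^+ #|B| * expR (- c * #|B|%:R)))).
  by apply: ler_pM => //; exact: half.
rewrite mulrCA -expRD ler_wpM2l ?exprn_ge0 // ler_expR AB.
have B0 : 0 <= #|B|%:R :> R by [].
have := ler_wpM2l B0 Ks; move: (u ^+ 2 * _) (#|B|%:R) => v w; lra.
Qed.

Lemma evt_bad_weight (R : realType) (C : R) (k e : nat) : 0 <= C -> (0 < e)%N ->
  evt (fun d => C * d%:R ^+ k * bad_weight d e (gain R e d) <= 1).
Proof.
move=> C0 e0; have er0 : 0 < e%:R :> R by rewrite ltr0n.
(* One power of d for C, k for the polynomial and 8 e for the prefactor of [bad_weight]. The
   exponent gained is at least [gain] times d, of order sqrt d / ln d, and exceeds m ln d. *)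
pose m := (k + 8 * e + 1)%N.
apply: evt_impl (evt_and (evt_ge (16 * e)) (evt_and (evt_ge_real C) (evt_and (@evt_ln_ge R 1) (@evt_ln_sqrt R (16 * 32 * e%:R * m%:R) 2)))).
move=> d [d16 [dC [ln1 lnsq]]].
have d0 : (0 < d)%N by apply: leq_trans d16; rewrite muln_gt0.
have dr0 : 0 < d%:R :> R by rewrite ltr0n.
have gain0 : 0 <= gain R e d.
  by rewrite invr_ge0; do ?apply: mulr_ge0 => //; rewrite ?sqrtr_ge0 //; exact: le_trans ln1.
have key : m%:R * ln d%:R <= gain R e d * (2 * (d - 8 * e))%:R.
  apply: (@le_trans _ _ (gain R e d * d%:R)); last by rewrite ler_wpM2l // ler_nat; lia.
  have sq : Num.sqrt d%:R * Num.sqrt d%:R = d%:R :> R by rewrite -expr2 sqr_sqrtr.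
  have s0 : 0 < Num.sqrt d%:R :> R by rewrite sqrtr_gt0.
  move: lnsq; rewrite /gain; move: (Num.sqrt d%:R) sq s0 (ln d%:R) ln1 => s sq s0 l ln1 h.
  have l0 : 0 < l by lra.
  rewrite -[leRHS]mulrC -[_ * (_)^-1]/(_ / _) ler_pdivlMr; last by do ?apply: mulr_gt0.
  have -> : m%:R * l * (16 * 32 * e%:R * s * l) = 16 * 32 * e%:R * m%:R * l ^+ 2 * s by ring.
  by rewrite -[leRHS]sq ler_wpM2r // ltW.
have dm : d%:R ^+ m = expR (m%:R * ln d%:R) :> R by rewrite expRM_natl lnK.
rewrite /bad_weight mulrA -[_ * _ * d%:R ^+ (8 * e)]mulrA -exprD.
apply: (@le_trans _ _ (d%:R * d%:R ^+ (k + 8 * e) * expR (- (m%:R * ln d%:R)))).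
  apply: ler_pM; rewrite ?expR_ge0 //; last by rewrite ler_expR lerN2.
    by do ?apply: mulr_ge0 => //; exact: exprn_ge0.
  by rewrite ler_wpM2r ?exprn_ge0.
by rewrite -exprS -addn1 -/m dm -expRD subrr expR0.
Qed.

(** This is where d^4 comes from: the contour constant is at most 18 d^3, and one more factor d
    absorbs 216 / a, where 216 = 2 * 6 * 18. The rates reach 2 X so that one X is left for numerical
    factors. *)
Lemma balanced_rates (R : realType) (a c v X l : R) (d : nat) : 0 < a -> 0 < c -> (0 < d)%N ->
  216 / a <= d%:R -> 4 / c <= d%:R -> 1 <= l ->
  v = l * X * d%:R ^+ 4 -> 0 < X ->
  2 * X <= a * v / (6 * ((2 * d * (2 * d).+1 ^ 2)%:R * l)) /\ 2 * X <= c * (v / 2).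
Proof.
move=> a0 c0 d0; rewrite !ler_pdivrMr // => ha hc l1 vE X0.
have d1 : 1 <= d%:R :> R by rewrite ler1n.
have l0 : 0 < l by lra.
split.
  have cub : (2 * d * (2 * d).+1 ^ 2)%:R <= 18 * d%:R ^+ 3 :> R.
    rewrite natrM natrX -[(2 * d).+1%:R]natr1 !natrM; move: (d%:R) d1 => D D1.
    have : (2 * D + 1) ^+ 2 <= (3 * D) ^+ 2 by apply: lerXn2r; rewrite ?nnegrE; lra.
    move=> h; have := ler_wpM2l (_ : 0 <= 2 * D) h; rewrite (_ : 2 * D * (3 * D) ^+ 2 = 18 * D ^+ 3); last by ring.
    by apply; lra.
  have cpos : 0 < (2 * d * (2 * d).+1 ^ 2)%:R :> R by rewrite ltr0n !muln_gt0 d0.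
  rewrite ler_pdivlMr; last by rewrite !mulr_gt0.
  move: cub cpos; move: (2 * d * _)%:R => u cub u0.
  apply: (@le_trans _ _ (216 * (l * X * d%:R ^+ 3))).
    have := ler_wpM2l (_ : 0 <= 12 * (X * l)) cub; rewrite (_ : 12 * (X * l) * (18 * d%:R ^+ 3) = 216 * (l * X * d%:R ^+ 3)); last by ring.
    by move=> h; apply: le_trans (h _); [rewrite le_eqVlt; apply/orP; left; apply/eqP; ring|rewrite !mulr_ge0 // ltW].
  rewrite vE; have -> : a * (l * X * d%:R ^+ 4) = d%:R * a * (l * X * d%:R ^+ 3) by ring.
  by apply: ler_wpM2r => //; apply: mulr_ge0; [apply: mulr_ge0; exact: ltW|exact: exprn_ge0].
rewrite vE; have d3 : 1 <= l * d%:R ^+ 3 by rewrite -[leLHS]mulr1; apply: ler_pM => //; exact: exprn_ege1.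
have -> : c * (l * X * d%:R ^+ 4 / 2) = (d%:R * c) * (l * d%:R ^+ 3) * (X / 2) by field.
apply: (@le_trans _ _ (4 * 1 * (X / 2))); first by lra.
by apply: ler_wpM2r; [lra|exact: ler_pM].
Qed.

Lemma pow2_le_volume n d : (1 < n)%N -> (1 < d)%N -> (2 ^ d <= n.+2 ^ d.-1)%N.
Proof.
move=> n2 d1; apply: (@leq_trans (4 ^ d.-1)).
  by rewrite (_ : 4 = 2 ^ 2)%N // -expnM leq_exp2l //; lia.
by rewrite leq_exp2r; lia.
Qed.

(** Uses e <= 4 and 2 d + 1 <= 3 d. The squared degree (2 d + 1)^12 gives d^12, the squared contour
    constant another d^6. *)
Lemma contour_weight_bounds (R : realType) (d : nat) (w a : R) : (0 < d)%N -> 0 <= w -> 0 < a ->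
  8 * 4 * 3 ^+ 12 * d%:R ^+ 12 * w <= 1 -> 12 * 18 ^+ 2 * 4 * 3 ^+ 12 / a * d%:R ^+ 18 * w <= 1 ->
  expR 1 * ((2 * d).+1 ^ 6)%:R ^+ 2 * w <= 8^-1 /\
  12 * ((2 * d * (2 * d).+1 ^ 2) ^ 2)%:R * (expR 1 * ((2 * d).+1 ^ 6)%:R ^+ 2 * w) <= a.
Proof.
move=> d0 w0 a0 h1 h2.
have d1 : 1 <= d%:R :> R by rewrite ler1n.
have e4 : expR 1 <= 4 :> R.
  have h : 2^-1 <= expR (- 2^-1) :> R by apply: le_trans (expR_ge1Dx _); lra.
  have : 2^-1 * 2^-1 <= expR (- 2^-1) * expR (- 2^-1) :> R by apply: ler_pM => //; rewrite invr_ge0.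
  rewrite -expRD (_ : - 2^-1 - 2^-1 = - 1 :> R); last by field.
  by rewrite expRN -invfM lef_pV2 ?posrE ?expR_gt0 // -natrM.
have u3 : (2 * d).+1%:R <= 3 * d%:R :> R by rewrite -natrM ler_nat; lia.
have u0 : 0 <= (2 * d).+1%:R :> R by [].
have t0 : 0 <= 3 * d%:R :> R by rewrite mulr_ge0.
have y12 : expR 1 * ((2 * d).+1 ^ 6)%:R ^+ 2 * w <= 4 * (3 * d%:R) ^+ 12 * w.
  rewrite natrX -exprM; apply: ler_wpM2r => //; apply: ler_pM => //.
  by apply: lerXn2r; rewrite ?nnegrE.
have y0 : 0 <= expR 1 * ((2 * d).+1 ^ 6)%:R ^+ 2 * w.
  by apply: mulr_ge0 => //; apply: mulr_ge0.
split.
  apply: (le_trans y12); rewrite -[8^-1]div1r ler_pdivlMr //; apply: le_trans h1.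
  by rewrite exprMn le_eqVlt; apply/orP; left; apply/eqP; ring.
have c18 : ((2 * d * (2 * d).+1 ^ 2) ^ 2)%:R <= (2 * d%:R * (3 * d%:R) ^+ 2) ^+ 2 :> R.
  rewrite natrX natrM natrX [(2 * d)%:R]natrM; apply: lerXn2r; rewrite ?nnegrE; do 1?[by apply: mulr_ge0 => //; do ?[exact: mulr_ge0|exact: exprn_ge0]].
  by apply: ler_wpM2l; [exact: mulr_ge0|apply: lerXn2r].
apply: (@le_trans _ _ (12 * (2 * d%:R * (3 * d%:R) ^+ 2) ^+ 2 * (4 * (3 * d%:R) ^+ 12 * w))).
  by apply: ler_pM => //; exact: ler_wpM2l.
have := ler_wpM2l (ltW a0) h2; rewrite mulr1; apply: le_trans.
rewrite le_eqVlt; apply/orP; left; apply/eqP.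
by rewrite [(3 * d%:R) ^+ 12]exprMn; move: (3 ^+ 12) => t; field; exact: lt0r_neq0.
Qed.

Section Balanced.
Variable R : realType.

Definition imbalance n d (I : {set torus n.+2 d}) : R :=
  #|I :&: sublattice n d false|%:R - #|I :&: sublattice n d true|%:R.

(* Either the contours fill a proportion a of the box, or one sublattice is nearly
   empty and the other less than half full. *)
Lemma card_balanced_le (n d e : nat) (g rho a K eta c : R) :
  ~~ odd n -> (1 < n)%N -> (0 < e)%N -> (8 * e <= d)%N -> 0 <= g -> 0 <= a ->
  (forall J : {set torus n.+2 d}, #|relaxed_on e J|%:R <= #|[set I : {set torus n.+2 d} | independent I]|%:R * expR (- (g * #|J|%:R))) ->
  expR 1 * ((2 * d).+1 ^ 6)%:R ^+ 2 * bad_weight d e g <= 8^-1 ->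
  12 * ((2 * d * (2 * d).+1 ^ 2) ^ 2)%:R * (expR 1 * ((2 * d).+1 ^ 6)%:R ^+ 2 * bad_weight d e g) <= a ->
  a + e%:R^-1 <= K / 2 -> rho + K <= 1 / 2 - eta ->
  (forall (T : finType) (A B : {set T}), #|A| = #|B| -> A :|: B = setT ->
    #|[set I : {set T} | (#|I :&: A|%:R <= K * #|A|%:R) && (#|I :&: B|%:R <= (1 / 2 - eta) * #|B|%:R)]|%:R
      <= 2 ^+ #|B| * expR (- (c * #|B|%:R))) ->
  #|[set I : {set torus n.+2 d} | independent I && (`|imbalance I| <= rho / 2 * #|{: torus n.+2 d}|%:R)]|%:R <=
  #|[set I : {set torus n.+2 d} | independent I]|%:R *
    (expR (- (a * #|{: torus n.+2 d}|%:R / (6 * (2 * d * (2 * d).+1 ^ 2 * n.+2)%:R)))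
      + 2 * expR (- (c * (#|{: torus n.+2 d}|%:R / 2)))).
Proof.
move=> n_even n2 e0 ed g0 a0 chess y8 ya aK rhoK lop.
have d0 : (0 < d)%N by apply: leq_trans ed; rewrite muln_gt0.
have cV (s : bool) : #|{: torus n.+2 d}|%:R / 2 = #|sublattice n d s|%:R :> R.
  by rewrite -(card_sublattice n_even s (Ordinal d0)) natrM mulfK // pnatr_eq0.
have ev := contour_event n_even n2 e0 ed g0 chess a0 y8 ya.
pose E1 := [set I : {set torus n.+2 d} | independent I &&
      (a * #|{: torus n.+2 d}|%:R <= (minn #|plus e I| #|~: plus e I| + #|bad_sites e I|)%:R)].
pose E2 s := [set I : {set torus n.+2 d} | (#|I :&: sublattice n d s|%:R <= K * #|sublattice n d s|%:R) &&
   (#|I :&: sublattice n d (~~ s)|%:R <= (1 / 2 - eta) * #|sublattice n d (~~ s)|%:R)].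
have cover : [set I : {set torus n.+2 d} | independent I && (`|imbalance I| <= rho / 2 * #|{: torus n.+2 d}|%:R)] \subset E1 :|: (E2 false :|: E2 true).
  apply/subsetP => I; rewrite in_set => /andP[ind]; rewrite ler_norml => /andP[lo hi].
  rewrite in_setU; case: (boolP (I \in E1)) => //=; rewrite in_set ind /= -ltNge => small.
  have [s hs] := dominant_sublattice n_even e0 small.
  have sparse : #|I :&: sublattice n d s|%:R <= K * (#|{: torus n.+2 d}|%:R / 2).
    apply: (le_trans hs); rewrite mulrCA mulrC; apply: ler_wpM2l => //.
  have other : #|I :&: sublattice n d (~~ s)|%:R <= #|I :&: sublattice n d s|%:R + rho / 2 * #|{: torus n.+2 d}|%:R.
    by move: lo hi; rewrite /imbalance; case: (s) => /=; move: (_ :&: _) (_ :&: _) => A B; lra.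
  suff : I \in E2 s by rewrite in_setU; case: (s) => ->; rewrite ?orbT.
  rewrite in_set -!cV sparse /=.
  apply: (le_trans other); apply: (le_trans (lerD sparse (lexx _))).
  have := ler_wpM2r (_ : 0 <= #|{: torus n.+2 d}|%:R / 2) rhoK; move: (#|{: torus n.+2 d}|%:R) (ler0n R #|{: torus n.+2 d}|) => v v0 h.
  by apply: le_trans (h _); [lra|rewrite divr_ge0].
have cE2 s : #|E2 s|%:R <= #|[set I : {set torus n.+2 d} | independent I]|%:R * expR (- (c * (#|{: torus n.+2 d}|%:R / 2))).
  have AB : #|sublattice n d s| = #|sublattice n d (~~ s)|.
    by apply/eqP; rewrite -(eqn_pmul2r (isT : 0 < 2)%N) !card_sublattice //; exact: Ordinal d0.
  have := lop _ (sublattice n d s) (sublattice n d (~~ s)) AB.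
  rewrite (cV (~~ s)) => h; apply: le_trans (h _) _.
    by apply/setP => x; rewrite !inE; case: (parity x); case: (s).
  rewrite ler_wpM2r ?expR_ge0 // -pow2_nat -cV; exact: card_independent_ge n_even (Ordinal d0).
apply: (@le_trans _ _ (#|E1|%:R + (#|E2 false|%:R + #|E2 true|%:R))).
  rewrite -!natrD ler_nat; apply: leq_trans (subset_leq_card cover) _.
  have [h1 _] := leq_card_setU E1 (E2 false :|: E2 true).
  have [h2 _] := leq_card_setU (E2 false) (E2 true).
  by apply: leq_trans h1 _; rewrite leq_add2l.
rewrite mulrDr; apply: lerD; first exact: ev.
apply: le_trans (lerD (cE2 false) (cE2 true)) _.
by rewrite le_eqVlt; apply/orP; left; apply/eqP; ring.
Qed.

Lemma card_balanced (rho : R) : 0 < rho -> rho < 1 / 2 -> evt (fun d => forall n, ~~ odd n -> (1 < n)%N ->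
  #|[set I : {set torus n.+2 d} | independent I && (`|imbalance I| <= rho / 2 * #|{: torus n.+2 d}|%:R)]|%:R <=
  #|[set I : {set torus n.+2 d} | independent I]|%:R * (expR (- (n.+2%:R ^+ d.-1 / d%:R ^+ 4)) / 80) :> R).
Proof.
move=> rho0 rho_half.
have [eta etaE] : exists eta, eta = (1 / 2 - rho) / 2 by exists ((1 / 2 - rho) / 2).
have eta0 : 0 < eta by rewrite etaE; lra.
have eta1 : eta < 1 / 2 by rewrite etaE; lra.
have [K [c [K0 Keta c0 lop]]] := card_lopsided eta0 eta1.
have [e e10 eK] : exists2 e, (2 ^ 10 <= e)%N & e%:R^-1 <= K / 4.
  exists (maxn (2 ^ 10) (Num.truncn (4 / K)).+1); first by rewrite leq_maxl.
  have : 4 / K <= (maxn (2 ^ 10) (Num.truncn (4 / K)).+1)%:R.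
    by apply: le_trans (ltW (truncnS_gt _)) _; rewrite ler_nat leq_maxr.
  have : (0 < maxn (2 ^ 10) (Num.truncn (4 / K)).+1)%N by rewrite leq_max orbT.
  move: (maxn _ _) => e e0; rewrite ler_pdivrMr // => h; rewrite -div1r ler_pdivrMr ?ltr0n //; lra.
have e0 : (0 < e)%N by apply: leq_trans e10.
have [a aE] : exists a, a = K / 4 by exists (K / 4).
have a0 : 0 < a by rewrite aE divr_gt0.
have C1 : 0 <= 8 * 4 * 3 ^+ 12 :> R by do ?apply: mulr_ge0 => //; exact: exprn_ge0.
have C2 : 0 <= 12 * 18 ^+ 2 * 4 * 3 ^+ 12 / a :> R.
  by apply: divr_ge0; [do ?apply: mulr_ge0 => //; exact: exprn_ge0|exact: ltW].
apply: evt_impl (evt_and (evt_card_relaxed R e10) (evt_and (evt_ge (8 * e)) (evt_and (evt_bad_weight 12 C1 e0)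
  (evt_and (evt_bad_weight 18 C2 e0) (evt_and (evt_ge_real (216 / a)) (evt_and (evt_ge_real (4 / c)) (@evt_pow2 R 240 4))))))).
move=> d [rel [ed [w1 [w2 [da [dc d240]]]]]] n n_even n2.
have d0 : (0 < d)%N by apply: leq_trans ed; rewrite muln_gt0.
have g0 : 0 <= gain R e d.
  by rewrite invr_ge0; do ?apply: mulr_ge0 => //; rewrite ?sqrtr_ge0 // ln_ge0 // ler1n.
have chess (J : {set torus n.+2 d}) := chessboard n_even J d0 rel.
have dr0 : 0 < d%:R :> R by rewrite ltr0n.
pose l : R := n.+2%:R; pose X : R := l ^+ d.-1 / d%:R ^+ 4.
have l1 : 1 <= l by rewrite ler1n.
have l0 : 0 < l by lra.
have X0 : 0 < X by rewrite divr_gt0 ?exprn_gt0.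
have VE : #|{: torus n.+2 d}|%:R = l * X * d%:R ^+ 4 :> R.
  rewrite card_ffun !card_ord natrX -/l -{1}(prednK d0) exprS /X.
  by field; exact: lt0r_neq0.
(* 240 = 3 * 80: the three error terms are each at most exp(- 2 X), and their sum has to be at most
   exp(- X) / 80. *)
have X240 : 240 <= expR X.
  apply: le_trans (expR_ge1Dx X); apply: ler_wpDl => //; rewrite /X ler_pdivlMr ?exprn_gt0 //.
  apply: (le_trans d240); rewrite /l -!natrX ler_nat; apply: pow2_le_volume => //.
  by apply: leq_trans ed; rewrite (@leq_trans (8 * 1)) // leq_mul2l.
have [rate1 rate2] := balanced_rates a0 c0 d0 da dc l1 VE X0.
have w0 : 0 <= bad_weight d e (gain R e d) by rewrite mulr_ge0 ?exprn_ge0 ?expR_ge0.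
have [y8 ya] := contour_weight_bounds d0 w0 a0 w1 w2.
have aK : a + e%:R^-1 <= K / 2 by rewrite aE; lra.
have rhoK : rho + K <= 1 / 2 - eta by rewrite etaE in Keta *; lra.
apply: le_trans (card_balanced_le n_even n2 e0 ed g0 (ltW a0) chess y8 ya aK rhoK lop) _.
apply: ler_wpM2l => //; rewrite -/l -/X.
have r1 : expR (- (a * #|{: torus n.+2 d}|%:R / (6 * (2 * d * (2 * d).+1 ^ 2 * n.+2)%:R))) <= expR (- X) * expR (- X).
  by rewrite -expRD ler_expR natrM -/l; move: rate1; move: (_ / _) => r; lra.
have r2 : expR (- (c * (#|{: torus n.+2 d}|%:R / 2))) <= expR (- X) * expR (- X).
  by rewrite -expRD ler_expR; move: rate2; move: (c * _) => r; lra.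
have E240 : expR (- X) <= 240^-1 by rewrite expRN lef_pV2 ?posrE ?expR_gt0.
have h := ler_wpM2l (expR_ge0 (- X)) E240.
by move: r1 r2 h; move: (expR (- X)) (expR (- (a * _ / _))) (expR (- (c * _))) => E u v; lra.
Qed.

End Balanced.

(** * The bottleneck *)

Section ExitProbability.
Variables (R : realType) (S : finType) (M : markov_chain R S) (A : {set S}).
Implicit Types (x y z : S) (t : nat).

Lemma trans_ge0 x y : 0 <= M x y.
Proof. by case: (transP M x). Qed.

Lemma trans_sum x : \sum_y M x y = 1.
Proof. by case: (transP M x). Qed.

Lemma trans_iter_ge0 t x y : 0 <= trans_iter M t x y.
Proof.
elim: t y => [|t IH] y /=; first by case: (_ == _).
by apply: sumr_ge0 => z _; rewrite mulr_ge0 ?trans_ge0.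
Qed.

Lemma trans_iter_sum t x : \sum_y trans_iter M t x y = 1.
Proof.
elim: t => [|t IH] /=.
  by rewrite (bigD1 x) //= eqxx big1 ?addr0 // => y; rewrite eq_sym => /negbTE->.
rewrite exchange_big /= -[RHS]IH; apply: eq_bigr => z _.
by rewrite -mulr_sumr trans_sum mulr1.
Qed.

(** [trans_iter] appends the last step, whereas exit probabilities are decomposed at the first. *)
Lemma trans_iterS t x y : trans_iter M t.+1 x y = \sum_z M x z * trans_iter M t z y.
Proof.
elim: t x y => [|t IH] x y.
  rewrite /= (bigD1 x) //= eqxx mul1r [X in _ + X]big1 ?addr0; last first.
    by move=> z; rewrite eq_sym => /negbTE->; rewrite mul0r.
  by rewrite (bigD1 y) //= eqxx mulr1 big1 ?addr0 // => z /negbTE->; rewrite mulr0.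
transitivity (\sum_z \sum_w M x w * trans_iter M t w z * M z y).
  by apply: eq_bigr => z _; rewrite -mulr_suml -IH.
rewrite exchange_big /=; apply: eq_bigr => w _.
by rewrite mulr_sumr; apply: eq_bigr => z _; rewrite mulrA.
Qed.

(** The probability that the chain started at x is outside A at some time up to t. *)
Fixpoint exit_prob t x : R :=
  if x \in A then (if t is t'.+1 then \sum_y M x y * exit_prob t' y else 0) else 1.

Lemma exit_prob_ge0 t x : 0 <= exit_prob t x.
Proof.
elim: t x => [|t IH] x /=; case: ifP => // _.
by apply: sumr_ge0 => y _; rewrite mulr_ge0 ?trans_ge0.
Qed.

Lemma exit_prob_out t x : x \notin A -> exit_prob t x = 1.
Proof. by case: t => [|t] /= /negbTE->. Qed.

Lemma trans_iter_out_le t x : \sum_(y | y \notin A) trans_iter M t x y <= exit_prob t x.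
Proof.
elim: t x => [|t IH] x; have [xA|xA] := boolP (x \in A).
- rewrite /= xA big1 // => y yA; case: eqP => // e; by rewrite -e xA in yA.
- rewrite exit_prob_out // -(trans_iter_sum 0 x) [leRHS](bigID (fun y => y \notin A)) /= lerDl.
  by apply: sumr_ge0 => y _; exact: ler0n.
- rewrite (eq_bigr (fun y => \sum_z M x z * trans_iter M t z y)); last by move=> y _; exact: trans_iterS.
  rewrite exchange_big /= xA; apply: ler_sum => z _.
  by rewrite -mulr_sumr ler_wpM2l ?trans_ge0.
rewrite exit_prob_out // -(trans_iter_sum t.+1 x) [leRHS](bigID (fun y => y \notin A)) /= lerDl.
by apply: sumr_ge0 => y _; apply: (trans_iter_ge0 t.+1).
Qed.

Variable B : {set S}.
Hypothesis doubly : forall y, \sum_x M x y = 1.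
Hypothesis barrier : forall x y, x \in A -> M x y != 0 -> (y \in A) || (y \in B).

(* Double stochasticity: one step leaks at most |B| out of A. *)
Lemma sum_exit_prob t : \sum_(x in A) exit_prob t x <= t%:R * #|B|%:R.
Proof.
elim: t => [|t IH].
  by rewrite mul0r big1 // => x xA; rewrite /= xA.
apply: (@le_trans _ _ (\sum_(x in A) (\sum_(y in A) M x y * exit_prob t y + \sum_(y in B) M x y))).
  apply: ler_sum => x xA; rewrite /= xA (bigID (fun y => y \in A)) /=; apply: lerD => //.
  rewrite [leLHS]big_mkcond [leRHS]big_mkcond /=; apply: ler_sum => y _.
  have [yA|yA] := boolP (y \in A); first by case: ifP => // _; exact: trans_ge0.
  rewrite exit_prob_out // mulr1; case: ifP => // yB.
  by have [->//|/(barrier xA)] := eqVneq (M x y) 0; rewrite (negbTE yA) yB.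
rewrite big_split /= -natr1 mulrDl mul1r; apply: lerD.
  apply: le_trans IH; rewrite exchange_big /=; apply: ler_sum => y _.
  rewrite -mulr_suml -[leRHS]mul1r ler_wpM2r ?exit_prob_ge0 // -(doubly y).
  by rewrite [leLHS]big_mkcond; apply: ler_sum => x _; case: ifP => // _; exact: trans_ge0.
rewrite exchange_big /= -sumr_const; apply: ler_sum => y _; rewrite -(doubly y).
by rewrite [leLHS]big_mkcond; apply: ler_sum => x _; case: ifP => // _; exact: trans_ge0.
Qed.

Lemma tv_dist_uniform_ge t x :
  1 - exit_prob t x - #|A|%:R / #|S|%:R <= tv_dist (trans_iter M t x) (uniform_distr R S).
Proof.
have S0 : 0 < #|S|%:R :> R by rewrite ltr0n; apply/card_gt0P; exists x.
have out := trans_iter_out_le t x.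
pose p := trans_iter M t x; pose u : R := #|S|%:R^-1.
have inA : \sum_(y in A) p y = 1 - \sum_(y | y \notin A) p y.
  by apply/eqP; rewrite eq_sym subr_eq -(trans_iter_sum t x) [eqbLHS](bigID (mem A)).
rewrite /tv_dist [2^-1 * _]mulrC ler_pdivlMr // (bigID (mem A)) /=.
have h1 : \sum_(y in A) p y - #|A|%:R * u <= \sum_(y in A) `|p y - uniform_distr R S y|.
  rewrite [_ * u]mulr_natl -sumr_const -sumrB; apply: ler_sum => y _; exact: ler_norm.
have h2 : #|~: A|%:R * u - \sum_(y | y \notin A) p y <= \sum_(y | y \notin A) `|p y - uniform_distr R S y|.
  rewrite [_ * u]mulr_natl -sumr_const (eq_bigl (fun y => y \notin A)) => [|y]; last by rewrite inE.
  by rewrite -sumrB; apply: ler_sum => y _; rewrite distrC; exact: ler_norm.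
have cA : #|~: A|%:R * u = 1 - #|A|%:R * u.
  have -> : #|~: A|%:R = #|S|%:R - #|A|%:R :> R.
    by apply/eqP; rewrite eq_sym subr_eq addrC -natrD cardsC.
  by rewrite mulrBl {1}/u mulfV ?lt0r_neq0.
rewrite cA in h2; rewrite inA in h1.
move: h1 h2 out; rewrite -/p -/u.
move: (\sum_(y in A) `|_|) (\sum_(y | y \notin A) `|_|) (\sum_(y | y \notin A) p y) (exit_prob t x) (#|A|%:R * u) => a b c' q' w; lra.
Qed.

(** Averaging the exit probability over A yields a start x where it is at most 2/25. The distance at
    time T is then at least 1 - 2/25 - 1/2 = 42/100, above 41/100 > 1/e. *)
Lemma mixing_time_ge (T : nat) : (0 < #|A|)%N -> 2 * #|A|%:R <= #|S|%:R :> R ->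
  25 * (T%:R * #|B|%:R) <= 2 * #|A|%:R :> R ->
  ((T%:R : R)%:E <= mixing_time M (uniform_distr R S))%E.
Proof.
move=> A0 half few.
have Ar : 0 < #|A|%:R :> R by rewrite ltr0n.
have [x xA qx] : exists2 x, x \in A & exit_prob T x <= 2 / 25.
  apply/exists_inP; apply: contraT => /exists_inPn large.
  have : \sum_(x in A) (2 / 25 : R) < \sum_(x in A) exit_prob T x.
    have [x0 x0A] := card_gt0P A0.
    by apply: ltr_sum; [apply/hasP; exists x0; rewrite ?mem_index_enum|move=> x xA; rewrite ltNge large].
  rewrite sumr_const -mulr_natl => h; have := lt_le_trans h (sum_exit_prob T).
  by move: few; move: (T%:R * _) => b; lra.
have S0 : 0 < #|S|%:R :> R by rewrite ltr0n; apply/card_gt0P; exists x.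
have e1 : (expR 1)^-1 < 41 / 100 :> R.
  have h : 5 / 4 <= expR (1 / 4) :> R by apply: le_trans (expR_ge1Dx _); lra.
  have h4 : (5 / 4) ^+ 4 <= expR 1 :> R.
    rewrite (_ : expR 1 = expR (1 / 4) ^+ 4); last by rewrite -expRM_natl; congr expR; field.
    by apply: lerXn2r => //; rewrite nnegrE ?expR_ge0 //; lra.
  apply: (@le_lt_trans _ _ ((5 / 4) ^+ 4)^-1); first by rewrite lef_pV2 ?posrE ?expR_gt0 // exprn_gt0 //; lra.
  by rewrite invf_plt ?posrE; [lra|apply: exprn_gt0; lra|lra].
rewrite /mixing_time; apply: (le_trans _ (le_bigmax _ _ x)).
(* A time t0 < T in [mixed_after] would make the chain mixed at time T itself. *)
apply: le_ereal_inf_tmp => _ [t0 /= mix <-]; rewrite lee_fin ler_nat leqNgt; apply/negP => t0T.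
have := le_trans (tv_dist_uniform_ge T x) (mix T t0T); apply/negP; rewrite -ltNge.
apply: (lt_le_trans e1).
have : #|A|%:R / #|S|%:R <= 1 / 2 :> R by rewrite ler_pdivrMr //; lra.
by move: qx; move: (exit_prob T x) (#|A|%:R / #|S|%:R) => q r; lra.
Qed.

End ExitProbability.

(** * The imbalance under translations and local moves *)

Section Translation.
Variables (R : realType) (n d : nat).
Hypothesis n_even : ~~ odd n.
Local Notation V := (torus n.+2 d).
Implicit Types (I J : {set V}) (i : 'I_d).

Definition translate i I : {set V} := [set x : V | x - unitv n i \in I].

Lemma translate_inj i : injective (translate i).
Proof.
move=> I J /setP h; apply/setP => x; have := h (x + unitv n i).
by rewrite !in_set addrK.
Qed.

Lemma independent_translate i I : independent I -> independent (translate i I).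
Proof.
move=> /independentP ind; apply/independentP => x k; rewrite !in_set => xI.
by rewrite addrAC; exact: ind.
Qed.

Lemma card_translate_sublattice i I s : #|translate i I :&: sublattice n d s| = #|I :&: sublattice n d (~~ s)|.
Proof.
rewrite -(card_imset _ (addIr (unitv n i))) -[in RHS](card_imset _ (addIr (unitv n i))) /=.
rewrite card_imset; last exact: addIr.
apply: eq_card => x; rewrite in_setI in_set in_set; apply/idP/imsetP => [/andP[xI xs]|[y]].
  exists (x - unitv n i); last by rewrite subrK.
  rewrite in_setI xI in_set; have := parity_unitv n_even (x - unitv n i) i.
  by rewrite subrK (eqP xs) => ->; rewrite negbK eqxx.
by rewrite in_setI in_set => /andP[yI /eqP ys] ->; rewrite addrK yI parity_unitv // ys negbK eqxx.
Qed.

Lemma imbalance_translate i I : imbalance R (translate i I) = - imbalance R I.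
Proof. by rewrite /imbalance !card_translate_sublattice opprB. Qed.

Lemma imbalance_lipschitz I J : `|imbalance R I - imbalance R J| <= #|symdiff I J|%:R.
Proof.
pose sgn (x : V) : R := (-1) ^+ (parity x).
have imbE (A : {set V}) : imbalance R A = \sum_(x in A) sgn x.
  have part s : \sum_(x in A :&: sublattice n d s) sgn x = (-1) ^+ s * #|A :&: sublattice n d s|%:R.
    rewrite (eq_bigr (fun=> (-1) ^+ s)) ?sumr_const ?mulr_natr // => x.
    by rewrite in_setI in_set => /andP[_ /eqP <-].
  rewrite (big_setID (sublattice n d false)) /=.
  have -> : A :\: sublattice n d false = A :&: sublattice n d true.
    by apply/setP => x; rewrite !inE andbC; case: (parity x).
  by rewrite !part mul1r mulN1r.
have -> : imbalance R I - imbalance R J = \sum_(x in symdiff I J) (if x \in I then sgn x else - sgn x).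
  rewrite !imbE [\sum_(x in I) _]big_mkcond [\sum_(x in J) _]big_mkcond -sumrB [RHS]big_mkcond.
  apply: eq_bigr => x _; rewrite !inE; case: (x \in I); case: (x \in J) => /=; by rewrite ?subrr ?subr0 ?sub0r.
apply: le_trans (ler_norm_sum _ _ _) _; rewrite -sumr_const; apply: ler_sum => x _.
by case: ifP => _; rewrite ?normrN normrX normrN1 expr1n.
Qed.

End Translation.

Lemma ln_ge1 (R : realType) (L : nat) : (4 <= L)%N -> 1 <= ln (L%:R : R).
Proof.
move=> L4; apply: (@le_trans _ _ (ln 4)); last by rewrite ler_ln ?posrE ?ler_nat // ltr0n; apply: leq_trans L4.
have -> : 4 = 2 ^+ 2 :> R by ring.
by rewrite lnXn // mulr2n; have := ln2_ge_half R; lra.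
Qed.

Section BottleneckMixing.
Variables (R : realType) (n d : nat) (w : R).
Hypotheses (n_even : ~~ odd n) (d0 : (0 < d)%N) (w0 : 0 < w).
Local Notation S := (indset n.+2 d).
Local Notation V := (torus n.+2 d).
Variable M : markov_chain R S.
Hypothesis unif : stationary M (uniform_distr R S).
Hypothesis steps : forall I J : S, M I J != 0 -> #|symdiff (val I) (val J)|%:R <= 2 * w.

Lemma uniform_doubly (J : S) : \sum_I M I J = 1.
Proof.
have [_ /(_ J)] := unif; rewrite /uniform_distr -mulr_sumr => h.
have S0 : #|{: S}|%:R != 0 :> R by rewrite pnatr_eq0 -lt0n; apply/card_gt0P; exists J.
by apply: (mulfI (invr_neq0 S0)); rewrite h mulr1.
Qed.

(** A unit translation exchanges [pos] and [neg], so 2 #|pos| lies between 79/80 of all independent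
    sets and all of them. As T x <= 2, T #|bal| is at most a 1/40 of them, and 25/40 < 79/80. *)
Lemma bottleneck_mixing (T : nat) (x : R) :
  #|[set I : {set V} | independent I && (`|imbalance R I| <= w)]|%:R <=
     #|[set I : {set V} | independent I]|%:R * (x / 80) ->
  T%:R * x <= 2 -> x <= 1 ->
  ((T%:R : R)%:E <= mixing_time M (uniform_distr R S))%E.
Proof.
move=> mid Tx x1; pose i0 := Ordinal d0.
pose Om := [set I : {set V} | independent I].
pose pos := [set I in Om | w < imbalance R I]; pose neg := [set I in Om | imbalance R I < - w].
pose bal := [set I : {set V} | independent I && (`|imbalance R I| <= w)].
have tr (A B : {set {set V}}) : (forall I, I \in A -> translate i0 I \in B) -> (#|A| <= #|B|)%N.
  move=> h; rewrite -(card_imset _ (@translate_inj n d i0)); apply: subset_leq_card.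
  by apply/subsetP => J /imsetP[I IA ->]; exact: h.
have pn : #|pos| = #|neg|.
  apply/eqP; rewrite eqn_leq; apply/andP; split; apply: tr => I; rewrite !in_set => /andP[ind h].
    by rewrite (independent_translate i0 ind) imbalance_translate // ltrN2.
  by rewrite (independent_translate i0 ind) imbalance_translate // ltrNr.
have cardS (P : pred {set V}) : #|[set I : S | P (val I)]| = #|[set I in Om | P I]|.
  rewrite -(card_imset _ val_inj); apply: eq_card => I; apply/imsetP/idP => [[J]|].
    move=> PJ ->; rewrite in_set (_ : val J \in Om); last by rewrite in_set (valP J).
    by rewrite in_set in PJ.
  by rewrite !in_set => /andP[ind PI]; exists (Sub I ind); rewrite ?in_set SubK.
have cS : #|{: S}| = #|Om|.
  rewrite -cardsT (_ : setT = [set I : S | predT (val I)]) ?cardS; last by apply/setP => I; rewrite !inE.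
  by apply: eq_card => I; rewrite !in_set andbT.
have cbal : #|bal| = #|[set I in Om | `|imbalance R I| <= w]|.
  by apply: eq_card => I; rewrite !in_set.
have wpos I : w < imbalance R I -> (imbalance R I < - w) = false.
  by move=> h; apply/negbTE; rewrite -leNgt (le_trans _ (ltW h)) //; move: w0; lra.
have upper : (2 * #|pos| <= #|Om|)%N.
  have -> : (2 * #|pos| = #|pos :|: neg|)%N.
    rewrite cardsU (_ : pos :&: neg = set0) ?cards0 ?subn0 -?pn ?mul2n ?addnn //.
    by apply/setP => I; rewrite !in_set; case: (boolP (w < imbalance R I)) => [/wpos ->|_]; rewrite ?andbF.
  by apply: subset_leq_card; apply/subsetP => I; rewrite !in_set => /orP[] /andP[].
have lower : (#|Om| <= 2 * #|pos| + #|bal|)%N.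
  have sub : Om \subset (pos :|: neg) :|: bal.
    apply/subsetP => I; rewrite in_set => ind; rewrite !in_set ind /= ler_norml.
    by case: (ltP w (imbalance R I)) => //= h; case: (ltP (imbalance R I) (- w)).
  apply: leq_trans (subset_leq_card sub) _.
  have [c1 _] := leq_card_setU (pos :|: neg) bal; have [c2 _] := leq_card_setU pos neg.
  by apply: leq_trans c1 _; rewrite leq_add2r; apply: leq_trans c2 _; rewrite -pn mul2n addnn.
have Om0 : (0 < #|Om|)%N.
  by apply/card_gt0P; exists set0; rewrite in_set; apply/independentP => y i; rewrite inE.
pose A := [set I : S | w < imbalance R (val I)]; pose B := [set I : S | `|imbalance R (val I)| <= w].
have cA : #|A| = #|pos| by exact: (cardS (fun I => w < imbalance R I)).
have cB : #|B| = #|bal| by rewrite cbal; exact: (cardS (fun I => `|imbalance R I| <= w)).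
have arith (T' x' Z p b : R) : 0 <= T' -> b <= Z * (x' / 80) -> T' * x' <= 2 -> x' <= 1 -> 2 * p <= Z ->
    Z <= 2 * p + b -> 1 <= Z -> 0 < p /\ 25 * (T' * b) <= 2 * p.
  move=> T0 hb hT hx h1 h2 h3.
  have k1 := ler_wpM2l T0 hb; have k2 := ler_wpM2l (_ : 0 <= Z) hT; have k3 := ler_wpM2l (_ : 0 <= Z) hx.
  have Z0 : 0 <= Z by lra.
  have {}k2 := k2 Z0; have {}k3 := k3 Z0.
  move: hb k1 k2 k3; rewrite (_ : T' * (Z * (x' / 80)) = Z * (T' * x') / 80); last by field.
  rewrite (_ : Z * (x' / 80) = Z * x' / 80); last by field.
  move: (Z * (T' * x')) (Z * x') (T' * b) => u v t; split; lra.
have [] := arith T%:R x #|Om|%:R #|pos|%:R #|bal|%:R _ mid Tx x1 _ _ _ => //.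
- by rewrite -natrM ler_nat.
- by rewrite -natrM -natrD ler_nat.
- by rewrite ler1n.
move=> p0 few; apply: (@mixing_time_ge R S M A B uniform_doubly).
(* A step changes the imbalance by at most 2 w, so from above w it lands at - w or above. *)
- move=> I J; rewrite !in_set => IA MIJ; rewrite ler_norml.
  have := le_trans (imbalance_lipschitz R (val I) (val J)) (steps MIJ); rewrite ler_norml => /andP[_ h].
  case: (ltP w (imbalance R (val J))) => //= _; rewrite andbT.
  by move: h IA; move: (imbalance R (val I)) (imbalance R (val J)) => u v; lra.
- by rewrite cA -(ltr_nat R).
- by rewrite cA cS -natrM ler_nat.
- by rewrite cA cB.
Qed.

End BottleneckMixing.

Theorem corollary1p4 (R : realType) (rho : R) (hrho : rho < 1 / 2) :
  exists d0 : R, 0 < d0 /\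
    forall (L d : nat), (4 <= L)%N -> ~~ odd L -> d0 <= d%:R ->
    forall M : markov_chain R (indset L d),
      ergodic M -> local_chain rho M ->
      stationary M (uniform_distr R (indset L d)) ->
      ((expR (L%:R ^+ (d - 1) / (d%:R ^+ 4 * ln (L%:R : R) ^+ 2)))%:E
         <= mixing_time M (uniform_distr R (indset L d)))%E.
Proof.
(* rho need not be positive; a chain that is local for rho is local for any larger r. *)
have [r [r0 r1 rr]] : exists r : R, [/\ 0 < r, r < 1 / 2 & rho <= r].
  by exists (Num.max rho (1 / 4)); rewrite lt_max gt_max le_max lexx hrho; split => //; [apply/orP; right|]; lra.
have [N balanced] := card_balanced r0 r1.
exists N.+1%:R; split=> //; case=> [|[|n]] // d L4 L_even; rewrite ler_nat => Nd M _ local unif.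
have n2 : (1 < n)%N by [].
have n_even : ~~ odd n by rewrite /= negbK in L_even.
have d0 : (0 < d)%N by apply: leq_trans Nd.
have dr0 : 0 < d%:R :> R by rewrite ltr0n.
pose X : R := n.+2%:R ^+ d.-1 / d%:R ^+ 4.
have X0 : 0 <= X by rewrite divr_ge0 ?exprn_ge0.
pose Y : R := n.+2%:R ^+ (d - 1) / (d%:R ^+ 4 * ln (n.+2%:R : R) ^+ 2).
have YX : Y <= X.
  have l1 : 1 <= ln (n.+2%:R : R) ^+ 2 by rewrite exprn_ege1 // ln_ge1.
  have D0 : 0 < d%:R ^+ 4 :> R by exact: exprn_gt0.
  rewrite /Y /X subn1; apply: ler_wpM2l; first exact: exprn_ge0.
  move: (ln _ ^+ 2) l1 (d%:R ^+ 4) D0 => z z1 D D0.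
  rewrite lef_pV2 ?posrE ?mulr_gt0 //; last exact: lt_le_trans z1.
  by rewrite -[leLHS]mulr1 ler_wpM2l // ltW.
(* T exceeds exp Y, while T <= exp Y + 1 keeps T exp(- X) at most 2. *)
pose T := (Num.truncn (expR Y)).+1.
have w0 : 0 < r / 2 * #|{: torus n.+2 d}|%:R.
  by rewrite mulr_gt0 ?divr_gt0 // ltr0n; apply/card_gt0P; exists 0.
have steps (I J : indset n.+2 d) : M I J != 0 -> #|symdiff (val I) (val J)|%:R <= 2 * (r / 2 * #|{: torus n.+2 d}|%:R).
  move=> /local h; apply: (le_trans h); rewrite mulrA mulrCA mulfV ?pnatr_eq0 // mulr1.
  by rewrite ler_wpM2r.
apply: (@le_trans _ _ (T%:R : R)%:E).
  by rewrite lee_fin; apply: ltW; exact: truncnS_gt.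
have mid := balanced d (ltnW Nd) n n_even n2.
apply: (bottleneck_mixing n_even d0 w0 unif steps mid); last first.
  by rewrite -/X expRN invf_le1 ?expR_gt0 // -expR0 ler_expR.
rewrite -/X /T -natr1 expRN ler_pdivrMr ?expR_gt0 //.
have tr : (Num.truncn (expR Y))%:R <= expR X :> R.
  by apply: (@le_trans _ _ (expR Y)); [rewrite truncn_le expR_ge0|rewrite ler_expR].
have e1 : 1 <= expR X by rewrite -expR0 ler_expR.
by move: tr e1; move: (expR X) (_%:R) => u v; lra.
Qed.
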